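(* For all $1<p,q<\infty$ with $\frac1p+\frac1q=1$, there exist $d_p,d_q\in\mathbb{R}$ such that the following holds. If $\Lambda=(\lambda_j)_{j\in\mathbb{Z}}$ and $M=(\mu_j)_{j\in\mathbb{Z}}$ are real sequences with $\lambda_j<\lambda_{j+1}$ and $\mu_j<\mu_{j+1}$ for all $j\in\mathbb{Z}$, $\lim_{j\to\pm\infty}\lambda_j=\pm\infty$, $\lim_{j\to\pm\infty}\mu_j=\pm\infty$, and $$\sup_{j\in\mathbb{Z}}(|\lambda_j|+d_p)^{p-1}(\lambda_{j+1}-\lambda_j)\le\tfrac12\quad\text{and}\quad\sup_{j\in\mathbb{Z}}(|\mu_j|+d_q)^{q-1}(\mu_{j+1}-\mu_j)\le\tfrac12,$$ then $(\Lambda,M)$ is a Fourier uniqueness pair for $\mathcal{H}$.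
   Context: Fourier transform: $\hat f(\xi)=\int_{\mathbb{R}}f(x)e^{-2\pi ix\xi}\,dx$. $\mathcal{H}:=\{f\in L^2(\mathbb{R}):\int_{\mathbb{R}}(1+x^2)|f(x)|^2\,dx+\int_{\mathbb{R}}(1+\xi^2)|\hat f(\xi)|^2\,d\xi<\infty\}$; for $f\in\mathcal{H}$, both $f$ and $\hat f$ are identified with their continuous representatives. A pair $(\Lambda,M)$ of subsets of $\mathbb{R}$ (sequences being identified with their sets of values) is a Fourier uniqueness pair for $\mathcal{H}$ if $f\in\mathcal{H}$, $f|_\Lambda=0$ and $\hat f|_M=0$ imply $f\equiv0$. *)

(* Defs.v *)
From HB Require Import structures.
From mathcomp Require Import all_boot all_order all_algebra.
From mathcomp Require Import complex.
From mathcomp Require Import all_classical all_reals all_analysis.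

Set Implicit Arguments.
Unset Strict Implicit.
Unset Printing Implicit Defensive.

Import Order.TTheory GRing.Theory Num.Theory.
Import numFieldNormedType.Exports.

Local Open Scope classical_set_scope.
Local Open Scope complex_scope.
Local Open Scope ring_scope.

Section FourierUniquenessPairs.
Variable R : realType.
Implicit Types (f : R -> R[i]) (L M : set R) (u : int -> R).

Notation mu := (@lebesgue_measure R).

Definition modulus (z : R[i]) : R := ComplexField.Normc.normc z.

(* e^{it} *)
Definition expi (t : R) : R[i] := cos t +i* sin t.

(* The library has no integral of complex-valued functions; as with
   [Rintegral], the value is meaningful only for integrable [f]. *)
Definition cintegral f : R[i] :=
  (\int[mu]_x complex.Re (f x)) +i* (\int[mu]_x complex.Im (f x)).

Definition fourier f : R -> R[i] :=
  fun xi => cintegral (fun x => f x * expi (- (2 * pi * x * xi))).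

Definition cmeasurable f : Prop :=
  measurable_fun setT (fun x => complex.Re (f x)) /\
  measurable_fun setT (fun x => complex.Im (f x)).

Definition square_integrable f : Prop :=
  cmeasurable f /\ finite_norm mu 2%:E (fun x => modulus (f x)).

Definition weighted_energy f : \bar R :=
  (\int[mu]_x ((1 + x ^+ 2) * modulus (f x) ^+ 2)%:E)%E.

(* Finiteness of the first energy forces [f] to be integrable (Cauchy-Schwarz),
   so that [fourier f] is then the L^2 Fourier transform of [f]; no extension
   by density is needed. *)
Definition in_H f : Prop :=
  square_integrable f /\
  (weighted_energy f + weighted_energy (fourier f) < +oo)%E.

(* The elements of H are represented by their continuous representatives,
   hence the continuity of [f] ([R[i]^o] only selects the topology of the
   modulus on [R[i]]); that of [fourier f] is automatic since [f] is
   integrable. *)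
Definition fourier_uniqueness_pair L M : Prop :=
  forall f, in_H f -> continuous (f : R -> R[i]^o) ->
    (forall x, L x -> f x = 0) ->
    (forall xi, M xi -> fourier f xi = 0) ->
    forall x, f x = 0.

Definition int_strictly_increasing u : Prop := forall j : int, u j < u (j + 1).

(* u_j --> +oo as j --> +oo and u_j --> -oo as j --> -oo; the library has no
   filters at the ends of [int]. *)
Definition int_diverges u : Prop :=
  (u n%:Z @[n --> \oo] --> +oo) /\ (u (- n%:Z) @[n --> \oo] --> -oo).

(* [powR] takes the junk value 1 at a negative base, which is only possible for
   d < 0.  For p > 1 the supremum for d = 1 dominates the one for any d < 0
   (for increasing [u]), so such values do not make it easier to find a
   suitable [d]. *)
Definition gap_sup (p d : R) u : \bar R :=
  ereal_sup (range (fun j : int =>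
    (((`|u j| + d) `^ (p - 1)) * (u (j + 1) - u j))%:E)).

End FourierUniquenessPairs.

(* Main.v *)
Require Import Defs.
From mathcomp Require Import all_boot all_order all_algebra.
From mathcomp Require Import complex.
From mathcomp Require Import all_classical all_reals all_analysis.
From mathcomp Require Import measurable_realfun.
From mathcomp Require Import ring lra zify.

Set Implicit Arguments.
Unset Strict Implicit.
Unset Printing Implicit Defensive.

Import Order.TTheory GRing.Theory Num.Theory.
Import numFieldNormedType.Exports.

Local Open Scope classical_set_scope.
Local Open Scope complex_scope.
Local Open Scope ring_scope.

(** Put r = q - 1, so that p - 1 = 1/r.  By Fourier inversion the map sending f
    to the conjugate of its transform is an involution; it exchanges the roles
    of (p, lam) and (q, mu), so r >= 1 may be assumed ([conj_fourier_swap]).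

    The engine is Wirtinger's inequality: a function h vanishing at both ends of
    an interval of length L satisfies (pi/L)^2 |h|^2 <= |h'|^2 in integrated
    form.  Summed over the gaps of a sequence, it says ([wirtinger_fourier]):
    if fourier F vanishes on a sequence whose gaps around y have length at most
    1/(2 w(y)), then

      int w^2 |fourier F|^2 <= int x^2 |F|^2.

    Write N = int |f|^2 and E = int x^2 |f|^2.  Since fourier f vanishes on mu,
    the inequality with w(y) = (|y| + d)^r gives

      int (|eta| + d)^(2r) |fourier f|^2 <= E,

    and it is enough to prove that N + E is at most the left-hand side: then
    N = 0.  For r = 1 this is the same inequality for f and lam.  For r > 1 the
    gaps of lam only give the weight (|x| + 3)^(2/r) against xi^2 |fourier f|^2,
    and both weights have to be raised to the power r.  This can be done where
    the first weight is almost constant, so f is localized: let g be a window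
    supported in [-1, 1] with int g^2 = 1.  The function y |-> f y * g (y - x)
    still vanishes on lam; let V(x, .) be its transform and W(x) its squared
    L^2 norm.  With P = (|x| + 2)^(2/r), Wirtinger gives

      P W(x) <= int xi^2 |V(x, xi)|^2   ([windowed_wirtinger]),

    and the tangent inequality r P^(r-1) Q <= Q^r + (r - 1) P^r at Q = xi^2,
    integrated against |V(x, .)|^2, turns this by Bessel's inequality into

      (|x| + 2)^2 W(x) <= int |xi|^(2r) |V(x, xi)|^2   ([windowed_young]).

    Now integrate over x.  The left-hand side becomes at least N + E, because
    1 + y^2 <= (|x| + 2)^2 for |x - y| <= 1 ([stft_energy_time]).  On the right,
    V(., xi) has the modulus of the transform of
    eta |-> conj (fourier f eta) * fourier g (eta - xi), so Bessel's inequality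
    in x bounds the result by the integral of |fourier f(eta)|^2 against
    int |xi|^(2r) |fourier g(eta - xi)|^2 dxi, which is at most (|eta| + d)^(2r)
    as soon as d dominates the moment of order 2r of |fourier g|^2
    ([stft_energy_freq]).  A smooth enough window has such a moment, and d
    depends on r and g alone.

    Of the Fourier transform the argument uses only Bessel's inequality and
    inversion at points of continuity.  Both follow from the multiplication
    formula with the factor exp (- e |x|), whose transform is the Poisson
    kernel. *)

(** * Complex-valued measurable functions *)

Section Modulus.
Variable R : realType.
Implicit Types (z w : R[i]).

Lemma sqr_modulus z : modulus z ^+ 2 = complex.Re z ^+ 2 + complex.Im z ^+ 2.
Proof. by case: z => a b; rewrite /modulus /= sqr_sqrtr// addr_ge0// sqr_ge0. Qed.

Lemma modulus_ge0 z : 0 <= modulus z.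
Proof. by case: z => a b; rewrite /modulus /= sqrtr_ge0. Qed.

Lemma modulusM z w : modulus (z * w) = modulus z * modulus w.
Proof. exact: ComplexField.Normc.normcM. Qed.

Lemma modulusJ z : modulus (conjc z) = modulus z.
Proof. by case: z => a b; rewrite /modulus /= sqrrN. Qed.

Lemma modulus_real (x : R) : modulus (x%:C)%C = `|x|.
Proof. by rewrite /modulus /= expr0n addr0 sqrtr_sqr. Qed.

Lemma modulus_expi (t : R) : modulus (expi t) = 1.
Proof. by rewrite /modulus /expi /= cos2Dsin2 sqrtr1. Qed.

Lemma ler_Re z : `|complex.Re z| <= modulus z.
Proof.
by rewrite -sqrtr_sqr; case: z => a b; apply: ler_wsqrtr; rewrite lerDl sqr_ge0.
Qed.

Lemma ler_Im z : `|complex.Im z| <= modulus z.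
Proof.
by rewrite -sqrtr_sqr; case: z => a b; apply: ler_wsqrtr; rewrite lerDr sqr_ge0.
Qed.

Lemma modulus_eq0 z : modulus z = 0 -> z = 0.
Proof. exact: ComplexField.Normc.eq0_normc. Qed.

Lemma modulus0 : modulus (0 : R[i]) = 0.
Proof. exact: ComplexField.Normc.normc0. Qed.

Lemma complex_ReM z w : complex.Re (z * w) =
  complex.Re z * complex.Re w - complex.Im z * complex.Im w.
Proof. by case: z => a b; case: w. Qed.

Lemma complex_ImM z w : complex.Im (z * w) =
  complex.Re z * complex.Im w + complex.Im z * complex.Re w.
Proof. by case: z => a b; case: w. Qed.

Lemma complex_ReJ z : complex.Re (conjc z) = complex.Re z. Proof. by case: z. Qed.

Lemma complex_ImJ z : complex.Im (conjc z) = - complex.Im z. Proof. by case: z. Qed.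

Lemma conjcM z w : conjc (z * w) = conjc z * conjc w.
Proof. exact: (rmorphM (@conjc R)). Qed.

Lemma expiD (s t : R) : expi (s + t) = expi s * expi t.
Proof.
rewrite /expi cosD sinD; apply/eqP; rewrite eq_complex /= eqxx /=.
by rewrite addrC.
Qed.

Lemma expiN (t : R) : expi (- t) = conjc (expi t).
Proof. by rewrite /expi cosN sinN. Qed.

End Modulus.

Section Measurability.
Variables (R : realType) (d : measure_display) (T : measurableType d).
Implicit Types (f g : T -> R[i]).

(** Measurability on an arbitrary domain: the Fubini arguments below need it on
    products of the line. *)
Definition complex_measurable f : Prop :=
  measurable_fun setT (fun x => complex.Re (f x)) /\
  measurable_fun setT (fun x => complex.Im (f x)).

Lemma complex_measurableM f g : complex_measurable f -> complex_measurable g ->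
  complex_measurable (fun x => f x * g x).
Proof.
move=> [f1 f2] [g1 g2]; split.
- by under eq_fun do rewrite complex_ReM; apply: measurable_funB; apply: measurable_funM.
- by under eq_fun do rewrite complex_ImM; apply: measurable_funD; apply: measurable_funM.
Qed.

Lemma complex_measurableJ f : complex_measurable f ->
  complex_measurable (fun x => conjc (f x)).
Proof.
move=> [f1 f2]; split; first by under eq_fun do rewrite complex_ReJ.
by under eq_fun do rewrite complex_ImJ; exact: measurable_funN.
Qed.

Lemma complex_measurable_real (h : T -> R) : measurable_fun setT h ->
  complex_measurable (fun x => (h x)%:C%C).
Proof. by move=> mh; split => //=; exact: measurable_cst. Qed.

Lemma complex_measurable_cst (z : R[i]) : complex_measurable (fun=> z).
Proof. by split; exact: measurable_cst. Qed.

Lemma complex_measurable_expi (h : T -> R) : measurable_fun setT h ->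
  complex_measurable (fun x => expi (h x)).
Proof.
move=> mh; split => /=; apply: measurableT_comp => //.
- by apply: continuous_measurable_fun; exact: continuous_cos.
- by apply: continuous_measurable_fun; exact: continuous_sin.
Qed.

Lemma measurable_sqr_modulus f : complex_measurable f ->
  measurable_fun setT (fun x => modulus (f x) ^+ 2).
Proof.
move=> [f1 f2]; under eq_fun do rewrite sqr_modulus.
by apply: measurable_funD; exact: measurable_funX.
Qed.

Lemma measurable_modulus f : complex_measurable f ->
  measurable_fun setT (fun x => modulus (f x)).
Proof.
move=> mf; have -> : (fun x => modulus (f x)) =
    (fun x => (modulus (f x) ^+ 2) `^ 2^-1).
  by apply/funext => x; rewrite powR12_sqrt ?sqr_ge0// sqrtr_sqr ger0_norm// modulus_ge0.
apply: (measurableT_comp (measurable_powR 2^-1)).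
exact: measurable_sqr_modulus.
Qed.

End Measurability.

Lemma complex_measurable_comp (R : realType) d1 d2 (S : measurableType d1)
    (T : measurableType d2) (f : T -> R[i]) (h : S -> T) :
  complex_measurable f -> measurable_fun setT h ->
  complex_measurable (f \o h).
Proof.
move=> [f1 f2] mh; split.
- by rewrite [X in measurable_fun _ X](_ : _ = (fun x => complex.Re (f x)) \o h)//;
    apply: measurableT_comp.
- by rewrite [X in measurable_fun _ X](_ : _ = (fun x => complex.Im (f x)) \o h)//;
    apply: measurableT_comp.
Qed.

(** * Integrals of complex-valued functions *)

Section LebesgueInvariance.
Variable R : realType.
Notation mu := (@lebesgue_measure R).
Local Open Scope ereal_scope.

Lemma ge0_integral_shift (h : R -> \bar R) (a : R) : measurable_fun setT h ->
  (forall x, 0 <= h x) -> \int[mu]_x h (x + a)%R = \int[mu]_x h x.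
Proof.
move=> mh h0; set phi := (fun x : R => x + a)%R.
have mphi : measurable_fun setT (phi : R -> measurableTypeR R).
  by apply: measurable_funD => //; exact: measurable_cst.
transitivity (\int[pushforward mu (phi : R -> measurableTypeR R)]_x h x); last first.
  apply: eq_measure_integral => //= A mA _; apply/esym.
  apply: lebesgue_measure_unique => //= _ [[u v]] _ <-.
  rewrite /pushforward /= (_ : phi @^-1` _ = `](u - a)%R, (v - a)%R]%classic); last first.
    by apply/seteqP; split=> x /=; rewrite !in_itv /= /phi ltrBlDr lerBrDr.
  rewrite !lebesgue_measure_itv/= !lte_fin ltrD2r; case: ifP => // _.
  by rewrite -!EFinB; congr (_ %:E); ring.
by rewrite ge0_integral_pushforward//= preimage_setT.
Qed.

Lemma ge0_integral_reflect (h : R -> \bar R) : measurable_fun setT h ->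
  (forall x, 0 <= h x) -> \int[mu]_x h (- x)%R = \int[mu]_x h x.
Proof.
move=> mh h0.
transitivity (\int[pushforward mu (-%R : R -> measurableTypeR R)]_x h x); last first.
  by apply: eq_measure_integral => //= A mA _; exact: lebesgue_measureN.
by rewrite ge0_integral_pushforward//= preimage_setT.
Qed.

Lemma integral_shift (h : R -> R) (a : R) : measurable_fun setT h ->
  (\int[mu]_x h (x + a) = \int[mu]_x h x)%R.
Proof.
move=> mh; rewrite /Rintegral; congr fine.
rewrite integralE [RHS]integralE; congr (_ - _).
- rewrite -(ge0_integral_shift (h := (EFin \o h)^\+) a)//.
    by apply: eq_integral => x _; rewrite !funeposE.
  exact/measurable_funepos/measurable_EFinP.
- rewrite -(ge0_integral_shift (h := (EFin \o h)^\-) a)//.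
    by apply: eq_integral => x _; rewrite !funenegE.
  exact/measurable_funeneg/measurable_EFinP.
Qed.

Lemma integral_reflect (h : R -> R) : measurable_fun setT h ->
  (\int[mu]_x h (- x) = \int[mu]_x h x)%R.
Proof.
move=> mh; rewrite /Rintegral; congr fine.
rewrite integralE [RHS]integralE; congr (_ - _).
- rewrite -(ge0_integral_reflect (h := (EFin \o h)^\+))//.
    by apply: eq_integral => x _; rewrite !funeposE.
  exact/measurable_funepos/measurable_EFinP.
- rewrite -(ge0_integral_reflect (h := (EFin \o h)^\-))//.
    by apply: eq_integral => x _; rewrite !funenegE.
  exact/measurable_funeneg/measurable_EFinP.
Qed.

End LebesgueInvariance.

Section ComplexIntegral.
Variable R : realType.
Notation mu := (@lebesgue_measure R).
Implicit Types (f g : R -> R[i]).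

Definition cintegrable f : Prop :=
  complex_measurable f /\ (\int[mu]_x (modulus (f x))%:E < +oo)%E.

Lemma integrable_modulus f : cintegrable f ->
  mu.-integrable setT (EFin \o (fun x => modulus (f x))).
Proof.
move=> [mf foo]; apply/integrableP; split.
  by apply/measurable_EFinP; exact: measurable_modulus.
by under eq_integral => x _ do rewrite gee0_abs ?lee_fin ?modulus_ge0//.
Qed.

Lemma le_cintegrable_integrable (h : R -> R) f : measurable_fun setT h ->
  (forall x, `|h x| <= modulus (f x)) -> cintegrable f ->
  mu.-integrable setT (EFin \o h).
Proof.
move=> mh hf /integrable_modulus; apply: le_integrable => //.
  exact/measurable_EFinP.
by move=> x _ /=; rewrite lee_fin (ger0_norm (modulus_ge0 _)).
Qed.

Lemma integrable_Re f : cintegrable f ->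
  mu.-integrable setT (EFin \o (fun x => complex.Re (f x))).
Proof.
move=> fi; apply: (le_cintegrable_integrable _ _ fi); first by case: fi => -[].
by move=> x; exact: ler_Re.
Qed.

Lemma integrable_Im f : cintegrable f ->
  mu.-integrable setT (EFin \o (fun x => complex.Im (f x))).
Proof.
move=> fi; apply: (le_cintegrable_integrable _ _ fi); first by case: fi => -[].
by move=> x; exact: ler_Im.
Qed.

Lemma le_cintegrable f (h : R -> R) : complex_measurable f ->
  (forall x, modulus (f x) <= h x) -> mu.-integrable setT (EFin \o h) ->
  cintegrable f.
Proof.
move=> mf fh hi; split => //.
have /integrableP[mh] := hi; apply: le_lt_trans; apply: ge0_le_integral => //.
- by move=> x _; rewrite lee_fin modulus_ge0.
- by apply/measurable_EFinP; exact: measurable_modulus.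
- exact: measurableT_comp.
- by move=> x _ /=; rewrite lee_fin (le_trans (fh x))// ler_norm.
Qed.

Lemma cintegrableZ (z : R[i]) f : cintegrable f ->
  cintegrable (fun x => z * f x).
Proof.
move=> fi; apply: (@le_cintegrable _ (fun x => modulus z * modulus (f x))).
- by apply: complex_measurableM; [exact: complex_measurable_cst|case: fi].
- by move=> x; rewrite modulusM.
- exact: (integrableZl _ (modulus z) (integrable_modulus fi)).
Qed.

Lemma cintegrable_bounded f g (C : R) : complex_measurable g ->
  (forall x, modulus (g x) <= C) -> cintegrable f ->
  cintegrable (fun x => f x * g x).
Proof.
move=> mg gC fi; apply: (@le_cintegrable _ (fun x => C * modulus (f x))).
- by apply: complex_measurableM => //; case: fi.
- by move=> x; rewrite modulusM mulrC ler_wpM2r// modulus_ge0.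
- exact: (integrableZl _ C (integrable_modulus fi)).
Qed.

Lemma cintegrable_expi f (h : R -> R) : measurable_fun setT h ->
  cintegrable f -> cintegrable (fun x => f x * expi (h x)).
Proof.
move=> mh; apply: (@cintegrable_bounded _ _ 1).
  exact: complex_measurable_expi.
by move=> x; rewrite modulus_expi.
Qed.

Lemma cintegrableJ f : cintegrable f -> cintegrable (fun x => conjc (f x)).
Proof.
move=> fi; apply: (@le_cintegrable _ (fun x => modulus (f x))).
- by apply: complex_measurableJ; case: fi.
- by move=> x; rewrite modulusJ.
- exact: integrable_modulus.
Qed.

Lemma cintegrable_real (h : R -> R) : mu.-integrable setT (EFin \o h) ->
  cintegrable (fun x => (h x)%:C%C).
Proof.
move=> hi; apply: (@le_cintegrable _ (fun x => `|h x|)).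
- by apply: complex_measurable_real; apply/measurable_EFinP; case/integrableP: hi.
- by move=> x; rewrite modulus_real.
- exact: (integrable_abse hi).
Qed.

Lemma eq_cintegral f g : f =1 g -> cintegral f = cintegral g.
Proof. by move=> /funext ->. Qed.

Lemma cintegralZ (z : R[i]) f : cintegrable f ->
  cintegral (fun x => z * f x) = z * cintegral f.
Proof.
move=> fi; have fr := integrable_Re fi; have fI := integrable_Im fi.
rewrite /cintegral; apply/eqP; rewrite eq_complex; apply/andP; split; apply/eqP.
- rewrite complex_ReM /=; under eq_Rintegral do rewrite complex_ReM.
  rewrite RintegralB//; last 2 first.
  + exact: (integrableZl _ (complex.Re z) fr).
  + exact: (integrableZl _ (complex.Im z) fI).
  by rewrite !RintegralZl.
- rewrite complex_ImM /=; under eq_Rintegral do rewrite complex_ImM.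
  rewrite RintegralD//; last 2 first.
  + exact: (integrableZl _ (complex.Re z) fI).
  + exact: (integrableZl _ (complex.Im z) fr).
  by rewrite !RintegralZl.
Qed.

Lemma cintegralJ f : cintegrable f ->
  cintegral (fun x => conjc (f x)) = conjc (cintegral f).
Proof.
move=> fi; have fI := integrable_Im fi; rewrite /cintegral /=.
apply/eqP; rewrite eq_complex /=; apply/andP; split; apply/eqP.
- by apply: eq_Rintegral => x _; rewrite complex_ReJ.
- under eq_Rintegral do rewrite complex_ImJ -mulN1r.
  by rewrite RintegralZl// mulN1r.
Qed.

Lemma cintegral_shift f (a : R) : complex_measurable f ->
  cintegral (fun x => f (x + a)) = cintegral f.
Proof.
move=> [f1 f2]; rewrite /cintegral; congr (_ +i* _).
- exact: (@integral_shift _ (fun x => complex.Re (f x))).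
- exact: (@integral_shift _ (fun x => complex.Im (f x))).
Qed.

(** Rotate: multiplying f by the conjugate of c = cintegral f makes the integral
    equal to the real number |c|^2, and a real part is at most the modulus. *)
Lemma modulus_cintegral f : cintegrable f ->
  modulus (cintegral f) <= \int[mu]_x modulus (f x).
Proof.
move=> fi; set c := cintegral f.
have [c0|c0] := eqVneq (modulus c) 0.
  by rewrite c0; apply: Rintegral_ge0 => x _; exact: modulus_ge0.
have cp : 0 < modulus c by rewrite lt_neqAle eq_sym c0 modulus_ge0.
rewrite -(ler_pM2l cp) -expr2.
have -> : modulus c ^+ 2 = complex.Re (cintegral (fun x => conjc c * f x)).
  by rewrite cintegralZ// complex_ReM complex_ReJ complex_ImJ sqr_modulus -/c; ring.
rewrite -RintegralZl//; last exact: integrable_modulus.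
have cfi := cintegrableZ (conjc c) fi.
apply: le_Rintegral => //.
- exact: (integrable_Re cfi).
- exact: (integrableZl _ (modulus c) (integrable_modulus fi)).
- move=> x _; rewrite -(modulusJ c) -modulusM.
  by apply: le_trans (ler_Re _); exact: ler_norm.
Qed.

End ComplexIntegral.

Section Fubini.
Variable R : realType.
Notation mu := (@lebesgue_measure R).

Lemma measurable_Rintegral_param d (T : measurableType d) (h : T * R -> R) :
  measurable_fun setT h -> measurable_fun setT (fun t => \int[mu]_y h (t, y)).
Proof.
move=> mh; rewrite /Rintegral.
apply: (measurableT_comp (f := fine)) => //.
under eq_fun => t do rewrite integralE.
apply: emeasurable_funB.
- pose H := ((EFin \o h)^\+)%E.
  have mH : measurable_fun setT H by exact/measurable_funepos/measurable_EFinP.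
  rewrite (_ : (fun t => _) = fubini_F mu H).
    apply: (@measurable_fun_fubini_tonelli_F _ _ T _ R mu H mH) => x.
    by rewrite /H ?funepos_ge0 ?funeneg_ge0.
  by apply/funext => t; apply: eq_integral => y _; rewrite /H !funeposE.
- pose H := ((EFin \o h)^\-)%E.
  have mH : measurable_fun setT H by exact/measurable_funeneg/measurable_EFinP.
  rewrite (_ : (fun t => _) = fubini_F mu H).
    apply: (@measurable_fun_fubini_tonelli_F _ _ T _ R mu H mH) => x.
    by rewrite /H ?funepos_ge0 ?funeneg_ge0.
  by apply/funext => t; apply: eq_integral => y _; rewrite /H !funenegE.
Qed.

Lemma complex_measurable_cintegral d (T : measurableType d) (h : T * R -> R[i]) :
  complex_measurable h ->
  complex_measurable (fun t => cintegral (fun y => h (t, y))).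
Proof.
move=> [h1 h2]; split.
- exact: (measurable_Rintegral_param h1).
- exact: (measurable_Rintegral_param h2).
Qed.

Lemma Rintegral_fubini (h : R * R -> R) : measurable_fun setT h ->
  (\int[mu]_x \int[mu]_y `|h (x, y)|%:E < +oo)%E ->
  (forall x, mu.-integrable setT (fun y => (h (x, y))%:E)) ->
  (forall y, mu.-integrable setT (fun x => (h (x, y))%:E)) ->
  \int[mu]_x \int[mu]_y h (x, y) = \int[mu]_y \int[mu]_x h (x, y).
Proof.
move=> mh hoo hx hy.
have hi : (mu \x mu)%E.-integrable setT (EFin \o h).
  by apply/integrable12ltyP => //; exact/measurable_EFinP.
have := Fubini hi; rewrite /= => H.
rewrite {1}/Rintegral; under eq_integral => x _.
  rewrite /Rintegral fineK; last exact: integrable_fin_num (hx x).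
  over.
rewrite H [in RHS]/Rintegral; congr fine; apply: eq_integral => y _.
by rewrite /Rintegral fineK//; exact: integrable_fin_num (hy y).
Qed.

Lemma cintegral_fubini (h : R * R -> R[i]) : complex_measurable h ->
  (\int[mu]_x \int[mu]_y (modulus (h (x, y)))%:E < +oo)%E ->
  (forall x, cintegrable (fun y => h (x, y))) ->
  (forall y, cintegrable (fun x => h (x, y))) ->
  cintegral (fun x => cintegral (fun y => h (x, y))) =
  cintegral (fun y => cintegral (fun x => h (x, y))).
Proof.
move=> mh hoo hx hy.
have dom (k : R * R -> R) : measurable_fun setT k ->
    (forall p, `|k p| <= modulus (h p)) ->
    (\int[mu]_x \int[mu]_y `|k (x, y)|%:E < +oo)%E.
  move=> mk kh; apply: le_lt_trans hoo.
  have mk' : measurable_fun setT (fun p => `|k p|%:E).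
    by apply/measurable_EFinP; exact: measurableT_comp.
  have mh' : measurable_fun setT (fun p => (modulus (h p))%:E).
    by apply/measurable_EFinP; exact: measurable_modulus.
  apply: ge0_le_integral => //.
  - by move=> x _; apply: integral_ge0.
  - by apply: (@measurable_fun_fubini_tonelli_F _ _ _ _ R mu _ mk').
  - apply: (@measurable_fun_fubini_tonelli_F _ _ _ _ R mu _ mh') => p.
    by rewrite lee_fin modulus_ge0.
  - move=> x _; apply: ge0_le_integral => //.
    + by apply/measurable_EFinP; apply: (measurableT_comp (@normr_measurable R setT)); apply: (measurableT_comp mk); exact: pair1_measurable.
    + by apply/measurable_EFinP; apply: measurable_modulus; case: (hx x).
    + by move=> y _; rewrite lee_fin.
case: (mh) => m1 m2; rewrite /cintegral /=; congr (_ +i* _).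
- apply: (Rintegral_fubini m1).
  + by apply: (dom _ m1) => p; exact: ler_Re.
  + by move=> x; exact: (integrable_Re (hx x)).
  + by move=> y; exact: (integrable_Re (hy y)).
- apply: (Rintegral_fubini m2).
  + by apply: (dom _ m2) => p; exact: ler_Im.
  + by move=> x; exact: (integrable_Im (hx x)).
  + by move=> y; exact: (integrable_Im (hy y)).
Qed.

End Fubini.

(** * The multiplication formula *)

Section FourierTransform.
Variable R : realType.
Notation mu := (@lebesgue_measure R).
Implicit Types (A B f g : R -> R[i]).

Lemma measurable_phase (xi : R) :
  measurable_fun setT (fun x : R => - (2 * pi * x * xi)).
Proof. by apply: measurable_funN; apply: measurable_funM. Qed.

Lemma complex_measurable_fourier f : complex_measurable f ->
  complex_measurable (fourier f).
Proof.
move=> mf; apply: (@complex_measurable_cintegral _ _ _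
  (fun p : R * R => f p.2 * expi (- (2 * pi * p.2 * p.1)))).
apply: complex_measurableM.
- exact: (complex_measurable_comp mf measurable_snd).
- apply: complex_measurable_expi; apply: measurable_funN.
  by apply: measurable_funM => //; apply: measurable_funM.
Qed.

Lemma cintegrable_phase f (xi : R) : cintegrable f ->
  cintegrable (fun x => f x * expi (- (2 * pi * x * xi))).
Proof. by apply: cintegrable_expi; exact: measurable_phase. Qed.

Lemma modulus_fourier f (xi : R) : cintegrable f ->
  modulus (fourier f xi) <= \int[mu]_x modulus (f x).
Proof.
move=> fi; apply: (le_trans (modulus_cintegral (cintegrable_phase xi fi))).
by under eq_Rintegral do rewrite modulusM modulus_expi mulr1.
Qed.

Lemma fourierZ (c : R[i]) f (xi : R) : cintegrable f ->
  fourier (fun x => c * f x) xi = c * fourier f xi.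
Proof.
move=> fi; rewrite /fourier -cintegralZ; last exact: cintegrable_phase.
by apply: eq_cintegral => x; rewrite mulrA.
Qed.

(** Reduces the regularity of imaginary parts of transforms to that of real
    parts. *)
Lemma Im_fourier f (xi : R) : cintegrable f -> complex.Im (fourier f xi) =
  complex.Re (fourier (fun x => (0 +i* -1) * f x) xi).
Proof.
by move=> fi; rewrite fourierZ//; case: (fourier f xi) => a b /=; ring.
Qed.

(** Fubini for A(u) B(v) exp (- 2 i pi u v).  This is the source of both Bessel's
    inequality and inversion. *)
Lemma fourier_multiplication A B : cintegrable A -> cintegrable B ->
  cintegral (fun u => A u * fourier B u) =
  cintegral (fun v => fourier A v * B v).
Proof.
move=> Ai Bi.
pose h (p : R * R) := A p.1 * B p.2 * expi (- (2 * pi * p.1 * p.2)).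
have hx x : cintegrable (fun y => h (x, y)).
  rewrite /h /=; apply: cintegrable_expi.
    by apply: measurable_funN; apply: measurable_funM; [exact: measurable_cst|exact: measurable_id].
  exact: cintegrableZ.
have hy y : cintegrable (fun x => h (x, y)).
  rewrite /h /=; apply: cintegrable_expi; first exact: measurable_phase.
  by under eq_fun do rewrite mulrC; exact: cintegrableZ.
have mA1 : complex_measurable (fun p : R * R => A p.1).
  by apply: (complex_measurable_comp (proj1 Ai)); exact: measurable_fst.
have mB2 : complex_measurable (fun p : R * R => B p.2).
  by apply: (complex_measurable_comp (proj1 Bi)); exact: measurable_snd.
have mh : complex_measurable h.
  apply: complex_measurableM; first exact: complex_measurableM.
  apply: complex_measurable_expi; apply: measurable_funN.
  by apply: measurable_funM => //; apply: measurable_funM.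
have hoo : (\int[mu]_x \int[mu]_y (modulus (h (x, y)))%:E < +oo)%E.
  have E x : (\int[mu]_y (modulus (h (x, y)))%:E =
      (modulus (A x))%:E * \int[mu]_y (modulus (B y))%:E)%E.
    rewrite -ge0_integralZl_EFin ?modulus_ge0//.
    - by apply: eq_integral => y _; rewrite /h !modulusM modulus_expi mulr1 EFinM.
    - by move=> y _; rewrite lee_fin modulus_ge0.
    - by apply/measurable_EFinP; apply: measurable_modulus; case: Bi.
  under eq_integral do rewrite E.
  rewrite ge0_integralZr//.
  - apply: lte_mul_pinfty; last by case: Bi.
      by apply: integral_ge0 => x _; rewrite lee_fin modulus_ge0.
    by apply: (integrable_fin_num _ (integrable_modulus Ai)).
  - by apply/measurable_EFinP; apply: measurable_modulus; case: Ai.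
  - by move=> y _; rewrite lee_fin modulus_ge0.
  - by apply: integral_ge0 => x _; rewrite lee_fin modulus_ge0.
transitivity (cintegral (fun x => cintegral (fun y => h (x, y)))).
  apply: eq_cintegral => x; rewrite /fourier -cintegralZ; last exact: cintegrable_phase.
  by apply: eq_cintegral => y; rewrite /h /= -!mulrA [2 * (pi * (x * y))]mulrCA; congr (_ * (_ * expi (- _))); ring.
rewrite cintegral_fubini//; apply: eq_cintegral => y.
rewrite mulrC /fourier -cintegralZ; last exact: cintegrable_phase.
by apply: eq_cintegral => x; rewrite /h /=; ring.
Qed.

End FourierTransform.

(** * The Abel factor and the Poisson kernel *)

Section PoissonKernel.
Variable R : realType.
Notation mu := (@lebesgue_measure R).
Implicit Types (e b t x y : R).

Definition abel e x : R := expR (- e * `|x|).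

Definition poisson e t : R := 2 * e / (e ^+ 2 + (2 * pi * t) ^+ 2).

Lemma abel_gt0 e x : 0 < abel e x. Proof. exact: expR_gt0. Qed.

Lemma abel_le1 e x : 0 < e -> abel e x <= 1.
Proof. by move=> e0; rewrite /abel expR_le1 mulNr oppr_le0 mulr_ge0// ltW. Qed.

Lemma continuous_abel e : continuous (abel e).
Proof.
move=> x; apply: (@continuous_comp _ _ _ (fun x => - e * `|x|) expR).
  by apply: cvgMr; exact: norm_continuous.
exact: continuous_expR.
Qed.

Lemma measurable_abel e : measurable_fun setT (abel e).
Proof. by apply: continuous_measurable_fun; exact: continuous_abel. Qed.

Lemma continuous_cosM b : continuous (fun x : R => cos (b * x)).
Proof.
move=> x; apply: (@continuous_comp _ _ _ (fun x => b * x) cos).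
  by apply: cvgMr; exact: cvg_id.
exact: continuous_cos.
Qed.

Lemma continuous_sinM b : continuous (fun x : R => sin (b * x)).
Proof.
move=> x; apply: (@continuous_comp _ _ _ (fun x => b * x) sin).
  by apply: cvgMr; exact: cvg_id.
exact: continuous_sin.
Qed.

Lemma measurable_cosM b : measurable_fun setT (fun x : R => cos (b * x)).
Proof. by apply: continuous_measurable_fun; exact: continuous_cosM. Qed.

Lemma measurable_sinM b : measurable_fun setT (fun x : R => sin (b * x)).
Proof. by apply: continuous_measurable_fun; exact: continuous_sinM. Qed.

(* A primitive of exp (- e x) (1 + cos (b x)).  Adding 1 to the cosine keeps the
   integrand nonnegative, so that the improper integral is that of a
   nonnegative function; the case b = 0 then gives the part to subtract. *)
Let prim e b x := expR (- e * x) *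
  (- e^-1 + (b * sin (b * x) - e * cos (b * x)) / (e ^+ 2 + b ^+ 2)).

Let is_derive_prim e b x : 0 < e ->
  is_derive x 1 (prim e b) (expR (- e * x) * (1 + cos (b * x))).
Proof.
move=> e0.
have H1 : is_derive x (1:R) (fun x => - e * x) (- e).
  by apply: is_derive_eq; rewrite /GRing.scale /= ?mulr1.
have H2 : is_derive x (1:R) (fun x => b * x) b.
  by apply: is_derive_eq; rewrite /GRing.scale /= ?mulr1.
have H3 := is_derive1_comp (is_derive_expR _) H1.
have H4 := is_derive1_comp (is_derive_sin _) H2.
have H5 := is_derive1_comp (is_derive_cos _) H2.
have D0 : e ^+ 2 + b ^+ 2 != 0.
  by rewrite gt_eqF// ltr_wpDr ?sqr_ge0// exprn_gt0.
apply: is_derive_eq.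
rewrite /GRing.scale /=; field.
by rewrite D0 gt_eqF.
Qed.

Let cvg_expRN e : 0 < e -> expR (- e * x) @[x --> +oo] --> (0:R).
Proof.
move=> e0; have H : e * x @[x --> +oo] --> +oo by exact: gt0_cvgMry.
under eq_cvg do rewrite mulNr.
exact: (cvg_comp _ _ H (@cvgr_expR R)).
Qed.

Let cvg_prim e b : 0 < e -> prim e b x @[x --> +oo] --> (0:R).
Proof.
move=> e0; have D0 : 0 < e ^+ 2 + b ^+ 2.
  by rewrite ltr_wpDr ?sqr_ge0// exprn_gt0.
pose C := e^-1 + (`|b| + e) / (e ^+ 2 + b ^+ 2).
apply/norm_cvg0P; apply: (squeeze_cvgr (f := cst 0) (h := fun x => C * expR (- e * x))).
- apply: nearW => x; rewrite normr_ge0 /= /prim normrM ger0_norm ?expR_ge0// mulrC.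
  rewrite ler_wpM2r ?expR_ge0//; apply: (le_trans (ler_normD _ _)).
  rewrite normrN (ger0_norm (x := e^-1)) ?invr_ge0 ?(ltW e0)// lerD2l.
  rewrite normrM (ger0_norm (x := (_ + _)^-1)) ?invr_ge0 ?(ltW D0)// ler_wpM2r ?invr_ge0 ?(ltW D0)//.
  apply: (le_trans (ler_normB _ _)); rewrite !normrM (gtr0_norm e0).
  apply: lerD.
    by rewrite ler_piMr// ler_norml sin_geN1 sin_le1.
  by rewrite ler_piMr ?(ltW e0)// ler_norml cos_geN1 cos_le1.
- exact: cvg_cst.
- by rewrite -(mulr0 C); apply: cvgMr; exact: cvg_expRN.
Qed.

Let fexp e b x := expR (- e * x) * (1 + cos (b * x)).

Let continuous_fexp e b : continuous (fexp e b).
Proof.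
move=> x; rewrite /fexp; apply: cvgM.
  apply: (@continuous_comp _ _ _ (fun x => - e * x) expR).
    by apply: cvgMr; exact: cvg_id.
  exact: continuous_expR.
by apply: cvgD; [exact: cvg_cst|exact: continuous_cosM].
Qed.

Let fexp_ge0 e b x : 0 <= fexp e b x.
Proof. by rewrite mulr_ge0 ?expR_ge0// -lerBlDl sub0r cos_geN1. Qed.

Let integral_fexp e b : 0 < e ->
  (\int[mu]_(x in `[0%R, +oo[) (fexp e b x)%:E =
   (e^-1 + e / (e ^+ 2 + b ^+ 2))%:E)%E.
Proof.
move=> e0; have dp x := is_derive_prim b x e0.
rewrite (@ge0_continuous_FTC2y R (fexp e b) (prim e b) 0 0).
- rewrite /prim !mulr0 expR0 sin0 cos0 -EFinB; congr (_ %:E); ring.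
- by move=> x _; exact: fexp_ge0.
- exact: continuous_subspaceT (@continuous_fexp e b).
- exact: cvg_prim.
- by move=> x _; have := dp x => ?; exact: ex_derive.
- apply: cvg_at_right_filter; apply: differentiable_continuous.
  by apply/derivable1_diffP; have := dp 0 => ?; exact: ex_derive.
- by move=> x _; have := dp x => ?; rewrite derive1E derive_val.
Qed.

Lemma integral_abel_cos_ge0 e b : 0 < e ->
  (\int[mu]_x (abel e x * (1 + cos (b * x)))%:E =
   (2 * (e^-1 + e / (e ^+ 2 + b ^+ 2)))%:E)%E.
Proof.
move=> e0; rewrite (@ge0_symfun_integralT R (fun x => abel e x * (1 + cos (b * x)))).
- rewrite EFinM -integral_fexp// set_itvcy; congr (_ * _)%E.
  by apply: eq_integral => x /[!inE]/= x0; rewrite /abel ger0_norm.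
- by move=> x; rewrite mulr_ge0 ?expR_ge0// -lerBlDl sub0r cos_geN1.
- move=> x; apply: cvgM; first exact: continuous_abel.
  by apply: cvgD; [exact: cvg_cst|exact: continuous_cosM].
- by move=> x /=; rewrite /abel normrN mulrN cosN.
Qed.

Lemma integrable_abel e : 0 < e -> mu.-integrable setT (EFin \o abel e).
Proof.
move=> e0; apply/integrableP; split.
  by apply/measurable_EFinP; exact: measurable_abel.
have := integral_abel_cos_ge0 0 e0 => H.
rewrite (@le_lt_trans _ _ (2 * (e^-1 + e / (e ^+ 2 + 0 ^+ 2)))%:E) ?ltey// -H.
apply: ge0_le_integral => //.
- by apply: measurableT_comp => //; apply/measurable_EFinP; exact: measurable_abel.
- apply/measurable_EFinP; under eq_fun do rewrite mul0r cos0.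
  by apply: measurable_funM => //; exact: measurable_abel.
- move=> x _ /=; rewrite lee_fin mul0r cos0 ger0_norm ?expR_ge0//.
  by rewrite ler_peMr ?expR_ge0// lerDl.
Qed.

Let Rintegral_abel_cos_ge0 e b : 0 < e ->
  \int[mu]_x (abel e x * (1 + cos (b * x))) =
   2 * (e^-1 + e / (e ^+ 2 + b ^+ 2)).
Proof. by move=> e0; rewrite /Rintegral integral_abel_cos_ge0. Qed.

Lemma integrable_abel_cos e b : 0 < e ->
  mu.-integrable setT (EFin \o (fun x => abel e x * cos (b * x))).
Proof.
move=> e0; apply: le_integrable (integrable_abel e0) => //.
  by apply/measurable_EFinP; apply: measurable_funM;
    [exact: measurable_abel|exact: measurable_cosM].
move=> x _ /=; rewrite lee_fin normrM ler_piMr//.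
by rewrite ler_norml cos_geN1 cos_le1.
Qed.

Lemma integral_abel_cos e t : 0 < e ->
  \int[mu]_x (abel e x * cos (2 * pi * t * x)) = poisson e t.
Proof.
move=> e0; set b := 2 * pi * t.
have := Rintegral_abel_cos_ge0 b e0; have := Rintegral_abel_cos_ge0 0 e0.
under eq_Rintegral do rewrite mul0r cos0 mulrDr mulr1.
rewrite RintegralD//; [|exact: integrable_abel..] => H0.
under eq_Rintegral do rewrite mulrDr mulr1.
rewrite RintegralD//; [|exact: integrable_abel|exact: integrable_abel_cos] => H.
have {}H0 : \int[mu]_x abel e x = 2 * e^-1.
  have : 2 * \int[mu]_x abel e x = 2 * (2 * e^-1).
    rewrite mulrDl mul1r H0 expr0n/= addr0; field; exact: lt0r_neq0.
  by apply: mulfI; rewrite pnatr_eq0.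
move: H; rewrite H0 mulrDr => /addrI ->.
by rewrite /poisson -/b mulrA.
Qed.

Lemma integrable_abel_sin e b : 0 < e ->
  mu.-integrable setT (EFin \o (fun x => abel e x * sin (b * x))).
Proof.
move=> e0; apply: le_integrable (integrable_abel e0) => //.
  by apply/measurable_EFinP; apply: measurable_funM;
    [exact: measurable_abel|exact: measurable_sinM].
move=> x _ /=; rewrite lee_fin normrM ler_piMr//.
by rewrite ler_norml sin_geN1 sin_le1.
Qed.

Lemma integral_abel_sin e b : 0 < e ->
  \int[mu]_x (abel e x * sin (b * x)) = 0.
Proof.
move=> e0; have : \int[mu]_x (abel e (- x) * sin (b * - x)) =
    \int[mu]_x (abel e x * sin (b * x)).
  apply: (@integral_reflect _ (fun x => abel e x * sin (b * x))).
  by apply: measurable_funM; [exact: measurable_abel|exact: measurable_sinM].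
under eq_Rintegral => x _.
  rewrite /abel normrN mulrN sinN mulrN -mulN1r; over.
rewrite RintegralZl//; last exact: integrable_abel_sin.
move=> H; lra.
Qed.

Lemma poisson_den_gt0 e t : 0 < e -> 0 < e ^+ 2 + (2 * pi * t) ^+ 2.
Proof. by move=> e0; rewrite ltr_wpDr ?sqr_ge0// exprn_gt0. Qed.

Lemma poisson_ge0 e t : 0 < e -> 0 <= poisson e t.
Proof.
move=> e0; apply: divr_ge0; first by rewrite mulr_ge0// ltW.
exact: ltW (poisson_den_gt0 t e0).
Qed.

Lemma poissonN e t : poisson e (- t) = poisson e t.
Proof. by rewrite /poisson mulrN sqrrN. Qed.

Lemma continuous_poisson e : 0 < e -> continuous (poisson e).
Proof.
move=> e0 t; rewrite /poisson; apply: cvgM; first exact: cvg_cst.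
apply: cvgV; first by rewrite gt_eqF// poisson_den_gt0.
apply: cvgD; first exact: cvg_cst.
by rewrite expr2; under eq_fun do rewrite expr2; apply: cvgM; apply: cvgMr; exact: cvg_id.
Qed.

Lemma measurable_poisson e : 0 < e -> measurable_fun setT (poisson e).
Proof. by move=> e0; apply: continuous_measurable_fun; exact: continuous_poisson. Qed.

(** A primitive is atan (2 pi t / e) / pi, which tends to 1/2. *)
Lemma integral_poisson e : 0 < e -> (\int[mu]_t (poisson e t)%:E = 1)%E.
Proof.
move=> e0; have pi0 : 0 < pi :> R by exact: pi_gt0.
have id_pi (p t : R) : 0 < p -> p^-1 * ((1 + (2 * p / e * t) ^+ 2)^-1 * (2 * p / e)) =
    2 * e / (e ^+ 2 + (2 * p * t) ^+ 2).
  move=> p0; have D0 : e ^+ 2 + (2 * p * t) ^+ 2 != 0.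
    by rewrite gt_eqF// ltr_wpDr ?sqr_ge0// exprn_gt0.
  by field; rewrite D0 !gt_eqF.
pose c : R := 2 * pi / e; have c0 : 0 < c by rewrite divr_gt0// mulr_gt0.
pose F t : R := pi^-1 * atan (c * t).
have dF t : is_derive t 1 F (poisson e t).
  have H1 : is_derive t (1:R) (fun x => c * x) c.
    by apply: is_derive_eq; rewrite /GRing.scale /= ?mulr1.
  have H2 := is_derive1_comp (is_derive1_atan _) H1.
  apply: is_derive_eq; rewrite /GRing.scale /=.
  exact: id_pi.
rewrite (@ge0_symfun_integralT R (poisson e)); last 3 first.
- by move=> t; exact: poisson_ge0.
- exact: continuous_poisson.
- by move=> t; rewrite /= poissonN.
rewrite -set_itvcy (@ge0_continuous_FTC2y R (poisson e) F 0 (2^-1)).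
- by rewrite /F mulr0 atan0 mulr0 sube0 -EFinM mulfV// pnatr_eq0.
- by move=> t _; exact: poisson_ge0.
- exact: continuous_subspaceT (continuous_poisson e0).
- rewrite (_ : 2^-1 = pi^-1 * (pi / 2)); last by rewrite mulrA mulVf ?mul1r// gt_eqF.
  apply: cvgMr; apply: (cvg_comp _ _ _ (@cvgy_atan R)).
  exact: gt0_cvgMry.
- by move=> t _; have := dF t => ?; exact: ex_derive.
- apply: cvg_at_right_filter; apply: differentiable_continuous.
  by apply/derivable1_diffP; have := dF 0 => ?; exact: ex_derive.
- by move=> t _; have := dF t => ?; rewrite derive1E derive_val.
Qed.

Lemma measurable_poissonB e y : 0 < e ->
  measurable_fun setT (fun v : R => poisson e (y - v)).
Proof.
move=> e0; apply: (measurableT_comp (measurable_poisson e0)).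
by apply: measurable_funB.
Qed.

Lemma integral_poissonB e y : 0 < e ->
  (\int[mu]_v (poisson e (y - v))%:E = 1)%E.
Proof.
move=> e0; rewrite -(integral_poisson e0).
under eq_integral do rewrite -poissonN opprB.
apply: (@ge0_integral_shift _ (fun v => (poisson e v)%:E)).
  by apply/measurable_EFinP; exact: measurable_poisson.
by move=> v; rewrite lee_fin poisson_ge0.
Qed.

Lemma integrable_poissonB e y : 0 < e ->
  mu.-integrable setT (EFin \o (fun v => poisson e (y - v))).
Proof.
move=> e0; apply/integrableP; split.
  by apply/measurable_EFinP; exact: measurable_poissonB.
under eq_integral => v _ do rewrite /= ger0_norm ?poisson_ge0//.
by rewrite integral_poissonB// ltey.
Qed.

Lemma poisson_le_inv e : 0 < e -> forall t, poisson e t <= 2 / e.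
Proof.
move=> e0 t; rewrite /poisson ler_pdivrMr ?poisson_den_gt0//.
rewrite mulrDr -[leLHS]addr0 lerD//; last by rewrite mulr_ge0 ?sqr_ge0 ?divr_ge0 ?ltW.
by rewrite le_eqVlt; apply/orP; left; apply/eqP; field; rewrite gt_eqF.
Qed.

(** The Poisson kernel at e = 2 pi serves as the integrable majorant
    1 / (1 + t^2). *)
Lemma poisson_2pi t : pi * poisson (2 * pi) t = (1 + t ^+ 2)^-1.
Proof.
have pi0 : 0 < pi :> R by exact: pi_gt0.
rewrite /poisson; move: (pi) pi0 => p p0.
have D0 : (2 * p) ^+ 2 + (2 * p * t) ^+ 2 != 0.
  by rewrite gt_eqF// ltr_wpDr ?sqr_ge0// exprn_gt0// mulr_gt0.
have D1 : 1 + t ^+ 2 != 0 by rewrite gt_eqF// ltr_wpDr ?sqr_ge0.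
by field; rewrite D0 D1.
Qed.

(** Away from 0 the kernel is O(e) times a fixed integrable function: for
    |t| >= d it is at most e / t^2, and 1 / t^2 <= (1 + d^-2) / (1 + t^2). *)
Lemma poisson_tail e d t : 0 < e -> 0 < d -> d <= `|t| ->
  poisson e t <= e * (1 + d ^- 2) * (pi * poisson (2 * pi) t).
Proof.
move=> e0 d0 dt; have pi2 := pi_ge2 R.
have pi0 : 0 < pi :> R by exact: pi_gt0.
have t0 : 0 < t ^+ 2 by rewrite exprn_even_gt0//= -normr_gt0 (lt_le_trans d0 dt).
have dt2 : d ^+ 2 <= t ^+ 2.
  by rewrite -[leRHS]real_normK ?num_real// ler_sqr ?nnegrE// ltW.
rewrite poisson_2pi.
rewrite ler_pdivlMr ?ltr_wpDr ?sqr_ge0//.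
apply: (@le_trans _ _ (e / t ^+ 2 * (1 + t ^+ 2))).
  rewrite ler_wpM2r ?addr_ge0 ?sqr_ge0//.
  rewrite /poisson ler_pdivrMr ?poisson_den_gt0// mulrAC ler_pdivlMr//.
  rewrite [2 * e]mulrC -[e * 2 * _]mulrA ler_wpM2l ?(ltW e0)// exprMn.
  have : 2 <= (2 * pi) ^+ 2 :> R by move: (pi) pi2 => p p2; nra.
  move: ((2 * pi) ^+ 2) => c c2.
  by rewrite (le_trans (ler_wpM2r (ltW t0) c2))// lerDr sqr_ge0.
rewrite mulrDr mulr1 mulrAC -[_ * t ^+ 2 / _]mulrA mulfV ?gt_eqF// mulr1 mulrDr mulr1.
rewrite addrC lerD2l ler_wpM2l ?(ltW e0)// lef_pV2 ?posrE ?(exprn_gt0 2 d0)//.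
Qed.

End PoissonKernel.

(** * Bessel's inequality and Fourier inversion *)

Section Fatou.
Variable R : realType.
Notation mu := (@lebesgue_measure R).

(** Fatou's lemma in the form used below: a bound on the integrals passes to the
    pointwise limit. *)
Lemma fatou_le (D : set R) (f_ : nat -> R -> \bar R) (f : R -> \bar R)
    (B_ : nat -> \bar R) B : measurable D ->
  (forall n, measurable_fun setT (f_ n)) -> (forall n x, 0 <= f_ n x)%E ->
  (forall x, f_ ^~ x @ \oo --> f x) ->
  (forall n, \int[mu]_(x in D) f_ n x <= B_ n)%E -> B_ @ \oo --> B ->
  (\int[mu]_(x in D) f x <= B)%E.
Proof.
move=> mD mf f0 fcvg fB Bcvg.
have -> : (\int[mu]_(x in D) f x = \int[mu]_(x in D) limn_einf (f_ ^~ x))%E.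
  by apply: eq_integral => x _; rewrite (cvg_limn_einf_sup (fcvg x)).1.
have mfD n : measurable_fun D (f_ n) by exact: measurable_funTS.
apply: le_trans; first by apply: fatou => // n x _; exact: f0.
rewrite -(cvg_limn_einf_sup Bcvg).1 !limn_einf_lim.
apply: lee_lim; [exact: is_cvg_einfs|exact: is_cvg_einfs|].
apply: nearW => n; apply: le_ereal_inf_tmp => _ [k nk <-].
by apply: ge_ereal_inf; exists (\int[mu]_(x in D) f_ k x)%E => //; exists k.
Qed.

End Fatou.

Section Abel.
Variable R : realType.
Notation mu := (@lebesgue_measure R).
Implicit Types (e : R) (f G : R -> R[i]).

Let measurable_char (y : R) :
  complex_measurable (fun u : R => expi (2 * pi * y * u)).
Proof. by apply: complex_measurable_expi; apply: measurable_funM => //; exact: measurable_cst. Qed.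

Lemma fourier_abel e y x : 0 < e ->
  fourier (fun u => (abel e u)%:C%C * expi (2 * pi * y * u)) x =
  (poisson e (y - x))%:C%C.
Proof.
move=> e0; rewrite /fourier.
rewrite (eq_cintegral (g := fun u => abel e u * cos (2 * pi * (y - x) * u) +i*
    (abel e u * sin (2 * pi * (y - x) * u)))).
  by rewrite /cintegral /= integral_abel_cos// integral_abel_sin.
move=> u; rewrite -mulrA -expiD.
have -> : 2 * pi * y * u + - (2 * pi * u * x) = 2 * pi * (y - x) * u by ring.
by rewrite /expi; apply/eqP; rewrite eq_complex /=; apply/andP; split; apply/eqP; ring.
Qed.

Lemma cintegrable_abel e : 0 < e -> cintegrable (fun u => (abel e u)%:C%C).
Proof. by move=> e0; apply: cintegrable_real; exact: integrable_abel. Qed.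

(** Abel summation of the inversion integral of [fourier G] is convolution of G
    with the Poisson kernel. *)
Lemma abel_mean_fourier e G y : 0 < e -> cintegrable G ->
  cintegral (fun u => (abel e u)%:C%C * expi (2 * pi * y * u) * fourier G u) =
  cintegral (fun v => (poisson e (y - v))%:C%C * G v).
Proof.
move=> e0 Gi; rewrite fourier_multiplication//.
  by apply: eq_cintegral => v; rewrite fourier_abel.
apply: (cintegrable_bounded (C := 1)); [exact: measurable_char| |].
  by move=> u; rewrite modulus_expi.
exact: cintegrable_abel.
Qed.

(** The left-hand side is the integral of conj (G v) G w against the kernel
    poisson e (v - w), by the multiplication formula.  Since
    2 |G v| |G w| <= |G v|^2 + |G w|^2 and the kernel has mass 1 in each
    variable, it is at most the square of the L^2 norm. *)
Lemma abel_bessel e G : 0 < e -> cintegrable G ->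
  (\int[mu]_u (abel e u * modulus (fourier G u) ^+ 2)%:E <=
   \int[mu]_v (modulus (G v) ^+ 2)%:E)%E.
Proof.
move=> e0 Gi; pose D u := (abel e u)%:C%C * conjc (fourier G u).
have mG : complex_measurable G by case: Gi.
have mhatG := complex_measurable_fourier mG.
have Di : cintegrable D.
  apply: (cintegrable_bounded (C := \int[mu]_x modulus (G x))).
  - exact: complex_measurableJ.
  - by move=> u; rewrite modulusJ modulus_fourier.
  - exact: cintegrable_abel.
have hatD v : fourier D v =
    conjc (cintegral (fun w => (poisson e (v - w))%:C%C * G w)).
  rewrite -abel_mean_fourier// -cintegralJ.
    apply: eq_cintegral => u; rewrite /D !conjcM -expiN.
    have -> : - (2 * pi * v * u) = - (2 * pi * u * v) by ring.
    by rewrite conjc_real mulrAC.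
  apply: (cintegrable_bounded (C := \int[mu]_x modulus (G x))) => //.
    by move=> u; rewrite modulus_fourier.
  apply: (cintegrable_bounded (C := 1)); [exact: measurable_char| |].
    by move=> u; rewrite modulus_expi.
  exact: cintegrable_abel.
have DGi : cintegrable (fun u => D u * fourier G u).
  apply: (cintegrable_bounded (C := \int[mu]_x modulus (G x))) => //.
  by move=> u; rewrite modulus_fourier.
have GDi : cintegrable (fun v => fourier D v * G v).
  under eq_fun do rewrite mulrC.
  apply: (cintegrable_bounded (C := \int[mu]_x modulus (D x))) => //.
    by apply: complex_measurable_fourier; case: Di.
  by move=> u; rewrite modulus_fourier.
have E : (\int[mu]_u (abel e u * modulus (fourier G u) ^+ 2)%:E =
    (complex.Re (cintegral (fun u => D u * fourier G u)))%:E)%E.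
  rewrite -[complex.Re (cintegral _)]/(\int[mu]_x complex.Re (D x * fourier G x)).
  rewrite /Rintegral fineK; last first.
    exact: integrable_fin_num (integrable_Re DGi).
  apply: eq_integral => u _; congr (_ %:E).
  rewrite /D sqr_modulus; case: (fourier G u) => a b /=; ring.
rewrite E fourier_multiplication//.
apply: (@le_trans _ _ (\int[mu]_v (modulus (fourier D v * G v))%:E)%E).
  apply: (@le_trans _ _ (\int[mu]_v modulus (fourier D v * G v))%:E).
    rewrite lee_fin; apply: le_trans (modulus_cintegral GDi).
    by apply: le_trans (ler_Re _); exact: ler_norm.
  rewrite /Rintegral fineK//.
  exact: integrable_fin_num (integrable_modulus GDi).
(* K1 and K2 are the two halves of the arithmetic-geometric mean bound. *)
pose S v := modulus (G v) ^+ 2 / 2.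
have S0 v : 0 <= S v by rewrite divr_ge0// sqr_ge0.
have mS : measurable_fun setT S.
  by apply: measurable_funM; [exact: measurable_sqr_modulus|exact: measurable_cst].
have mP : measurable_fun setT (fun p : R * R => poisson e (p.1 - p.2)).
  by apply: (measurableT_comp (measurable_poisson e0)); exact: measurable_funB.
pose K1 (p : R * R) := (poisson e (p.1 - p.2) * S p.1)%:E.
pose K2 (p : R * R) := (poisson e (p.1 - p.2) * S p.2)%:E.
have mK1 : measurable_fun setT K1.
  apply/measurable_EFinP; apply: measurable_funM => //.
  by apply: (measurableT_comp mS); exact: measurable_fst.
have mK2 : measurable_fun setT K2.
  apply/measurable_EFinP; apply: measurable_funM => //.
  by apply: (measurableT_comp mS); exact: measurable_snd.
have K10 p : (0 <= K1 p)%E by rewrite lee_fin mulr_ge0// poisson_ge0.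
have K20 p : (0 <= K2 p)%E by rewrite lee_fin mulr_ge0// poisson_ge0.
have intP1 w : (\int[mu]_v (poisson e (v - w))%:E = 1)%E.
  by under eq_integral do rewrite -poissonN opprB; exact: integral_poissonB.
have I1 : (\int[mu]_v \int[mu]_w K1 (v, w) = \int[mu]_v (S v)%:E)%E.
  apply: eq_integral => v _; rewrite /K1 /=.
  under eq_integral do rewrite EFinM.
  rewrite ge0_integralZr ?lee_fin// ?integral_poissonB ?mul1e//.
  - by apply/measurable_EFinP; exact: measurable_poissonB.
  - by move=> w _; rewrite lee_fin poisson_ge0.
have I2 : (\int[mu]_v \int[mu]_w K2 (v, w) = \int[mu]_v (S v)%:E)%E.
  rewrite [LHS](@fubini_tonelli _ _ _ _ R mu mu K2 mK2 K20).
  apply: eq_integral => w _; rewrite /K2 /=.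
  under eq_integral do rewrite EFinM.
  rewrite ge0_integralZr ?lee_fin// ?intP1 ?mul1e//.
  - apply/measurable_EFinP; apply: (measurableT_comp (measurable_poisson e0)).
    by apply: measurable_funB.
  - by move=> v _; rewrite lee_fin poisson_ge0.
have -> : (\int[mu]_v (modulus (G v) ^+ 2)%:E =
    \int[mu]_v \int[mu]_w K1 (v, w) + \int[mu]_v \int[mu]_w K2 (v, w))%E.
  rewrite I1 I2 -ge0_integralD//.
  - by apply: eq_integral => v _; rewrite -EFinD -mulrDl /S; congr (_ %:E); field.
  - by move=> v _; rewrite lee_fin.
  - exact/measurable_EFinP.
  - by move=> v _; rewrite lee_fin.
  - exact/measurable_EFinP.
have mF1 := @measurable_fun_fubini_tonelli_F _ _ _ _ R mu _ mK1 K10.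
have mF2 := @measurable_fun_fubini_tonelli_F _ _ _ _ R mu _ mK2 K20.
rewrite -ge0_integralD//; last 2 first.
- by move=> v _; apply: integral_ge0.
- by move=> v _; apply: integral_ge0.
apply: ge0_le_integral => //.
- by move=> v _; rewrite lee_fin modulus_ge0.
- by apply/measurable_EFinP; apply: measurable_modulus; case: GDi.
- exact: emeasurable_funD.
move=> v _; rewrite -ge0_integralD//; last 2 first.
- exact: (measurableT_comp mK1 (pair1_measurable v)).
- exact: (measurableT_comp mK2 (pair1_measurable v)).
have PGi : cintegrable (fun w => (poisson e (v - w))%:C%C * G w).
  under eq_fun do rewrite mulrC.
  apply: (cintegrable_bounded (C := 2 / e)) => //.
    by apply: complex_measurable_real; exact: measurable_poissonB.
  by move=> w; rewrite modulus_real ger0_norm ?poisson_ge0// poisson_le_inv.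
rewrite modulusM hatD modulusJ EFinM.
apply: (@le_trans _ _ ((\int[mu]_w (modulus ((poisson e (v - w))%:C%C * G w))%:E) * (modulus (G v))%:E)%E).
  rewrite lee_wpmul2r ?lee_fin ?modulus_ge0//.
  apply: (@le_trans _ _ (\int[mu]_w (modulus ((poisson e (v - w))%:C%C * G w)))%:E).
    by rewrite lee_fin modulus_cintegral.
  rewrite /Rintegral fineK//.
  exact: integrable_fin_num (integrable_modulus PGi).
have mPG : measurable_fun setT (fun w : R => modulus ((poisson e (v - w))%:C%C * G w)).
  by apply: measurable_modulus; case: PGi.
rewrite -ge0_integralZr ?lee_fin ?modulus_ge0//; last 2 first.
- exact/measurable_EFinP.
- by move=> w _; rewrite lee_fin modulus_ge0.
apply: ge0_le_integral => //.
- by move=> w _; rewrite -EFinM lee_fin mulr_ge0// modulus_ge0.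
- under eq_fun do rewrite -EFinM; apply/measurable_EFinP.
  by apply: measurable_funM => //; exact: measurable_cst.
- apply: emeasurable_funD.
  + exact: (measurableT_comp mK1 (pair1_measurable v)).
  + exact: (measurableT_comp mK2 (pair1_measurable v)).
move=> w _; rewrite /K1 /K2 /= -EFinM -EFinD lee_fin modulusM modulus_real.
rewrite ger0_norm ?poisson_ge0// -mulrA -mulrDr ler_wpM2l ?poisson_ge0//.
rewrite /S; have := sqr_ge0 (modulus (G w) - modulus (G v)).
move: (modulus (G w)) (modulus (G v)) => a b; nra.
Qed.

End Abel.

Section Bessel.
Variable R : realType.
Notation mu := (@lebesgue_measure R).
Implicit Types (f G : R -> R[i]).

Let eps n : R := n.+1%:R^-1.

Let eps_gt0 n : 0 < eps n. Proof. by rewrite invr_gt0. Qed.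

Let cvg_eps : eps @ \oo --> (0 : R). Proof. exact: cvg_harmonic. Qed.

Let cvg_abel (x : R) : abel (eps n) x @[n --> \oo] --> (1 : R).
Proof.
rewrite -expR0; apply: (@cvg_comp _ _ _ (fun n => - eps n * `|x|) (@expR R)); last exact: continuous_expR.
by rewrite -(mul0r `|x|) -oppr0; apply: cvgMl; apply: cvgN; exact: cvg_eps.
Qed.

(** Half of Plancherel's theorem, for integrable functions: let e tend to 0 in
    [abel_bessel].  It is the only L^2 estimate that the argument needs. *)
Lemma bessel G : cintegrable G ->
  (\int[mu]_u (modulus (fourier G u) ^+ 2)%:E <=
   \int[mu]_v (modulus (G v) ^+ 2)%:E)%E.
Proof.
move=> Gi; have mhatG : complex_measurable (fourier G).
  by apply: complex_measurable_fourier; case: Gi.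
apply: (@fatou_le _ setT (fun n u => (abel (eps n) u * modulus (fourier G u) ^+ 2)%:E)
  _ (fun=> \int[mu]_v (modulus (G v) ^+ 2)%:E)%E) => //.
- move=> n; apply/measurable_EFinP; apply: measurable_funM.
    exact: measurable_abel.
  exact: measurable_sqr_modulus.
- by move=> n x; rewrite lee_fin mulr_ge0 ?sqr_ge0// ltW// abel_gt0.
- move=> x; apply: cvg_EFin; first exact: nearW.
  rewrite -[X in _ --> X]mul1r; apply: cvgMl; exact: cvg_abel.
- by move=> n; exact: abel_bessel.
- exact: cvg_cst.
Qed.

Lemma cvg_integral_cutoff (chi : nat -> R -> R) (a : R -> R) :
  (forall n, measurable_fun setT (chi n)) -> (forall n x, `|chi n x| <= 1) ->
  (forall x, chi n x @[n --> \oo] --> (1 : R)) ->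
  mu.-integrable setT (EFin \o a) ->
  \int[mu]_u (chi n u * a u) @[n --> \oo] --> \int[mu]_u a u.
Proof.
move=> mchi chi1 cchi ai; have ma : measurable_fun setT a.
  by apply/measurable_EFinP; case/integrableP: ai.
have [] := @dominated_convergence _ _ R mu setT measurableT
  (fun n u => (chi n u * a u)%:E) (EFin \o a) (fun u => `|a u|%:E).
- by move=> n; apply/measurable_EFinP; apply: measurable_funM => //; exact: mchi.
- exact/measurable_EFinP.
- apply: aeW => u _; apply: cvg_EFin; first exact: nearW.
  by rewrite -[X in _ --> X]mul1r; apply: cvgMl; exact: cchi.
- exact: (integrable_abse ai).
- by apply: aeW => u n _; rewrite abse_EFin lee_fin normrM ler_piMl.
move=> _ _; rewrite /Rintegral => H.
apply: fine_cvg; rewrite fineK //.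
exact: integrable_fin_num ai.
Qed.

Let abel_mean_cvg (a : R -> R) : mu.-integrable setT (EFin \o a) ->
  \int[mu]_u (abel (eps n) u * a u) @[n --> \oo] --> \int[mu]_u a u.
Proof.
apply: (cvg_integral_cutoff (chi := fun n => abel (eps n))) => [n|n x|]; [exact: measurable_abel| |exact: cvg_abel].
by rewrite gtr0_norm ?abel_gt0// abel_le1.
Qed.

(** The Poisson kernel is an approximate identity.  Near y the continuity of a
    is used; away from y, [poisson_tail] bounds the kernel by O(eps) times a
    fixed function that is both bounded and integrable. *)
Let poisson_mean_cvg (a : R -> R) (y : R) : mu.-integrable setT (EFin \o a) ->
  {for y, continuous a} ->
  \int[mu]_v (poisson (eps n) (y - v) * a v) @[n --> \oo] --> a y.
Proof.
move=> ai ca; have ma : measurable_fun setT a.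
  by apply/measurable_EFinP; case/integrableP: ai.
apply/cvgrPdist_le => eta eta0.
have eta2 : 0 < eta / 2 by rewrite divr_gt0.
have /cvgrPdist_le/(_ _ eta2) := ca.
move=> /nbhs_ballP[d /= d0 Hd].
pose K : R := 1 + d ^- 2.
have K0 : 0 < K by rewrite ltr_wpDr// invr_ge0 sqr_ge0.
pose C : R := K * (\int[mu]_v `|a v| + `|a y| * pi).
have pi0 : 0 < pi :> R by exact: pi_gt0.
have C0 : 0 <= C.
  rewrite mulr_ge0 ?(ltW K0)// addr_ge0//; first exact: Rintegral_ge0.
  by rewrite mulr_ge0// ltW.
have pi20 : 0 < 2 * pi :> R by rewrite mulr_gt0.
near=> n.
have en0 := eps_gt0 n.
have iP := integrable_poissonB y en0.
have iPa : mu.-integrable setT (EFin \o (fun v => poisson (eps n) (y - v) * a v)).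
  apply: (@le_integrable _ _ _ mu _ measurableT _ (fun v => (2 / eps n * a v)%:E)).
  - apply/measurable_EFinP; apply: measurable_funM => //; exact: measurable_poissonB.
  - move=> v _ /=; rewrite lee_fin normrM [leRHS]normrM ler_wpM2r//.
    rewrite (ger0_norm (poisson_ge0 _ en0)) ger0_norm ?divr_ge0// ?(ltW en0)//.
    exact: poisson_le_inv.
  - exact: (integrableZl _ (2 / eps n) ai).
have E1 : a y = \int[mu]_v (poisson (eps n) (y - v) * a y).
  rewrite RintegralZr// /Rintegral integral_poissonB//= mul1r //.
have iPy : mu.-integrable setT (EFin \o (fun v => poisson (eps n) (y - v) * a y)).
  exact: (integrableZr _ (a y) iP).
rewrite [in leLHS]E1 -RintegralB//.
have iD : mu.-integrable setT (EFin \o (fun v =>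
    poisson (eps n) (y - v) * a y - poisson (eps n) (y - v) * a v)).
  exact: (integrableB _ iPy iPa).
apply: (le_trans (le_normr_Rintegral _ iD)) => //.
have iA : mu.-integrable setT (EFin \o (fun v => `|a v|)) by exact: (integrable_abse ai).
have iP2 := integrable_poissonB y pi20.
have i1 : mu.-integrable setT (EFin \o (fun v => eta / 2 * poisson (eps n) (y - v))).
  exact: (integrableZl _ (eta / 2) iP).
have i2a : mu.-integrable setT (EFin \o (fun v => `|a y| * pi * poisson (2 * pi) (y - v))).
  exact: (integrableZl _ (`|a y| * pi) iP2).
have i2 : mu.-integrable setT (EFin \o (fun v => `|a v| + `|a y| * pi * poisson (2 * pi) (y - v))).
  exact: (integrableD _ iA i2a).
have i3 : mu.-integrable setT (EFin \o (fun v => eps n * K *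
    (`|a v| + `|a y| * pi * poisson (2 * pi) (y - v)))).
  exact: (integrableZl _ (eps n * K) i2).
apply: (@le_trans _ _ (\int[mu]_v (eta / 2 * poisson (eps n) (y - v) +
   eps n * K * (`|a v| + `|a y| * pi * poisson (2 * pi) (y - v))))).
  apply: le_Rintegral => //.
  - exact: (integrable_abse iD).
  - exact: (integrableD _ i1 i3).
  move=> v _; rewrite -mulrBr normrM (ger0_norm (poisson_ge0 _ en0)).
  have P0 := poisson_ge0 (y - v) en0.
  have Q0 := poisson_ge0 (y - v) pi20.
  have A0 : 0 <= eps n * K * (`|a v| + `|a y| * pi * poisson (2 * pi) (y - v)).
    by rewrite mulr_ge0 ?(mulr_ge0 (ltW en0) (ltW K0))// addr_ge0// mulr_ge0//
      mulr_ge0// ltW.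
  have [dv|dv] := ltP `|y - v| d.
    rewrite -[leLHS]addr0 lerD//.
    by rewrite mulrC ler_wpM2r//; exact: Hd.
  have T := poisson_tail en0 d0 dv.
  rewrite -[leLHS]add0r lerD//; first by rewrite mulr_ge0// ltW.
  apply: (@le_trans _ _ (poisson (eps n) (y - v) * (`|a y| + `|a v|))).
    by rewrite ler_wpM2l// ler_normB.
  rewrite mulrDr addrC mulrDr lerD//.
    rewrite ler_wpM2r//; apply: (le_trans T); rewrite -/K.
    rewrite ler_piMr ?mulr_ge0 ?(ltW en0) ?(ltW K0)//.
    have := poisson_le_inv pi20 (y - v); rewrite invfM mulrA mulfV// mul1r.
    by move=> /(ler_wpM2l (ltW pi0)); rewrite mulfV// gt_eqF.
  rewrite (_ : eps n * K * (_ * _ * _) =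
    eps n * K * (pi * poisson (2 * pi) (y - v)) * `|a y|) ?ler_wpM2r//.
  by move: (pi) (eps n) (poisson _ _) => ? ? ?; ring.
rewrite (RintegralD _ i1 i3)// (RintegralZl _ _ iP)// (RintegralZl _ _ i2)//.
rewrite (RintegralD _ iA i2a)// (RintegralZl _ _ iP2)//.
rewrite /Rintegral !integral_poissonB//= !mulr1 -/(Rintegral _ _ _).
rewrite -mulrA -/C [leRHS](splitr eta) lerD2l.
near: n.
have : eps n * C @[n --> \oo] --> (0 : R).
  by rewrite -(mul0r C); apply: cvgMl; exact: cvg_eps.
move=> /cvgr0Pnorm_le/(_ _ eta2); apply: filterS => n.
exact/le_trans/ler_norm.
Unshelve. all: by end_near. Qed.

(** Inversion in the form in which it is used, with conjugation instead of a
    sign change: Abel summation converges to the integral of the integrable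
    function [fourier h] on one side, and to h y on the other. *)
Lemma fourier_inversion (h : R -> R[i]) (y : R) :
  cintegrable h -> cintegrable (fourier h) ->
  {for y, continuous (fun x => complex.Re (h x))} ->
  {for y, continuous (fun x => complex.Im (h x))} ->
  fourier (fun xi => conjc (fourier h xi)) y = conjc (h y).
Proof.
move=> hi hhi cr ci.
pose g u := expi (2 * pi * y * u) * fourier h u.
have mch : measurable_fun setT (fun u : R => 2 * pi * y * u).
  by apply: measurable_funM.
have gi : cintegrable g.
  by rewrite /g; under eq_fun do rewrite mulrC; exact: cintegrable_expi.
have H n : cintegral (fun u => (abel (eps n) u)%:C%C * g u) =
    cintegral (fun v => (poisson (eps n) (y - v))%:C%C * h v).
  rewrite -abel_mean_fourier//.
  by apply: eq_cintegral => u; rewrite mulrA.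
have component (c : R[i] -> R) : (forall (t : R) z, c (t%:C%C * z) = t * c z) ->
    (forall G, c (cintegral G) = \int[mu]_x c (G x)) ->
    mu.-integrable setT (EFin \o (fun x => c (g x))) ->
    mu.-integrable setT (EFin \o (fun x => c (h x))) ->
    {for y, continuous (fun x => c (h x))} -> c (cintegral g) = c (h y).
  move=> cZ cI cg ch cc; rewrite cI.
  have Hc n : \int[mu]_u (abel (eps n) u * c (g u)) =
      \int[mu]_v (poisson (eps n) (y - v) * c (h v)).
    have := congr1 c (H n); rewrite !cI => E.
    transitivity (\int[mu]_u c ((abel (eps n) u)%:C%C * g u)).
      by apply: eq_Rintegral => u _; rewrite cZ.
    by rewrite E; apply: eq_Rintegral => v _; rewrite cZ.
  have L1 := abel_mean_cvg cg.
  have L2 := poisson_mean_cvg ch cc.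
  have L3 : \int[mu]_v (poisson (eps n) (y - v) * c (h v)) @[n --> \oo] -->
      \int[mu]_u c (g u) by under eq_fun do rewrite -Hc.
  exact: (cvg_unique _ L3 L2).
have gE : cintegral g = h y.
  apply/eqP; rewrite eq_complex; apply/andP; split; apply/eqP.
  - apply: (component (@complex.Re R)) => //; [|exact: integrable_Re..].
    by move=> t z; rewrite complex_ReM /= mul0r subr0.
  - apply: (component (@complex.Im R)) => //; [|exact: integrable_Im..].
    by move=> t z; rewrite complex_ImM /= mul0r addr0.
rewrite -gE -cintegralJ//; apply: eq_cintegral => u.
rewrite /g conjcM -expiN mulrC; congr (expi _ * _); ring.
Qed.

Let cont_Re_phase (z : R[i]) (x : R) : continuous
   (fun l : R => complex.Re (z * expi (- (2 * pi * x * l)))).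
Proof.
rewrite (_ : (fun l => _) = (fun l : R => complex.Re z * cos (- (2 * pi * x * l)) - complex.Im z * sin (- (2 * pi * x * l)))); last first.
  by apply/funext => l; rewrite /expi complex_ReM.
move=> xi; have L : - (2 * pi * x * l) @[l --> xi] --> - (2 * pi * x * xi).
  by apply: cvgN; apply: cvgMr; exact: cvg_id.
apply: cvgB; apply: cvgMr.
- by apply: (cvg_comp _ _ L); exact: continuous_cos.
- by apply: (cvg_comp _ _ L); exact: continuous_sin.
Qed.

Lemma continuous_Re_fourier G : cintegrable G ->
  continuous (fun xi => complex.Re (fourier G xi)).
Proof.
move=> Gi xi.
have := @continuity_under_integral R _ _ mu
  (fun l x => complex.Re (G x * expi (- (2 * pi * x * l)))) setT measurableT
  (xi - 1) (xi + 1).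
apply.
- by move=> l _; exact: (integrable_Re (cintegrable_phase l Gi)).
- by apply: aeW => x _ l _; exact: cont_Re_phase.
- exact: (integrable_modulus Gi).
- move=> l _; apply: aeW => x _; apply: (le_trans (ler_Re _)).
  by rewrite modulusM modulus_expi mulr1.
- by rewrite inE /= in_itv /= ltrBlDr ltrDl ltr01.
Qed.

Lemma continuous_Im_fourier G : cintegrable G ->
  continuous (fun xi => complex.Im (fourier G xi)).
Proof.
move=> Gi; rewrite (_ : (fun xi => _) =
    (fun xi => complex.Re (fourier (fun x => (0 +i* -1) * G x) xi))).
  by apply: continuous_Re_fourier; exact: cintegrableZ.
by apply/funext => xi; exact: Im_fourier.
Qed.

End Bessel.

(** * Wirtinger's inequality on intervals *)

Section WirtingerInterval.
Variable R : realType.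
Notation mu := (@lebesgue_measure R).

(** With m the midpoint and c x = - k tan (k (x - m)) one has
    c' = - (k^2 + c^2), hence
    h'^2 - k^2 h^2 = (h' - h c)^2 + (h^2 c)'.
    Drop the square and integrate; the function c is regular on the interval
    because k (b - a) < pi.  The boundary values are kept, since the lemma is
    applied to approximations of a function that vanishes at the endpoints. *)
Lemma wirtinger_interval (h h' : R -> R) (a b k : R) :
  (forall x : R, is_derive x 1 h (h' x)) -> continuous h' ->
  a < b -> 0 < k -> k * (b - a) < pi ->
  (\int[mu]_(x in `[a, b]) ((k * h x) ^+ 2)%:E <=
   \int[mu]_(x in `[a, b]) (h' x ^+ 2)%:E +
   (k * tan (k * (b - a) / 2) * (h a ^+ 2 + h b ^+ 2))%:E)%E.
Proof.
move=> dh ch' ab k0 kab.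
have ch : continuous h.
  move=> x; apply: differentiable_continuous; apply/derivable1_diffP.
  by have := dh x => ?; exact: ex_derive.
pose m := (a + b) / 2.
pose c x := - k * tan (k * (x - m)).
pose F x := h x ^+ 2 * c x.
pose u x := h' x ^+ 2 - (k * h x) ^+ 2 - (h' x - h x * c x) ^+ 2.
have cosp x : a <= x <= b -> cos (k * (x - m)) != 0.
  move=> /andP[ax xb]; rewrite gt_eqF// cos_gt0_pihalf//.
  have ma : - ((b - a) / 2) <= x - m by rewrite /m; lra.
  have mb : x - m <= (b - a) / 2 by rewrite /m; lra.
  have := ler_wpM2l (ltW k0) ma; have := ler_wpM2l (ltW k0) mb.
  move: (pi) kab => p kab; rewrite mulrN mulrA => H1 H2; apply/andP; split; lra.
have dc x : a <= x <= b -> is_derive x 1 c (- (k ^+ 2 + c x ^+ 2)).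
  move=> /cosp cx.
  have H1 : is_derive x (1:R) (fun x => k * (x - m)) k.
    by apply: is_derive_eq; rewrite /GRing.scale /= ?(subr0, addr0, mulr1).
  have H2 := @is_derive1_comp _ tan (fun x : R => k * (x - m)) x _ _ (is_derive_tan cx) H1.
  apply: is_derive_eq; rewrite /GRing.scale /= cos2_tan2// /c; ring.
have dF x : a <= x <= b -> is_derive x 1 F (u x).
  move=> axb; have H1 := dc _ axb; have H2 := dh x.
  apply: is_derive_eq; rewrite /GRing.scale /= /u; ring.
have contF x : a <= x <= b -> {for x, continuous F}.
  move=> axb; apply: differentiable_continuous; apply/derivable1_diffP.
  by have := dF x axb => ?; exact: ex_derive.
have contc x : a <= x <= b -> {for x, continuous c}.
  move=> axb; apply: differentiable_continuous; apply/derivable1_diffP.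
  by have := dc x axb => ?; exact: ex_derive.
have csq (f : R -> R) x : {for x, continuous f} ->
    {for x, continuous (fun x => f x ^+ 2)}.
  by move=> cf; apply: (@continuous_comp _ _ _ f (fun y => y ^+ 2)) => //;
    exact: exprn_continuous.
have ch2 : continuous (fun x => (k * h x) ^+ 2).
  by move=> x; apply: (csq (fun x => k * h x)); apply: cvgMr; exact: ch.
have ch'2 : continuous (fun x => h' x ^+ 2).
  by move=> x; apply: (csq h'); exact: ch'.
have contu x : a <= x <= b -> {for x, continuous u}.
  move=> axb; rewrite /u; apply: cvgB.
    by apply: cvgB; [exact: ch'2|exact: ch2].
  apply: (csq (fun x => h' x - h x * c x)); apply: cvgB; first exact: ch'.
  by apply: cvgM; [exact: ch|exact: contc].
have contu' : {within `[a, b], continuous u}.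
  by apply: continuous_in_subspaceT => x /[!inE] /=; rewrite in_itv /= => /contu.
have FTC : (\int[mu]_(x in `[a, b]) (u x)%:E = (F b)%:E - (F a)%:E)%E.
  apply: continuous_FTC2 => //.
  - split.
    + move=> x; rewrite in_itv /= => /andP[ax xb].
      have : a <= x <= b by rewrite !ltW.
      by move=> /dF ?; exact: ex_derive.
    + by apply: cvg_at_right_filter; apply: contF; rewrite lexx ltW.
    + by apply: cvg_at_left_filter; apply: contF; rewrite lexx ltW.
  - move=> x; rewrite in_itv /= => /andP[ax xb].
    have : a <= x <= b by rewrite !ltW.
    by move=> /dF ?; rewrite derive1E derive_val.
set B := k * tan _ * _.
have FE : F b - F a = - B.
  rewrite /F /c /B.
  have -> : k * (b - m) = k * (b - a) / 2 by rewrite /m; field.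
  have -> : k * (a - m) = - (k * (b - a) / 2) by rewrite /m; field.
  by rewrite tanN; ring.
have iu : mu.-integrable `[a, b] (EFin \o u).
  by apply: continuous_compact_integrable => //; exact: segment_compact.
have ih : mu.-integrable `[a, b] (EFin \o (fun x => (k * h x) ^+ 2)).
  apply: continuous_compact_integrable; first exact: segment_compact.
  exact: continuous_subspaceT.
have ih' : mu.-integrable `[a, b] (EFin \o (fun x => h' x ^+ 2)).
  apply: continuous_compact_integrable; first exact: segment_compact.
  exact: continuous_subspaceT.
have Iu : (\int[mu]_(x in `[a, b]) u x)%R = - B by rewrite /Rintegral FTC -EFinB /= FE.
have : \int[mu]_(x in `[a, b]) ((k * h x) ^+ 2) <=
    \int[mu]_(x in `[a, b]) (h' x ^+ 2 - u x).
  apply: le_Rintegral => //.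
    exact: (integrableB _ ih' iu).
  move=> x _; rewrite /u; have := sqr_ge0 (h' x - h x * c x); lra.
rewrite RintegralB// Iu opprK /Rintegral -lee_fin EFinD !fineK//.
- exact: integrable_fin_num ih'.
- exact: integrable_fin_num ih.
Qed.

Lemma ge0_integral_itv_split (g : R -> \bar R) (a b c : R) :
  measurable_fun setT g -> (forall x, 0 <= g x)%E -> a <= b -> b <= c ->
  (\int[mu]_(x in `[a, c]) g x =
   \int[mu]_(x in `[a, b]) g x + \int[mu]_(x in `[b, c]) g x)%E.
Proof.
move=> mg g0 ab bc.
rewrite (@itv_bndbnd_setU _ _ (BLeft a) (BRight b) (BRight c)) ?bnd_simp//.
rewrite ge0_integral_setU//=.
- congr (_ + _)%E; rewrite -integral_itv_obnd_cbnd//; exact: measurable_funTS.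
- exact: measurable_funTS.
- apply/disj_setPS => x [] /=; rewrite !in_itv /= => /andP[_ xb] /andP[bx _].
  by move: (lt_le_trans bx xb); rewrite ltxx.
Qed.

Lemma le_integral_itv_chain (u v : R -> \bar R) (s c : nat -> R) :
  measurable_fun setT u -> measurable_fun setT v ->
  (forall x, 0 <= u x)%E -> (forall x, 0 <= v x)%E ->
  (forall i, s i <= s i.+1) ->
  (forall i, \int[mu]_(x in `[s i, s i.+1]) u x <=
     \int[mu]_(x in `[s i, s i.+1]) v x + (c i)%:E)%E ->
  forall n, (\int[mu]_(x in `[s 0%N, s n]) u x <=
     \int[mu]_(x in `[s 0%N, s n]) v x + (\sum_(i < n) c i)%:E)%E.
Proof.
move=> mu_ mv u0 v0 sS H; have s0 n : s 0%N <= s n.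
  by elim: n => // n IH; exact: le_trans IH (sS n).
elim=> [|n IH].
  by rewrite set_itv1 !integral_set1 big_ord0 adde0.
rewrite (ge0_integral_itv_split mu_ u0 (s0 n) (sS n)).
rewrite (ge0_integral_itv_split mv v0 (s0 n) (sS n)).
rewrite big_ord_recr /= EFinD; apply: (le_trans (leeD IH (H n))).
by rewrite addeACA.
Qed.

End WirtingerInterval.

(** * Wirtinger's inequality for Fourier transforms *)

Section FourierDerivative.
Variable R : realType.
Notation mu := (@lebesgue_measure R).
Implicit Types (G : R -> R[i]).

(** The function whose Fourier transform is the derivative of that of G. *)
Definition phase_deriv G : R -> R[i] := fun x => (0 +i* - (2 * pi * x)) * G x.

Lemma sqr_modulus_phase_deriv G x :
  modulus (phase_deriv G x) ^+ 2 = (2 * pi) ^+ 2 * (x ^+ 2 * modulus (G x) ^+ 2).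
Proof.
rewrite /phase_deriv modulusM [LHS]exprMn.
have E (t : R) : modulus (0 +i* t) ^+ 2 = t ^+ 2.
  by rewrite sqr_modulus /= expr0n add0r.
by rewrite E sqrrN [(_ * x) ^+ 2]exprMn mulrA.
Qed.

Let is_derive_phase (x l : R) :
  is_derive l (1 : R) (fun l : R => - (2 * pi * x * l)) (- (2 * pi * x)).
Proof. by apply: is_derive_eq; rewrite /GRing.scale /= mulr1. Qed.

Let is_derive_Re_phase G (x l : R) :
  is_derive l (1 : R) (fun l : R => complex.Re (G x * expi (- (2 * pi * x * l))))
    (complex.Re (phase_deriv G x * expi (- (2 * pi * x * l)))).
Proof.
rewrite (_ : (fun l => _) = (fun l : R => complex.Re (G x) * cos (- (2 * pi * x * l)) -
    complex.Im (G x) * sin (- (2 * pi * x * l)))); last first.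
  by apply/funext => l'; rewrite /expi complex_ReM.
have H1 := @is_derive1_comp _ cos _ l _ _ (is_derive_cos _) (is_derive_phase x l).
have H2 := @is_derive1_comp _ sin _ l _ _ (is_derive_sin _) (is_derive_phase x l).
apply: is_derive_eq; rewrite /GRing.scale /= /phase_deriv /expi.
by case: (G x) => a b /=; ring.
Qed.

Let near_itv (y : R) : `]y - 1, y + 1[%classic y.
Proof. by rewrite /= in_itv /= ltrBlDr ltrDl ltr01. Qed.

Lemma is_derive_Re_fourier G (y : R) : cintegrable G -> cintegrable (phase_deriv G) ->
  is_derive y (1 : R) (fun l => complex.Re (fourier G l))
    (complex.Re (fourier (phase_deriv G) y)).
Proof.
move=> Gi DGi.
have dE l x : derive1 (fun l : R => complex.Re (G x * expi (- (2 * pi * x * l)))) l =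
    complex.Re (phase_deriv G x * expi (- (2 * pi * x * l))).
  by have := is_derive_Re_phase G x l => ?; rewrite derive1E derive_val.
pose f (l x : R) := complex.Re (G x * expi (- (2 * pi * x * l))).
have intf l : `]y - 1, y + 1[%classic l -> mu.-integrable setT (EFin \o f l).
  by move=> _; exact: (integrable_Re (cintegrable_phase l Gi)).
have df l x : `]y - 1, y + 1[%classic l -> setT x -> derivable (f ^~ x) l 1.
  by move=> _ _; have := is_derive_Re_phase G x l => ?; exact: ex_derive.
have ub l x : `]y - 1, y + 1[%classic l -> setT x ->
    `|partial1of2 f l x| <= modulus (phase_deriv G x).
  move=> _ _; rewrite /partial1of2 dE; apply: (le_trans (ler_Re _)).
  by rewrite modulusM modulus_expi mulr1.
have D := @derivable_under_integral R _ _ mu f setT measurableT y _ _ (near_itv y)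
  intf df _ (fun x => modulus_ge0 (phase_deriv G x)) (integrable_modulus DGi) ub.
have V := @differentiation_under_integral R _ _ mu f setT measurableT y _ _ (near_itv y)
  intf df _ (fun x => modulus_ge0 (phase_deriv G x)) (integrable_modulus DGi) ub.
apply: DeriveDef; first exact: D.
rewrite -derive1E V /fourier /=; apply: eq_Rintegral => x _.
exact: dE.
Qed.

Lemma is_derive_Im_fourier G (y : R) : cintegrable G -> cintegrable (phase_deriv G) ->
  is_derive y (1 : R) (fun l => complex.Im (fourier G l))
    (complex.Im (fourier (phase_deriv G) y)).
Proof.
move=> Gi DGi; pose H x := (0 +i* -1) * G x.
have HE : phase_deriv H = (fun x => (0 +i* -1) * phase_deriv G x).
  by apply/funext => x; rewrite /phase_deriv /H mulrCA.
rewrite (_ : (fun l => _) = (fun l => complex.Re (fourier H l))); last first.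
  by apply/funext => l; exact: Im_fourier.
rewrite Im_fourier// -HE; apply: is_derive_Re_fourier; first exact: cintegrableZ.
by rewrite HE; exact: cintegrableZ.
Qed.

End FourierDerivative.

Section WirtingerFourier.
Variable R : realType.
Notation mu := (@lebesgue_measure R).
Implicit Types (F G : R -> R[i]) (w : R -> R).

Let measurable_sqr_fourier G : cintegrable G ->
  measurable_fun setT (fun x => modulus (fourier G x) ^+ 2).
Proof.
by move=> [mG _]; apply: measurable_sqr_modulus; exact: complex_measurable_fourier.
Qed.

Let wirtinger_fourier_interval G (a b k : R) :
  cintegrable G -> cintegrable (phase_deriv G) ->
  a < b -> 0 < k -> k * (b - a) < pi ->
  (\int[mu]_(x in `[a, b]) (k ^+ 2 * modulus (fourier G x) ^+ 2)%:E <=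
   \int[mu]_(x in `[a, b]) (modulus (fourier (phase_deriv G) x) ^+ 2)%:E +
   (k * tan (k * (b - a) / 2) *
     (modulus (fourier G a) ^+ 2 + modulus (fourier G b) ^+ 2))%:E)%E.
Proof.
move=> Gi DGi ab k0 kab.
have Hr := wirtinger_interval (fun x => is_derive_Re_fourier x Gi DGi)
  (continuous_Re_fourier DGi) ab k0 kab.
have Hi := wirtinger_interval (fun x => is_derive_Im_fourier x Gi DGi)
  (continuous_Im_fourier DGi) ab k0 kab.
have mr G' : cintegrable G' -> measurable_fun setT (fun x => complex.Re (fourier G' x)).
  by move=> G'i; apply: continuous_measurable_fun; exact: continuous_Re_fourier.
have mi G' : cintegrable G' -> measurable_fun setT (fun x => complex.Im (fourier G' x)).
  by move=> G'i; apply: continuous_measurable_fun; exact: continuous_Im_fourier.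
have E1 : (\int[mu]_(x in `[a, b]) (k ^+ 2 * modulus (fourier G x) ^+ 2)%:E =
    \int[mu]_(x in `[a, b]) ((k * complex.Re (fourier G x)) ^+ 2)%:E +
    \int[mu]_(x in `[a, b]) ((k * complex.Im (fourier G x)) ^+ 2)%:E)%E.
  rewrite -ge0_integralD//; last 4 first.
  - by move=> x _; rewrite lee_fin sqr_ge0.
  - apply/measurable_EFinP/measurable_funX/measurable_funTS.
    by apply: measurable_funM; [exact: measurable_cst|exact: mr].
  - by move=> x _; rewrite lee_fin sqr_ge0.
  - apply/measurable_EFinP/measurable_funX/measurable_funTS.
    by apply: measurable_funM; [exact: measurable_cst|exact: mi].
  by apply: eq_integral => x _; rewrite -EFinD sqr_modulus !exprMn mulrDr.
have E2 : (\int[mu]_(x in `[a, b]) (modulus (fourier (phase_deriv G) x) ^+ 2)%:E =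
    \int[mu]_(x in `[a, b]) ((complex.Re (fourier (phase_deriv G) x)) ^+ 2)%:E +
    \int[mu]_(x in `[a, b]) ((complex.Im (fourier (phase_deriv G) x)) ^+ 2)%:E)%E.
  rewrite -ge0_integralD//; last 4 first.
  - by move=> x _; rewrite lee_fin sqr_ge0.
  - by apply/measurable_EFinP/measurable_funX/measurable_funTS; exact: mr.
  - by move=> x _; rewrite lee_fin sqr_ge0.
  - by apply/measurable_EFinP/measurable_funX/measurable_funTS; exact: mi.
  by apply: eq_integral => x _; rewrite -EFinD sqr_modulus.
rewrite E1 E2; apply: (le_trans (leeD Hr Hi)).
rewrite addeACA leeD2l// -EFinD lee_fin -mulrDr !sqr_modulus.
by rewrite le_eqVlt; apply/orP; left; apply/eqP; congr (_ * _); ring.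
Qed.

(** The coefficient of the boundary terms of [wirtinger_interval] on the i-th gap
    for k = th pi / (gap length), where th < 1 keeps k times the length below
    pi; these terms disappear in the limit, so only their finiteness counts. *)
Definition bdry (th : R) (s : nat -> R) i : R :=
  th * pi / (s i.+1 - s i) * tan (th * pi / (s i.+1 - s i) * (s i.+1 - s i) / 2).

(** Sum [wirtinger_fourier_interval] over consecutive gaps and bound the integral
    of the derivative by Bessel's inequality for [phase_deriv G].  The hypothesis
    on w says that 2 pi th w is at most the admissible k on each gap. *)
Lemma wirtinger_fourier_chain G w (th : R) (s : nat -> R) n :
  cintegrable G -> cintegrable (phase_deriv G) -> 0 < th < 1 ->
  (forall i, s i < s i.+1) ->
  measurable_fun setT w -> (forall y, 0 <= w y) ->
  (forall i y, s i <= y <= s i.+1 -> w y * (2 * (s i.+1 - s i)) <= 1) ->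
  (\int[mu]_(x in `[s 0%N, s n])
     ((2 * pi * th * w x) ^+ 2 * modulus (fourier G x) ^+ 2)%:E <=
   \int[mu]_x ((2 * pi) ^+ 2 * (x ^+ 2 * modulus (G x) ^+ 2))%:E +
   (\sum_(i < n) bdry th s i * (modulus (fourier G (s i)) ^+ 2 +
       modulus (fourier G (s i.+1)) ^+ 2))%:E)%E.
Proof.
move=> Gi DGi /andP[th0 th1] sS mw w0 wS.
have pi0 : 0 < pi :> R by exact: pi_gt0.
pose u x := ((2 * pi * th * w x) ^+ 2 * modulus (fourier G x) ^+ 2)%:E.
pose v x := (modulus (fourier (phase_deriv G) x) ^+ 2)%:E.
have mu_ : measurable_fun setT u.
  apply/measurable_EFinP; apply: measurable_funM; last exact: measurable_sqr_fourier.
  by apply: measurable_funX; apply: measurable_funM => //; exact: measurable_cst.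
have mv : measurable_fun setT v.
  by apply/measurable_EFinP; exact: measurable_sqr_fourier.
have u0 x : (0 <= u x)%E by rewrite lee_fin mulr_ge0// sqr_ge0.
have v0 x : (0 <= v x)%E by rewrite lee_fin sqr_ge0.
pose c i := bdry th s i * (modulus (fourier G (s i)) ^+ 2 + modulus (fourier G (s i.+1)) ^+ 2).
have step i : (\int[mu]_(x in `[s i, s i.+1]) u x <=
     \int[mu]_(x in `[s i, s i.+1]) v x + (c i)%:E)%E.
  have L0 : 0 < s i.+1 - s i by rewrite subr_gt0.
  pose k := th * pi / (s i.+1 - s i).
  have k0 : 0 < k by rewrite divr_gt0// mulr_gt0.
  have kL : k * (s i.+1 - s i) < pi.
    by rewrite /k divfK ?gt_eqF// gtr_pMl.
  apply: le_trans (wirtinger_fourier_interval Gi DGi (sS i) k0 kL).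
  apply: ge0_le_integral => //.
  - by apply: measurable_funTS.
  - apply/measurable_EFinP; apply: measurable_funTS; apply: measurable_funM => //.
      exact: measurable_sqr_fourier.
  move=> x; rewrite /= in_itv /= => /wS wx.
  rewrite lee_fin ler_wpM2r ?sqr_ge0// ler_sqr ?nnegrE; last 2 first.
  - by rewrite mulr_ge0// !mulr_ge0// ltW.
  - exact: ltW.
  rewrite /k ler_pdivlMr//.
  have -> : 2 * pi * th * w x * (s i.+1 - s i) =
      th * pi * (w x * (2 * (s i.+1 - s i))).
    by move: (pi) => p; ring.
  by rewrite ler_piMr// mulr_ge0// ltW.
have chain := le_integral_itv_chain mu_ mv u0 v0 (fun i => ltW (sS i)) step n.
apply: (le_trans chain); rewrite leeD2r//.
apply: (@le_trans _ _ (\int[mu]_x v x)%E).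
  by apply: ge0_subset_integral => //.
apply: (le_trans (bessel DGi)).
by under eq_integral do rewrite sqr_modulus_phase_deriv.
Qed.

End WirtingerFourier.

Section Truncation.
Variable R : realType.
Notation mu := (@lebesgue_measure R).
Implicit Types (F : R -> R[i]).

Definition cutoff (n : nat) (x : R) : R := \1_(`[- n%:R, n%:R]%classic : set R) x.

Lemma cutoffE n x : cutoff n x = (`|x| <= n%:R)%R%:R.
Proof.
rewrite /cutoff indicE; congr (nat_of_bool _)%:R.
by apply/idP/idP; rewrite inE /= in_itv /= ler_norml.
Qed.

Lemma measurable_cutoff n : measurable_fun setT (cutoff n).
Proof. by apply: measurable_indic; exact: measurable_itv. Qed.

Lemma cutoff_ge0 n x : 0 <= cutoff n x. Proof. by rewrite cutoffE. Qed.

Lemma cutoff_le1 n x : cutoff n x <= 1. Proof. by rewrite cutoffE; case: (`|x| <= n%:R). Qed.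

Lemma cvg_cutoff x : cutoff n x @[n --> \oo] --> (1 : R).
Proof.
apply: cvg_near_cst; exists (Num.bound `|x|) => // n /= xn.
apply/eqP; rewrite cutoffE (_ : _ <= _ = true)//.
by rewrite (le_trans (ltW (archi_boundP (normr_ge0 x))))// ler_nat.
Qed.

Definition truncate F n x := (cutoff n x)%:C%C * F x.

Lemma modulus_truncate F n x : modulus (truncate F n x) = cutoff n x * modulus (F x).
Proof. by rewrite modulusM modulus_real ger0_norm// cutoff_ge0. Qed.

Lemma modulus_truncate_le F n x : modulus (truncate F n x) <= modulus (F x).
Proof. by rewrite modulus_truncate ler_piMl ?modulus_ge0// cutoff_le1. Qed.

Lemma complex_measurable_truncate F n :
  complex_measurable F -> complex_measurable (truncate F n).
Proof.
move=> mF; apply: complex_measurableM => //.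
by apply: complex_measurable_real; exact: measurable_cutoff.
Qed.

Lemma cintegrable_truncate F n : cintegrable F -> cintegrable (truncate F n).
Proof.
move=> Fi; apply: (le_cintegrable _ (modulus_truncate_le F n)).
  by apply: complex_measurable_truncate; case: Fi.
exact: integrable_modulus.
Qed.

Lemma cintegrable_phase_deriv_truncate F n : cintegrable F ->
  cintegrable (phase_deriv (truncate F n)).
Proof.
move=> Fi; have pi0 : 0 < pi :> R by exact: pi_gt0.
apply: (@le_cintegrable _ _ (fun x => 2 * pi * n%:R * modulus (F x))).
- apply: complex_measurableM; last by apply: complex_measurable_truncate; case: Fi.
  split => /=; first exact: measurable_cst.
  by apply: measurable_funN; apply: measurable_funM => //; exact: measurable_cst.
- move=> x; rewrite -ler_sqr ?nnegrE ?modulus_ge0//; last first.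
    by rewrite !mulr_ge0 ?modulus_ge0// ltW.
  rewrite sqr_modulus_phase_deriv modulus_truncate cutoffE.
  rewrite [leRHS]exprMn [(_ * n%:R) ^+ 2]exprMn -[leRHS]mulrA ler_wpM2l ?sqr_ge0//.
  have [xn|xn] := leP `|x| n%:R; last by rewrite mul0r expr0n mulr0 mulr_ge0// sqr_ge0.
  rewrite mul1r ler_wpM2r ?sqr_ge0//.
  by rewrite -[x ^+ 2]real_normK ?num_real// ler_sqr ?nnegrE.
- exact: (integrableZl _ (2 * pi * n%:R) (integrable_modulus Fi)).
Qed.

Lemma cvg_fourier_truncate F y : cintegrable F ->
  modulus (fourier (truncate F n) y) ^+ 2 @[n --> \oo] --> modulus (fourier F y) ^+ 2.
Proof.
move=> Fi; under eq_cvg do rewrite sqr_modulus; rewrite sqr_modulus.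
have chi1 n (x : R) : `|cutoff n x| <= 1 by rewrite ger0_norm ?cutoff_ge0 ?cutoff_le1.
have HR : complex.Re (fourier (truncate F n) y) @[n --> \oo] --> complex.Re (fourier F y).
  have H := cvg_integral_cutoff (fun n => measurable_cutoff n) chi1 (fun x : R => cvg_cutoff x)
    (integrable_Re (cintegrable_phase y Fi)).
  rewrite (_ : (fun n => _) = (fun n => \int[mu]_x (cutoff n x *
    complex.Re (F x * expi (- (2 * pi * x * y)))))) //.
  apply/funext => n.
  rewrite /fourier /=; apply: eq_Rintegral => x _.
  by rewrite /truncate -mulrA complex_ReM /= mul0r subr0.
have HI : complex.Im (fourier (truncate F n) y) @[n --> \oo] --> complex.Im (fourier F y).
  have H := cvg_integral_cutoff (fun n => measurable_cutoff n) chi1 (fun x : R => cvg_cutoff x)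
    (integrable_Im (cintegrable_phase y Fi)).
  rewrite (_ : (fun n => _) = (fun n => \int[mu]_x (cutoff n x *
    complex.Im (F x * expi (- (2 * pi * x * y)))))) //.
  apply/funext => n.
  rewrite /fourier /=; apply: eq_Rintegral => x _.
  by rewrite /truncate -mulrA complex_ImM /= mul0r addr0.
exact: (cvgD (cvgM HR HR) (cvgM HI HI)).
Qed.

End Truncation.

Section WirtingerFourierLine.
Variable R : realType.
Notation mu := (@lebesgue_measure R).
Implicit Types (F G : R -> R[i]) (w : R -> R).

Let cvg_sum0 (c : nat -> nat -> R) N :
  (forall i, c i n @[n --> \oo] --> (0 : R)) ->
  \sum_(i < N) c i n @[n --> \oo] --> (0 : R).
Proof.
move=> c0; elim: N => [|N IH].
  by under eq_cvg do rewrite big_ord0; exact: cvg_cst.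
rewrite (_ : (fun n => _) = (fun n => \sum_(i < N) c i n + c N n)); last first.
  by apply/funext => n; rewrite big_ord_recr.
have := cvgD IH (c0 N); rewrite addr0; exact.
Qed.

(** [fourier F] need not be differentiable when x |-> x F x is not integrable, so
    the previous lemma is applied to truncations of F.  Their transforms
    converge to [fourier F], which vanishes on s, so the boundary terms tend to
    0 and Fatou's lemma applies. *)
Lemma wirtinger_fourier_zeros F w (th : R) (s : nat -> R) N :
  cintegrable F -> 0 < th < 1 ->
  (forall i, s i < s i.+1) ->
  measurable_fun setT w -> (forall y, 0 <= w y) ->
  (forall i y, s i <= y <= s i.+1 -> w y * (2 * (s i.+1 - s i)) <= 1) ->
  (forall i, fourier F (s i) = 0) ->
  (\int[mu]_(x in `[s 0%N, s N])
     ((2 * pi * th * w x) ^+ 2 * modulus (fourier F x) ^+ 2)%:E <=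
   \int[mu]_x ((2 * pi) ^+ 2 * (x ^+ 2 * modulus (F x) ^+ 2))%:E)%E.
Proof.
move=> Fi th01 sS mw w0 wS F0.
pose B n : \bar R := (\int[mu]_x ((2 * pi) ^+ 2 * (x ^+ 2 * modulus (F x) ^+ 2))%:E +
   (\sum_(i < N) bdry th s i * (modulus (fourier (truncate F n) (s i)) ^+ 2 +
       modulus (fourier (truncate F n) (s i.+1)) ^+ 2))%:E)%E.
have mF : complex_measurable F by case: Fi.
apply: (@fatou_le _ _ (fun n x =>
  ((2 * pi * th * w x) ^+ 2 * modulus (fourier (truncate F n) x) ^+ 2)%:E) _ B).
- exact: measurable_itv.
- move=> n; apply/measurable_EFinP; apply: measurable_funM.
    by apply: measurable_funX; apply: measurable_funM => //; exact: measurable_cst.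
  apply: measurable_sqr_modulus; apply: complex_measurable_fourier.
  exact: complex_measurable_truncate.
- by move=> n x; rewrite lee_fin mulr_ge0// sqr_ge0.
- move=> x; apply: cvg_EFin; first exact: nearW.
  by apply: cvgMr; exact: cvg_fourier_truncate.
- move=> n; apply: (le_trans (wirtinger_fourier_chain _ (cintegrable_truncate n Fi)
    (cintegrable_phase_deriv_truncate n Fi) th01 sS mw w0 wS)).
  rewrite leeD2r//; apply: ge0_le_integral => //.
  + by move=> x _; rewrite lee_fin mulr_ge0 ?sqr_ge0// mulr_ge0 ?sqr_ge0.
  + apply/measurable_EFinP; apply: measurable_funM; first exact: measurable_cst.
    apply: measurable_funM; first exact: measurable_funX.
    by apply: measurable_sqr_modulus; exact: complex_measurable_truncate.
  + apply/measurable_EFinP; apply: measurable_funM; first exact: measurable_cst.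
    apply: measurable_funM; first exact: measurable_funX.
    exact: measurable_sqr_modulus.
  + move=> x _; rewrite lee_fin ler_wpM2l ?sqr_ge0// ler_wpM2l ?sqr_ge0// ler_sqr ?nnegrE ?modulus_ge0//.
    exact: modulus_truncate_le.
- rewrite /B -[X in _ --> X]adde0; apply: cvgeD.
  + by rewrite fin_num_adde_defl.
  + exact: cvg_cst.
  + apply: cvg_EFin; first exact: nearW.
    apply: (@cvg_sum0 (fun i n => bdry th s i *
      (modulus (fourier (truncate F n) (s i)) ^+ 2 +
       modulus (fourier (truncate F n) (s i.+1)) ^+ 2))) => i.
    rewrite -(mulr0 (bdry th s i)); apply: cvgMr.
    rewrite -[0]addr0; apply: cvgD.
      by have := cvg_fourier_truncate (y := s i) Fi; rewrite F0 modulus0 expr0n.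
    by have := cvg_fourier_truncate (y := s i.+1) Fi; rewrite F0 modulus0 expr0n.
Qed.

(** Finitely many gaps cover any bounded interval. *)
Lemma int_diverges_exhaust (u : int -> R) (A : R) : int_diverges u ->
  exists N : nat, u (- N%:Z) <= - A /\ A <= u N%:Z.
Proof.
move=> [/cvgryPge/(_ A)[N1 _ H1] /cvgrNyPle/(_ (- A))[N2 _ H2]].
exists (maxn N1 N2); split; [apply: H2|apply: H1] => /=.
  exact: leq_maxr.
exact: leq_maxl.
Qed.

(** Let th tend to 1 and the chain of gaps exhaust the line in
    [wirtinger_fourier_zeros].  The right-hand side may be infinite. *)
Lemma wirtinger_fourier F (lam : int -> R) w :
  cintegrable F -> int_strictly_increasing lam -> int_diverges lam ->
  measurable_fun setT w -> (forall y, 0 <= w y) ->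
  (forall j y, lam j <= y <= lam (j + 1) -> w y * (2 * (lam (j + 1) - lam j)) <= 1) ->
  (forall j, fourier F (lam j) = 0) ->
  (\int[mu]_x (w x ^+ 2 * modulus (fourier F x) ^+ 2)%:E <=
   \int[mu]_x (x ^+ 2 * modulus (F x) ^+ 2)%:E)%E.
Proof.
move=> Fi lamS lamoo mw w0 lamw F0.
have mF : complex_measurable F by case: Fi.
have mFF : complex_measurable (fourier F) by exact: complex_measurable_fourier.
have pi0 : 0 < pi :> R by exact: pi_gt0.
pose th n : R := 1 - n.+2%:R^-1.
have th01 n : 0 < th n < 1.
  by rewrite /th subr_gt0 gtrBl invr_gt0 ltr0n invf_lt1 ?ltr1n.
have cth : th n @[n --> \oo] --> (1 : R).
  rewrite -[X in _ --> X]subr0; apply: cvgB; first exact: cvg_cst.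
  have := @cvg_harmonic R; rewrite -(cvg_shiftS (@harmonic R)); exact.
have key : (\int[mu]_x ((2 * pi * w x) ^+ 2 * modulus (fourier F x) ^+ 2)%:E <=
   \int[mu]_x ((2 * pi) ^+ 2 * (x ^+ 2 * modulus (F x) ^+ 2))%:E)%E.
  pose B := (\int[mu]_x ((2 * pi) ^+ 2 * (x ^+ 2 * modulus (F x) ^+ 2))%:E)%E.
  apply: (@fatou_le _ _ (fun n x => (cutoff n x *
    ((2 * pi * th n * w x) ^+ 2 * modulus (fourier F x) ^+ 2))%:E) _ (fun=> B)) => //.
  - move=> n; apply/measurable_EFinP; apply: measurable_funM; first exact: measurable_cutoff.
    apply: measurable_funM; last exact: measurable_sqr_modulus.
    by apply: measurable_funX; apply: measurable_funM => //; exact: measurable_cst.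
  - by move=> n x; rewrite lee_fin mulr_ge0 ?cutoff_ge0// mulr_ge0// sqr_ge0.
  - move=> x; apply: cvg_EFin; first exact: nearW.
    rewrite -[X in _ --> X]mul1r; apply: cvgM; first exact: cvg_cutoff.
    apply: cvgMl.
    have H : 2 * pi * th n * w x @[n --> \oo] --> 2 * pi * w x.
      apply: cvgMl; rewrite -[X in _ --> X]mulr1; apply: cvgMr; exact: cth.
    exact: (cvgM H H).
  - move=> n; have [N [N1 N2]] := int_diverges_exhaust n%:R lamoo.
    (* the 2N gaps from lam (- N) to lam N, which cover [-n, n] *)
    pose s i := lam (i%:Z - N%:Z).
    have sE i : s i.+1 = lam (i%:Z - N%:Z + 1) by rewrite /s; congr lam; lia.
    have H := @wirtinger_fourier_zeros F w (th n) s (N + N)%N Fi (th01 n) _ mw w0 _ _.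
    apply: le_trans (H _ _ _); last 3 first.
    + by move=> i; rewrite sE; exact: lamS.
    + by move=> i y; rewrite sE => /lamw.
    + by move=> i; exact: F0.
    rewrite [leRHS]integral_mkcond.
    have A0 x : 0 <= (2 * pi * th n * w x) ^+ 2 * modulus (fourier F x) ^+ 2.
      by rewrite mulr_ge0// sqr_ge0.
    have mA : measurable_fun setT
        (fun x => (2 * pi * th n * w x) ^+ 2 * modulus (fourier F x) ^+ 2).
      apply: measurable_funM; last exact: measurable_sqr_modulus.
      by apply: measurable_funX; apply: measurable_funM => //; exact: measurable_cst.
    apply: ge0_le_integral => //.
    + by move=> x _; rewrite lee_fin mulr_ge0// cutoff_ge0.
    + by apply/measurable_EFinP; apply: measurable_funM => //; exact: measurable_cutoff.
    + apply/(measurable_restrictT _ _).1; first exact: measurable_itv.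
      by apply: measurable_funTS; exact/measurable_EFinP.
    move=> x _; rewrite patchE; case: ifPn => [_|xs].
      by rewrite lee_fin ler_piMl// cutoff_le1.
    rewrite lee_fin cutoffE (_ : (`|x| <= n%:R) = false) ?mul0r//.
    apply/negP; rewrite ler_norml => /andP[nx xn]; move/negP: xs; apply.
    rewrite inE /= in_itv /= /s; apply/andP; split.
      by apply: le_trans nx; rewrite sub0r.
    by apply: (le_trans xn); rewrite PoszD addrK.
  - exact: cvg_cst.
have E1 : (\int[mu]_x ((2 * pi * w x) ^+ 2 * modulus (fourier F x) ^+ 2)%:E =
    ((2 * pi) ^+ 2)%:E * \int[mu]_x (w x ^+ 2 * modulus (fourier F x) ^+ 2)%:E)%E.
  rewrite -ge0_integralZl_EFin ?sqr_ge0//.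
  - by apply: eq_integral => x _; rewrite -EFinM; congr (_%:E); move: (pi) => p; ring.
  - by move=> x _; rewrite lee_fin mulr_ge0// sqr_ge0.
  - apply/measurable_EFinP; apply: measurable_funM; last exact: measurable_sqr_modulus.
    exact: measurable_funX.
have E2 : (\int[mu]_x ((2 * pi) ^+ 2 * (x ^+ 2 * modulus (F x) ^+ 2))%:E =
    ((2 * pi) ^+ 2)%:E * \int[mu]_x (x ^+ 2 * modulus (F x) ^+ 2)%:E)%E.
  rewrite -ge0_integralZl_EFin ?sqr_ge0//.
  - by move=> x _; rewrite lee_fin mulr_ge0// sqr_ge0.
  - apply/measurable_EFinP; apply: measurable_funM; last exact: measurable_sqr_modulus.
    exact: measurable_funX.
move: key; rewrite E1 E2 lee_pmul2l// lte_fin exprn_gt0//.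
by rewrite mulr_gt0.
Qed.

End WirtingerFourierLine.

(** * A window with a finite moment in frequency *)

Section OscillatoryIntegrals.
Variable R : realType.
Notation mu := (@lebesgue_measure R).
Implicit Types (P Q : {poly R}) (k x : R).

Notation cI := (`[-1, 1]%classic : set R).
Notation cosI P k := (\int[mu]_(x in cI) (P.[x] * cos (k * x))).
Notation sinI P k := (\int[mu]_(x in cI) (P.[x] * sin (k * x))).

Let is_derive_lin k x : is_derive x (1 : R) (fun x : R => k * x) k.
Proof. by apply: is_derive_eq; rewrite /GRing.scale /= mulr1. Qed.

Let is_derive_sinM k x : is_derive x (1 : R) (fun x : R => sin (k * x)) (k * cos (k * x)).
Proof.
have H := @is_derive1_comp _ sin _ x _ _ (is_derive_sin _) (is_derive_lin k x).
by apply: is_derive_eq; rewrite mulrC.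
Qed.

Let is_derive_NcosM k x : is_derive x (1 : R) (fun x : R => - cos (k * x)) (k * sin (k * x)).
Proof.
have H := @is_derive1_comp _ cos _ x _ _ (is_derive_cos _) (is_derive_lin k x).
by apply: is_derive_eq; rewrite mulNr opprK mulrC.
Qed.

Let integrableI (f : R -> R) : continuous f -> mu.-integrable cI (EFin \o f).
Proof.
move=> cf; apply: continuous_compact_integrable; first exact: segment_compact.
exact: continuous_subspaceT.
Qed.

Let LR_of_derive (F f : R -> R) : (forall x : R, is_derive x (1 : R) F (f x)) ->
  derivable_oo_LRcontinuous F (-1) 1 /\ {in `](-1), 1[, derive1 F =1 f}.
Proof.
move=> dF; have cF : continuous F.
  move=> x; apply: differentiable_continuous; apply/derivable1_diffP.
  by have := dF x => ?; exact: ex_derive.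
split; last by move=> x _; have := dF x => ?; rewrite derive1E derive_val.
split.
- by move=> x _; have := dF x => ?; exact: ex_derive.
- by apply: cvg_at_right_filter; exact: cF.
- by apply: cvg_at_left_filter; exact: cF.
Qed.

Let is_derive_horner P x : is_derive x (1 : R) (horner P) (P^`()%R).[x].
Proof.
by apply: DeriveDef; [exact: derivable_horner|rewrite -derive1E derivE].
Qed.

Let by_parts P (G g : R -> R) : P.[1] = 0 -> P.[-1] = 0 ->
  (forall x : R, is_derive x (1 : R) G (g x)) -> continuous g ->
  \int[mu]_(x in cI) (P.[x] * g x) = - \int[mu]_(x in cI) ((P^`()%R).[x] * G x).
Proof.
move=> P1 PN1 dG cg.
have [LG G'] := LR_of_derive dG.
have [LP P'] := LR_of_derive (is_derive_horner P).
have lt11 : -1 < 1 :> R by lra.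
rewrite (Rintegration_by_parts lt11 _ LP P' _ LG G').
- by rewrite P1 PN1 !mul0r subrr add0r.
- by apply: continuous_subspaceT; exact: continuous_horner.
- exact: continuous_subspaceT.
Qed.

Let cosI_parts P k : P.[1] = 0 -> P.[-1] = 0 ->
  k * cosI P k = - sinI (P^`())%R k.
Proof.
move=> P1 PN1; rewrite -(by_parts P1 PN1 (is_derive_sinM k)).
- rewrite -RintegralZl//; last first.
    apply: integrableI => x; apply: cvgM; [exact: continuous_horner|exact: continuous_cosM].
  by apply: eq_Rintegral => x _; rewrite mulrCA.
- by move=> x; apply: cvgMr; exact: continuous_cosM.
Qed.

Let sinI_parts P k : P.[1] = 0 -> P.[-1] = 0 ->
  k * sinI P k = cosI (P^`())%R k.
Proof.
move=> P1 PN1; transitivity (\int[mu]_(x in cI) (P.[x] * (k * sin (k * x)))).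
  rewrite -RintegralZl//; last first.
    apply: integrableI => x; apply: cvgM; [exact: continuous_horner|exact: continuous_sinM].
  by apply: eq_Rintegral => x _; rewrite mulrCA.
rewrite (by_parts P1 PN1 (is_derive_NcosM k)).
- under eq_Rintegral do rewrite mulrN -mulN1r.
  rewrite RintegralZl ?mulN1r ?opprK//.
  apply: integrableI => x; apply: cvgM; [exact: continuous_horner|exact: continuous_cosM].
- by move=> x; apply: cvgMr; exact: continuous_sinM.
Qed.

Let deriv_mulX Q (w : {poly R}) N :
  (Q * w ^+ N.+1)^`() = (Q^`() * w + (Q * w^`()) *+ N.+1) * w ^+ N.
Proof. by rewrite derivM deriv_exp exprS mulrDl mulrnAl mulrnAr !mulrA. Qed.

(** Integrate by parts N times on [-1, 1].  The boundary terms vanish because the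
    polynomial has zeros of order N at both ends, and its derivative is again a
    polynomial multiple of (1 - X^2)^(N-1): quantifying over Q makes the
    induction go through. *)
Lemma oscillatory_decay N Q : exists2 C : R, 0 <= C & forall k,
  `|k| ^+ N * `|cosI (Q * (1 - 'X^2) ^+ N) k| <= C /\
  `|k| ^+ N * `|sinI (Q * (1 - 'X^2) ^+ N) k| <= C.
Proof.
elim: N Q => [|N IH] Q.
  exists (\int[mu]_(x in cI) `|Q.[x]|); first exact: Rintegral_ge0.
  have iQ : mu.-integrable cI (EFin \o (fun x => `|Q.[x]|)).
    apply: integrableI => x; apply: (@continuous_comp _ _ _ (horner Q) Num.norm).
      exact: continuous_horner.
    exact: norm_continuous.
  move=> k; rewrite expr0 mulr1 !mul1r; split.
  - have i : mu.-integrable cI (EFin \o (fun x => Q.[x] * cos (k * x))).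
      by apply: integrableI => x; apply: cvgM; [exact: continuous_horner|exact: continuous_cosM].
    apply: (le_trans (le_normr_Rintegral _ i)) => //.
    apply: le_Rintegral => //; first exact: (integrable_abse i).
    move=> x _; rewrite normrM ler_piMr//.
    by rewrite ler_norml cos_geN1 cos_le1.
  - have i : mu.-integrable cI (EFin \o (fun x => Q.[x] * sin (k * x))).
      by apply: integrableI => x; apply: cvgM; [exact: continuous_horner|exact: continuous_sinM].
    apply: (le_trans (le_normr_Rintegral _ i)) => //.
    apply: le_Rintegral => //; first exact: (integrable_abse i).
    move=> x _; rewrite normrM ler_piMr//.
    by rewrite ler_norml sin_geN1 sin_le1.
pose w : {poly R} := 1 - 'X^2.
have [C C0 HC] := IH (Q^`() * w + (Q * w^`()) *+ N.+1).
exists C => // k; set P := Q * w ^+ N.+1.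
have P' : P^`() = (Q^`() * w + (Q * w^`()) *+ N.+1) * w ^+ N.
  exact: deriv_mulX.
have Pz x : x ^+ 2 = 1 -> P.[x] = 0.
  by move=> x1; rewrite /P hornerM horner_exp /w hornerD hornerN hornerC hornerXn x1 subrr expr0n mulr0.
have P1 : P.[1] = 0 by apply: Pz; rewrite expr1n.
have PN1 : P.[-1] = 0 by apply: Pz; rewrite sqrrN expr1n.
have [H1 H2] := HC k.
rewrite !exprSr -!mulrA -!normrM.
by rewrite cosI_parts// sinI_parts// P' normrN.
Qed.

End OscillatoryIntegrals.

Section Window.
Variable R : realType.
Notation mu := (@lebesgue_measure R).

Let bump (N : nat) (x : R) : R := (Num.max 0 (1 - x ^+ 2)) ^+ N.+1.

Let continuous_bump N : continuous (bump N).
Proof.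
move=> x; apply: (@continuous_comp _ _ _ (fun x : R => Num.max 0 (1 - x ^+ 2)) (fun y => y ^+ N.+1)).
  have -> : (fun x : R => Num.max 0 (1 - x ^+ 2)) = (fun=> 0) \max (fun x => 1 - x ^+ 2).
    by apply/funext.
  apply: (@continuous_max R R^o); first exact: cvg_cst.
  apply: cvgB; first exact: cvg_cst.
  exact: exprn_continuous.
exact: exprn_continuous.
Qed.

Let bump_ge0 N x : 0 <= bump N x.
Proof. by rewrite exprn_ge0// le_max lexx. Qed.

Let bump_le1 N x : bump N x <= 1.
Proof.
rewrite exprn_ile1// ?le_max ?lexx//.
by rewrite ge_max ler01/= lerBlDr lerDl sqr_ge0.
Qed.

Let bumpE N x :
  bump N x = ((1 - 'X^2) ^+ N.+1 : {poly R}).[x] * \1_(`[-1, 1]%classic : set R) x.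
Proof.
rewrite /bump horner_exp hornerD hornerN hornerC hornerXn indicE.
have E : (x \in (`[-1, 1]%classic : set R)) = (x ^+ 2 <= 1).
  rewrite -[RHS](@ler_sqrt _ (x ^+ 2) 1)// sqrtr1 sqrtr_sqr ler_norml.
  by apply/idP/idP; rewrite inE /= in_itv.
rewrite E; have [x1|x1] := leP.
  by rewrite mulr1 max_r// subr_ge0.
by rewrite mulr0 max_l ?expr0n// ltW// subr_lt0.
Qed.

Let bump_eq0 N x : 1 < `|x| -> bump N x = 0.
Proof.
move=> x1; rewrite bumpE indicE memNset ?mulr0//= in_itv /= -ler_norml => H.
by move: (lt_le_trans x1 H); rewrite ltxx.
Qed.

Let measurable_bump N : measurable_fun setT (bump N).
Proof. by apply: continuous_measurable_fun; exact: continuous_bump. Qed.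

Let integrable_ind : mu.-integrable setT (EFin \o (\1_(`[-1, 1]%classic : set R) : R -> R)).
Proof.
apply/integrableP; split.
  by apply/measurable_EFinP; apply: measurable_indic; exact: measurable_itv.
under eq_integral => x _ do rewrite /= ger0_norm//.
have mI : measurable (`[-1, 1]%classic : set R) by exact: measurable_itv.
rewrite integral_indic// setIT.
by rewrite [X in (X < _)%E]lebesgue_measure_itv /=; case: ifP => //; rewrite -EFinB ltey.
Qed.

Let bump_le_ind N x : bump N x <= \1_(`[-1, 1]%classic : set R) x.
Proof.
rewrite indicE; have [xi|xi] := boolP (x \in _); first exact: bump_le1.
by rewrite bumpE indicE (negbTE xi) mulr0.
Qed.

Let integrable_bump N : mu.-integrable setT (EFin \o bump N).
Proof.
apply: le_integrable integrable_ind => //.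
  by apply/measurable_EFinP; exact: measurable_bump.
move=> x _ /=; rewrite lee_fin ger0_norm// ger0_norm// ?bump_le_ind//.
Qed.

(* On [-1/2, 1/2] the function 1 - x^2 is at least 3/4. *)
Let sqr_bump_mass N : exists2 m : R, 0 < m & (\int[mu]_x (bump N x ^+ 2)%:E = m%:E)%E.
Proof.
have mb2 : measurable_fun setT (fun x => bump N x ^+ 2).
  by apply: measurable_funX; exact: measurable_bump.
have fin : (\int[mu]_x (bump N x ^+ 2)%:E < +oo)%E.
  case/integrableP: (integrable_bump N) => _; apply: le_lt_trans.
  apply: ge0_le_integral => //.
  - by move=> x _; rewrite lee_fin sqr_ge0.
  - exact/measurable_EFinP.
  - by apply: measurableT_comp => //; apply/measurable_EFinP; exact: measurable_bump.
  - move=> x _ /=; rewrite lee_fin ger0_norm// expr2 ler_piMl// bump_le1.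
have ge0 : (0 <= \int[mu]_x (bump N x ^+ 2)%:E)%E.
  by apply: integral_ge0 => x _; rewrite lee_fin sqr_ge0.
exists (fine (\int[mu]_x (bump N x ^+ 2)%:E)); last by rewrite fineK// ge0_fin_numE.
rewrite fine_gt0// fin andbT.
pose d : R := (3 / 4) ^+ N.+1.
have d0 : 0 < d by rewrite exprn_gt0// divr_gt0.
apply: (@lt_le_trans _ _ (\int[mu]_x ((d ^+ 2)%:E * (\1_(`[- 2^-1, 2^-1]%classic : set R) x)%:E))%E).
  rewrite ge0_integralZl_EFin ?sqr_ge0//; last first.
    by apply/measurable_EFinP; apply: measurable_indic; exact: measurable_itv.
  have mI : measurable (`[- 2^-1, 2^-1]%classic : set R) by exact: measurable_itv.
  rewrite integral_indic// setIT.
  rewrite [X in (_ < _ * X)%E]lebesgue_measure_itv /= lte_fin ifT; last by lra.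
  by rewrite -EFinB -EFinM lte_fin mulr_gt0 ?exprn_gt0//; lra.
apply: ge0_le_integral => //.
- by move=> x _; rewrite -EFinM lee_fin mulr_ge0// sqr_ge0.
- under eq_fun do rewrite -EFinM; apply/measurable_EFinP.
  by apply: measurable_funM => //; apply: measurable_indic; exact: measurable_itv.
- exact/measurable_EFinP.
- move=> x _; rewrite -EFinM lee_fin indicE.
  have [|] := boolP (x \in _); last by rewrite mulr0 sqr_ge0.
  rewrite inE /= in_itv /= => /andP[x1 x2]; rewrite mulr1 ler_sqr ?nnegrE// ?(ltW d0)//.
  rewrite /d /bump; apply: lerXn2r; rewrite ?nnegrE ?le_max ?lexx//; try lra.
  by apply/orP; right; nra.
Qed.

Let integral_bumpM N (h : R -> R) :
  \int[mu]_x (bump N x * h x) =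
  \int[mu]_(x in `[-1, 1]) ((1 * (1 - 'X^2) ^+ N.+1).[x] * h x).
Proof.
rewrite [RHS]Rintegral_mkcond; apply: eq_Rintegral => x _.
rewrite bumpE indicE patchE mul1r; case: ifPn => _; first by rewrite mulr1.
by rewrite mulr0 mul0r.
Qed.

Let integrable_bumpM N (h : R -> R) : measurable_fun setT h ->
  (forall x, `|h x| <= 1) -> mu.-integrable setT (EFin \o (fun x => bump N x * h x)).
Proof.
move=> mh h1; apply: le_integrable (integrable_bump N) => //.
  by apply/measurable_EFinP; apply: measurable_funM => //; exact: measurable_bump.
by move=> x _ /=; rewrite lee_fin normrM ler_piMr.
Qed.

Let cos_norm_le1 (t : R) : `|cos t| <= 1.
Proof. by rewrite ler_norml cos_geN1 cos_le1. Qed.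

Let sin_norm_le1 (t : R) : `|sin t| <= 1.
Proof. by rewrite ler_norml sin_geN1 sin_le1. Qed.

Let fourier_bump N (c xi : R) :
  fourier (fun x => (c * bump N x)%:C%C) xi =
  c * (\int[mu]_(x in `[-1, 1]) ((1 * (1 - 'X^2) ^+ N.+1).[x] * cos (2 * pi * xi * x))) +i*
  (- c * (\int[mu]_(x in `[-1, 1]) ((1 * (1 - 'X^2) ^+ N.+1).[x] * sin (2 * pi * xi * x)))).
Proof.
have E (x : R) : - (2 * pi * x * xi) = - (2 * pi * xi * x) by move: (pi) => p; ring.
rewrite /fourier /cintegral; congr (_ +i* _).
- rewrite -integral_bumpM -RintegralZl//; last first.
    by apply: integrable_bumpM => //; exact: measurable_cosM.
  apply: eq_Rintegral => x _; rewrite complex_ReM /= mul0r subr0 E cosN; ring.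
- rewrite -integral_bumpM -RintegralZl//; last first.
    by apply: integrable_bumpM => //; exact: measurable_sinM.
  apply: eq_Rintegral => x _; rewrite complex_ImM /= mul0r addr0 E sinN; ring.
Qed.

(** The window is a normalized power of max (0, 1 - x^2).  For N >= s,
    [oscillatory_decay] makes its transform O(|z|^(-N-1)), so that
    |z|^s times the square of the transform is O(1 / (1 + z^2)). *)
Lemma exists_window (s : R) : 0 <= s -> exists (g : R -> R) (M : R),
  [/\ continuous g, (forall x, 1 < `|x| -> g x = 0),
      (exists K, forall x, `|g x| <= K),
      (\int[mu]_x (g x ^+ 2)%:E = 1)%E &
      (\int[mu]_z (`|z| `^ s * modulus (fourier (fun x => (g x)%:C%C) z) ^+ 2)%:E
        <= M%:E)%E].
Proof.
move=> s0; pose N := Num.bound s.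
have sN : s <= N%:R by exact/ltW/archi_boundP.
have [m m0 mE] := sqr_bump_mass N.
pose c : R := Num.sqrt m^-1.
have c2 : c ^+ 2 = m^-1 by rewrite sqr_sqrtr// invr_ge0 ltW.
pose g x := c * bump N x.
have cg : continuous g by move=> x; apply: cvgMr; exact: continuous_bump.
have mg : measurable_fun setT g by apply: continuous_measurable_fun.
have gi : cintegrable (fun x => (g x)%:C%C).
  by apply: cintegrable_real; exact: (integrableZl _ c (integrable_bump N)).
have [C C0 HC] := oscillatory_decay N.+1 (1 : {poly R}).
pose K0 : R := \int[mu]_x modulus (g x)%:C%C.
have K00 : 0 <= K0 by apply: Rintegral_ge0 => x _; exact: modulus_ge0.
pose D : R := 4 * (c ^+ 2 * C ^+ 2) + 2 * K0 ^+ 2.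
have cC : 0 <= c ^+ 2 * C ^+ 2 by apply: mulr_ge0; exact: sqr_ge0.
have D0 : 0 <= D by rewrite /D; have := sqr_ge0 K0; lra.
have pi0 : 0 < pi :> R by exact: pi_gt0.
have pi20 : 0 < 2 * pi :> R by rewrite mulr_gt0.
exists g, (D * pi); split => //.
- by move=> x x1; rewrite /g bump_eq0// mulr0.
- exists `|c| => x; rewrite /g normrM (ger0_norm (bump_ge0 _ _)).
  by rewrite ler_piMr// bump_le1.
- rewrite (_ : (\int[mu]_x _ = (m^-1)%:E * \int[mu]_x (bump N x ^+ 2)%:E)%E).
    by rewrite mE -EFinM mulVf// gt_eqF.
  rewrite -ge0_integralZl_EFin ?invr_ge0 ?(ltW m0)//.
  + by apply: eq_integral => x _; rewrite -EFinM -c2 -exprMn.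
  + by move=> x _; rewrite lee_fin sqr_ge0.
  + by apply/measurable_EFinP; apply: measurable_funX; exact: measurable_bump.
have bound z : `|z| `^ s * modulus (fourier (fun x => (g x)%:C%C) z) ^+ 2 <=
    D * (pi * poisson (2 * pi) z).
  rewrite poisson_2pi ler_pdivlMr ?ltr_wpDr ?sqr_ge0//.
  set h := modulus _ ^+ 2.
  have h0 : 0 <= h by exact: sqr_ge0.
  have hK : h <= K0 ^+ 2.
    by rewrite ler_sqr ?nnegrE ?modulus_ge0//; exact: modulus_fourier.
  have [z1|z1] := leP `|z| 1.
    have zs : `|z| `^ s <= 1.
      have e1 : 1 `^ s = 1 :> R by rewrite powR1.
      by rewrite -e1; apply: ge0_ler_powR => //; rewrite nnegrE.
    have z2 : 1 + z ^+ 2 <= 2.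
      by rewrite -[2]/(1 + 1) lerD2l -real_normK ?num_real// exprn_ile1.
    have A0 : 0 <= `|z| `^ s by exact: powR_ge0.
    have : `|z| `^ s * h <= K0 ^+ 2 by rewrite (le_trans _ hK)// ler_piMl.
    have zz := sqr_ge0 z.
    have Ah : 0 <= `|z| `^ s * h by rewrite mulr_ge0.
    rewrite /D; move: (`|z| `^ s * h) (K0 ^+ 2) (c ^+ 2 * C ^+ 2) Ah cC => t u v t0 v0 tu.
    by nra.
  have [H1 H2] := HC (2 * pi * z).
  have hE : h = c ^+ 2 * ((\int[mu]_(x in `[-1, 1]) ((1 * (1 - 'X^2) ^+ N.+1).[x] * cos (2 * pi * z * x))) ^+ 2 +
     (\int[mu]_(x in `[-1, 1]) ((1 * (1 - 'X^2) ^+ N.+1).[x] * sin (2 * pi * z * x))) ^+ 2).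
    by rewrite /h fourier_bump sqr_modulus [complex.Re _]/= [complex.Im _]/= !exprMn sqrrN -mulrDr.
  have z0 : 0 < `|z| by exact: lt_trans z1.
  have kz : `|z| <= `|2 * pi * z|.
    rewrite normrM ler_peMl// gtr0_norm//.
    have := pi_ge2 R; move: (pi) => p; lra.
  have zh : (z ^+ 2) ^+ N.+1 * h <= 2 * (c ^+ 2 * C ^+ 2).
    rewrite hE mulrCA [leRHS]mulrCA ler_wpM2l ?sqr_ge0// mulrDr.
    have -> : 2 * C ^+ 2 = C ^+ 2 + C ^+ 2 by ring.
    have G (t : R) : `|2 * pi * z| ^+ N.+1 * `|t| <= C -> (z ^+ 2) ^+ N.+1 * t ^+ 2 <= C ^+ 2.
      move=> Ht; rewrite -(real_normK (num_real z)) -(real_normK (num_real t)).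
      have zt : 0 <= `|z| ^+ N.+1 * `|t| by apply: mulr_ge0 => //; exact: exprn_ge0.
      rewrite exprAC -exprMn ler_sqr ?nnegrE//.
      apply: le_trans Ht; rewrite ler_wpM2r//.
      by apply: lerXn2r; rewrite ?nnegrE.
    by apply: lerD; apply: G.
  have zs : `|z| `^ s <= (z ^+ 2) ^+ N.
    rewrite -(real_normK (num_real z)) -exprM.
    rewrite -powR_mulrn//; apply: ler_powR; first exact: ltW.
    by rewrite (le_trans sN)// ler_nat leq_pmull.
  have z2 : 1 <= z ^+ 2 by rewrite -(real_normK (num_real z)) exprn_ege1// ltW.
  apply: (@le_trans _ _ ((z ^+ 2) ^+ N * h * (2 * z ^+ 2))).
    have -> : 2 * z ^+ 2 = z ^+ 2 + z ^+ 2 by ring.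
    apply: ler_pM.
    - by apply: mulr_ge0 => //; exact: powR_ge0.
    - by rewrite addr_ge0 ?sqr_ge0.
    - by rewrite ler_wpM2r.
    - by rewrite lerD2r.
  have -> : (z ^+ 2) ^+ N * h * (2 * z ^+ 2) = 2 * ((z ^+ 2) ^+ N.+1 * h).
    by rewrite [(z ^+ 2) ^+ N.+1]exprS; move: ((z ^+ 2) ^+ N) (z ^+ 2) => a b; ring.
  have := sqr_ge0 K0; move: zh; rewrite /D.
  move: ((z ^+ 2) ^+ N.+1 * h) (c ^+ 2 * C ^+ 2) (K0 ^+ 2) => a b t ab t0; lra.
have mhat : measurable_fun setT (fun z => modulus (fourier (fun x => (g x)%:C%C) z) ^+ 2).
  by apply: measurable_sqr_modulus; apply: complex_measurable_fourier; case: gi.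
have mnorm : measurable_fun setT (fun z : R => `|z| `^ s).
  by apply: (measurableT_comp (measurable_powR s)); exact: normr_measurable.
have mP := measurable_poisson pi20.
apply: (@le_trans _ _ (\int[mu]_z (D * (pi * poisson (2 * pi) z))%:E)%E).
  apply: ge0_le_integral => //.
  - by move=> z _; rewrite lee_fin; apply: mulr_ge0; [exact: powR_ge0|exact: sqr_ge0].
  - by apply/measurable_EFinP; exact: measurable_funM.
  - apply/measurable_EFinP; apply: measurable_funM; first exact: measurable_cst.
    by apply: measurable_funM => //; exact: measurable_cst.
  - by move=> z _; rewrite lee_fin; exact: bound.
under eq_integral do rewrite mulrA EFinM.
rewrite ge0_integralZl_EFin ?integral_poisson ?mule1//.
- by move=> z _; rewrite lee_fin poisson_ge0.
- exact/measurable_EFinP.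
- by rewrite mulr_ge0// ltW.
Qed.

End Window.

(** * Convexity of powers *)

Section PowerInequalities.
Variable R : realType.
Implicit Types A B P Q r : R.

(** Convexity: the graph of t |-> t^r lies above its tangent at P.  It is Young's
    inequality for the exponents r and r / (r - 1). *)
Lemma powR_tangent r P Q : 1 <= r -> 0 <= P -> 0 <= Q ->
  r * P `^ (r - 1) * Q <= Q `^ r + (r - 1) * P `^ r.
Proof.
move=> r1 P0 Q0; have r0 : 0 < r by exact: lt_le_trans r1.
have [->|rn1] := eqVneq r 1.
  by rewrite subrr powRr0 mul0r addr0 powRr1// !mul1r.
have rp : 0 < r - 1 by rewrite subr_gt0 lt_neqAle eq_sym rn1.
pose q := r / (r - 1).
have q0 : 0 < q by exact: divr_gt0.
have rq : r^-1 + q^-1 = 1.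
  by rewrite /q invf_div; field; rewrite gt_eqF.
have := conjugate_powR Q0 (powR_ge0 P (r - 1)) r0 q0 rq.
rewrite -powRrM (_ : (r - 1) * q = r); last by rewrite /q mulrC divfK// gt_eqF.
move=> /(ler_wpM2l (ltW r0)); rewrite mulrDr.
rewrite [r * (_ / r)]mulrC divfK ?gt_eqF//.
rewrite (_ : r * (P `^ r / q) = (r - 1) * P `^ r); last first.
  by rewrite /q; field; rewrite !gt_eqF.
by rewrite mulrAC -mulrA.
Qed.

(** Jensen's inequality for the weights A / (A + 1) and 1 / (A + 1) at the points
    1 and B, whose mean is (A + B) / (A + 1).  The factor A + B^r is what lets a
    moment of B be integrated out in [shifted_moment]. *)
Lemma powR_add_le r A B : 1 <= r -> 0 <= A -> 0 <= B ->
  (A + B) `^ r <= (A + 1) `^ (r - 1) * (A + B `^ r).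
Proof.
move=> r1 A0 B0; have A1 : 0 < A + 1 by rewrite ltr_wpDl.
have r0 : 0 < r by exact: lt_le_trans r1.
pose c := (A + B) / (A + 1).
have c0 : 0 <= c by rewrite divr_ge0 ?addr_ge0.
have cE : A + B = c * (A + 1) by rewrite divfK// gt_eqF.
(* Jensen from the tangents at the mean c *)
have T1 := powR_tangent r1 c0 ler01; rewrite powR1 mulr1 in T1.
have TB := powR_tangent r1 c0 B0.
have cc : c * c `^ (r - 1) = c `^ r by exact: mulr_powRB1.
have key : (A + 1) * c `^ r <= A + B `^ r.
  have := ler_wpM2l A0 T1; rewrite -cc in T1 TB *.
  move: (c `^ (r - 1)) (B `^ r) TB => u v TB TA.
  have E : A * (r * u) + r * u * B = r * (c * u) * (A + 1).
    by transitivity (r * u * (A + B)); [ring|rewrite cE; ring].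
  by nra.
rewrite cE powRM ?(ltW A1)// -[X in _ * X <= _](mulr_powRB1 (ltW A1) r0).
rewrite mulrA mulrC [c `^ r * _]mulrC ler_wpM2l// powR_ge0//.
Qed.

End PowerInequalities.

(** * Short-time Fourier transform *)

Section Energy.
Variable R : realType.
Notation mu := (@lebesgue_measure R).
Implicit Types f : R -> R[i].

Let pi0 : 0 < pi :> R. Proof. exact: pi_gt0. Qed.

Let pi20 : 0 < 2 * pi :> R. Proof. by rewrite mulr_gt0. Qed.

Lemma measurable_energy_density f : complex_measurable f ->
  measurable_fun setT (fun x : R => x ^+ 2 * modulus (f x) ^+ 2).
Proof.
move=> mf; apply: measurable_funM; first exact: measurable_funX.
exact: measurable_sqr_modulus.
Qed.

Lemma weighted_energyE f : complex_measurable f ->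
  (weighted_energy f = \int[mu]_x (modulus (f x) ^+ 2)%:E +
    \int[mu]_x (x ^+ 2 * modulus (f x) ^+ 2)%:E)%E.
Proof.
move=> mf; rewrite /weighted_energy -ge0_integralD//.
- by apply: eq_integral => x _; rewrite -EFinD mulrDl mul1r.
- by move=> x _; rewrite lee_fin sqr_ge0.
- by apply/measurable_EFinP; exact: measurable_sqr_modulus.
- by move=> x _; rewrite lee_fin; apply: mulr_ge0; exact: sqr_ge0.
- by apply/measurable_EFinP; exact: measurable_energy_density.
Qed.

(** |f| <= (1 + x^2) |f|^2 + 1 / (1 + x^2). *)
Lemma cintegrable_energy f : complex_measurable f ->
  (weighted_energy f < +oo)%E -> cintegrable f.
Proof.
move=> mf foo.
pose h x := (1 + x ^+ 2) * modulus (f x) ^+ 2 + pi * poisson (2 * pi) x.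
apply: (@le_cintegrable _ _ h) => //.
  move=> x; rewrite /h poisson_2pi.
  have u0 : 0 < 1 + x ^+ 2 by rewrite ltr_wpDr ?sqr_ge0.
  rewrite -[leRHS](mulfK (lt0r_neq0 u0)) ler_pdivlMr// mulrDl mulVf ?gt_eqF//.
  move: (modulus (f x)) (modulus_ge0 (f x)) (1 + x ^+ 2) u0 => t t0 u u0.
  have := sqr_ge0 (u * t - 1); nra.
have mE : measurable_fun setT (fun x : R => (1 + x ^+ 2) * modulus (f x) ^+ 2).
  apply: measurable_funM; last exact: measurable_sqr_modulus.
  by apply: measurable_funD => //; exact: measurable_funX.
have i1 : mu.-integrable setT (EFin \o (fun x => (1 + x ^+ 2) * modulus (f x) ^+ 2)).
  apply/integrableP; split; first exact/measurable_EFinP.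
  under eq_integral => x _.
    rewrite /= ger0_norm; last by rewrite mulr_ge0 ?sqr_ge0// addr_ge0 ?sqr_ge0.
    over.
  exact: foo.
have i2 : mu.-integrable setT (EFin \o (fun x => pi * poisson (2 * pi) x)).
  have := integrable_poissonB 0 pi20.
  under eq_fun do rewrite /= sub0r poissonN.
  exact: integrableZl.
exact: (integrableD _ i1 i2).
Qed.

End Energy.

Section ShortTimeFourier.
Variable R : realType.
Notation mu := (@lebesgue_measure R).
Variables (f : R -> R[i]) (g : R -> R) (K : R).
Hypotheses (fi : cintegrable f) (mg : measurable_fun setT g).
Hypothesis gK : forall x, `|g x| <= K.
Hypothesis gi : cintegrable (fun x => (g x)%:C%C).

Definition windowed x y : R[i] := f y * (g (y - x))%:C%C.

Definition stft x xi : R[i] := fourier (windowed x) xi.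

Lemma measurable_windowed x : complex_measurable (windowed x).
Proof.
apply: complex_measurableM; first by case: fi.
apply: complex_measurable_real; apply: (measurableT_comp mg).
by apply: measurable_funB.
Qed.

Lemma cintegrable_windowed x : cintegrable (windowed x).
Proof.
apply: (cintegrable_bounded (C := K)) => //.
  apply: complex_measurable_real; apply: (measurableT_comp mg).
  by apply: measurable_funB.
by move=> y; rewrite modulus_real.
Qed.

Lemma measurable_stft : complex_measurable (fun p : R * R => stft p.1 p.2).
Proof.
apply: (@complex_measurable_cintegral _ _ _
  (fun q : (R * R) * R => f q.2 * (g (q.2 - q.1.1))%:C%C * expi (- (2 * pi * q.2 * q.1.2)))).
apply: complex_measurableM; first apply: complex_measurableM.
- exact: (complex_measurable_comp (proj1 fi) measurable_snd).
- apply: complex_measurable_real; apply: (measurableT_comp mg).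
  by apply: measurable_funB => //; apply: measurableT_comp.
- apply: complex_measurable_expi; apply: measurable_funN.
  apply: measurable_funM; first by apply: measurable_funM.
  by apply: measurableT_comp.
Qed.

Lemma bessel_stft x : (\int[mu]_xi (modulus (stft x xi) ^+ 2)%:E <=
  \int[mu]_y (modulus (windowed x y) ^+ 2)%:E)%E.
Proof. exact: bessel (cintegrable_windowed x). Qed.

Variable F : R -> R[i].
Hypotheses (Fi : cintegrable F) (fF : forall y, f y = conjc (fourier F y)).

Let ghat := fourier (fun x => (g x)%:C%C).

Let Fgi xi : cintegrable (fun eta => F eta * ghat (eta - xi)).
Proof.
apply: (cintegrable_bounded (C := \int[mu]_x modulus (g x)%:C%C)) => //; last first.
  by move=> eta; exact: modulus_fourier.
have mh : complex_measurable ghat by apply: complex_measurable_fourier; case: gi.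
have mB : measurable_fun setT (fun eta : R => eta - xi) by apply: measurable_funB.
exact: (complex_measurable_comp mh mB).
Qed.

(** Read on the frequency side: the product of f with the translated and
    modulated window is integrated through the multiplication formula, and the
    transform of the modulated translate of g is, up to a unimodular factor, the
    translate of [ghat] by xi. *)
Lemma modulus_stft x xi :
  modulus (stft x xi) = modulus (fourier (fun eta => F eta * ghat (eta - xi)) x).
Proof.
pose A y := (g (y - x))%:C%C * expi (2 * pi * y * xi).
have mexp : measurable_fun setT (fun y : R => 2 * pi * y * xi).
  by apply: measurable_funM => //; apply: measurable_funM.
have Ai : cintegrable A.
  apply: cintegrable_expi => //; apply: cintegrable_real.
  apply/integrableP; split.
    apply/measurable_EFinP; apply: (measurableT_comp mg).
    by apply: measurable_funB.
  have [_] := gi; under eq_integral do rewrite modulus_real.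
  rewrite -(@ge0_integral_shift _ (fun y => `|g y|%:E) (- x))//.
  by apply/measurable_EFinP; exact: measurableT_comp.
have hatA eta : fourier A eta = expi (- (2 * pi * x * (eta - xi))) * ghat (eta - xi).
  rewrite /ghat [fourier (fun x => (g x)%:C%C) _]/fourier -cintegralZ; last exact: cintegrable_phase.
  pose k t := expi (- (2 * pi * x * (eta - xi))) *
    ((g t)%:C%C * expi (- (2 * pi * t * (eta - xi)))).
  rewrite -[RHS](@cintegral_shift _ k (- x)); last first.
    apply: complex_measurableM; first exact: complex_measurable_cst.
    apply: complex_measurableM; first by case: gi.
    by apply: complex_measurable_expi; exact: measurable_phase.
  apply: eq_cintegral => y; rewrite /A /k mulrCA -mulrA -!expiD.
  by congr (_ * expi _); ring.
have stftE : conjc (stft x xi) =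
    expi (2 * pi * x * xi) * fourier (fun eta => F eta * ghat (eta - xi)) x.
  rewrite /stft /fourier -cintegralJ; last exact/cintegrable_phase/cintegrable_windowed.
  rewrite -/(fourier _ _) -cintegralZ; last exact: cintegrable_phase.
  transitivity (cintegral (fun y => A y * fourier F y)).
    apply: eq_cintegral => y; rewrite /windowed !conjcM fF conjcK conjc_real -expiN opprK /A.
    by ring.
  rewrite fourier_multiplication//; apply: eq_cintegral => eta.
  have -> : fourier A eta = expi (2 * pi * x * xi) * expi (- (2 * pi * eta * x)) *
      ghat (eta - xi).
    by rewrite hatA -expiD; congr (expi _ * _); ring.
  by ring.
by rewrite -(modulusJ (stft x xi)) stftE modulusM modulus_expi mul1r.
Qed.

(** Bessel's inequality in the position x, for fixed frequency xi. *)
Lemma bessel_stft_freq xi : (\int[mu]_x (modulus (stft x xi) ^+ 2)%:E <=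
  \int[mu]_eta (modulus (F eta) ^+ 2 * modulus (ghat (eta - xi)) ^+ 2)%:E)%E.
Proof.
under eq_integral do rewrite modulus_stft.
apply: (le_trans (bessel (Fgi xi))).
by under eq_integral do rewrite modulusM exprMn.
Qed.

End ShortTimeFourier.

(** * Gaps, moments and shifts *)

Section GapCondition.
Variable R : realType.

(** The shape of the gap hypothesis that [wirtinger_fourier] uses, with the
    weight evaluated at all points of the gap and not only at its left end. *)
Definition gap_condition (s D : R) (lam : int -> R) : Prop := forall j y,
  lam j <= y <= lam (j + 1) ->
  (`|y| + D) `^ s * (2 * (lam (j + 1) - lam j)) <= 1.

(** With the shift D + 1 >= 1 the supremum condition forces gaps of length at
    most 1/2, so that |y| <= |lam j| + 1 on the j-th gap: one unit of the shift
    pays for moving the weight from lam j to y. *)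
Lemma gap_condition_of_sup (p D : R) (lam : int -> R) : 1 < p -> 0 <= D ->
  int_strictly_increasing lam -> (gap_sup p (D + 1) lam <= (2^-1)%:E)%E ->
  gap_condition (p - 1) D lam.
Proof.
move=> p1 D0 lamS sup j y /andP[y1 y2].
have L0 : 0 < lam (j + 1) - lam j by rewrite subr_gt0.
set L := lam (j + 1) - lam j in L0 *.
have p0 : 0 <= p - 1 by rewrite subr_ge0 ltW.
have H : (`|lam j| + (D + 1)) `^ (p - 1) * L <= 2^-1.
  rewrite -lee_fin; apply: le_trans sup; apply: ereal_sup_ubound.
  by exists j.
have one : 1 <= (`|lam j| + (D + 1)) `^ (p - 1).
  have e1 : 1 `^ (p - 1) = 1 :> R by rewrite powR1.
  by rewrite -[leLHS]e1; apply: ge0_ler_powR; rewrite ?nnegrE//;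
    have := normr_ge0 (lam j); lra.
have L1 : L <= 2^-1.
  by apply: le_trans H; rewrite ler_peMl// ltW.
have yl : `|y| <= `|lam j| + 1.
  have -> : y = lam j + (y - lam j) by ring.
  apply: (le_trans (ler_normD _ _)); rewrite lerD2l ger0_norm ?subr_ge0//.
  by move: L1; rewrite /L; lra.
apply: (@le_trans _ _ ((`|lam j| + (D + 1)) `^ (p - 1) * (2 * L))).
  rewrite ler_wpM2r ?mulr_ge0 ?(ltW L0)//.
  have yn := normr_ge0 y; have ln := normr_ge0 (lam j).
  by apply: ge0_ler_powR; rewrite ?nnegrE//; lra.
by rewrite mulrCA; move: H; lra.
Qed.

End GapCondition.

Section WindowMoment.
Variable R : realType.
Notation mu := (@lebesgue_measure R).

(** This is where the shift d comes from: by [powR_add_le] at A = |eta|, B = |u|,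
    the integral is at most (|eta| + 1)^(2r-1) (|eta| + M), which d >= 1 and
    d >= M bring below (|eta| + d)^(2r). *)
Lemma shifted_moment (r M d : R) (h : R -> R) (eta : R) :
  1 <= r -> 1 <= d -> M <= d -> measurable_fun setT h -> (forall z, 0 <= h z) ->
  (\int[mu]_z (h z)%:E <= 1)%E ->
  (\int[mu]_z (`|z| `^ (2 * r) * h z)%:E <= M%:E)%E ->
  (\int[mu]_xi ((xi ^+ 2) `^ r * h (eta - xi))%:E <= ((`|eta| + d) `^ (2 * r))%:E)%E.
Proof.
move=> r1 d1 Md mh h0 h1 hM; set s := 2 * r.
have s1 : 1 <= s by rewrite /s; lra.
have d0 : 0 <= d by lra.
have sqE z : (z ^+ 2) `^ r = `|z| `^ s.
  by rewrite /s powRrM -(real_normK (num_real z)) powR_mulrn.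
have mpow : measurable_fun setT (fun z : R => `|z| `^ s).
  by apply: (measurableT_comp (measurable_powR s)); exact: normr_measurable.
have mk : measurable_fun setT (fun u : R => `|eta - u| `^ s * h u).
  apply: measurable_funM => //; apply: (measurableT_comp mpow).
  by apply: measurable_funB.
have -> : (\int[mu]_xi ((xi ^+ 2) `^ r * h (eta - xi))%:E =
    \int[mu]_u (`|eta - u| `^ s * h u)%:E)%E.
  rewrite -(@ge0_integral_shift _ (fun u => (`|eta - u| `^ s * h u)%:E) eta); last 2 first.
  - exact/measurable_EFinP.
  - by move=> u; rewrite lee_fin mulr_ge0 ?powR_ge0.
  rewrite -(@ge0_integral_reflect _ (fun u => (`|eta - (u + eta)| `^ s * h (u + eta))%:E)); last 2 first.
  - apply/measurable_EFinP; apply: (measurableT_comp mk).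
    by apply: measurable_funD.
  - by move=> u; rewrite lee_fin mulr_ge0 ?powR_ge0.
  apply: eq_integral => xi _; rewrite sqE.
  by rewrite (_ : eta - (- xi + eta) = xi) 1?(_ : - xi + eta = eta - xi)//; ring.
pose c := (`|eta| + 1) `^ (s - 1).
have c0 : 0 <= c by exact: powR_ge0.
apply: (@le_trans _ _ (\int[mu]_u (c * (`|eta| * h u + `|u| `^ s * h u))%:E)%E).
  apply: ge0_le_integral => //.
  - by move=> u _; rewrite lee_fin mulr_ge0 ?powR_ge0.
  - exact/measurable_EFinP.
  - apply/measurable_EFinP; apply: measurable_funM; first exact: measurable_cst.
    apply: measurable_funD; last exact: measurable_funM.
    by apply: measurable_funM.
  - move=> u _; rewrite lee_fin -mulrDl mulrA ler_wpM2r//.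
    apply: le_trans (powR_add_le s1 (normr_ge0 eta) (normr_ge0 u)).
    apply: ge0_ler_powR; rewrite ?nnegrE//; try exact: ler_normB.
    - by lra.
have mI1 : measurable_fun setT (fun u => `|eta| * h u) by apply: measurable_funM.
have mI2 : measurable_fun setT (fun u : R => `|u| `^ s * h u) by exact: measurable_funM.
under eq_integral do rewrite EFinM EFinD.
rewrite ge0_integralZl_EFin//; last 2 first.
- by move=> u _; rewrite -EFinD lee_fin addr_ge0// mulr_ge0 ?powR_ge0.
- by apply: emeasurable_funD; exact/measurable_EFinP.
rewrite ge0_integralD//; last 4 first.
- by move=> u _; rewrite lee_fin mulr_ge0.
- exact/measurable_EFinP.
- by move=> u _; rewrite lee_fin mulr_ge0 ?powR_ge0.
- exact/measurable_EFinP.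
apply: (@le_trans _ _ (c%:E * (`|eta| + d)%:E)%E).
  rewrite lee_wpmul2l ?lee_fin// EFinD; apply: leeD; last first.
    by rewrite (le_trans hM)// lee_fin.
  under eq_integral do rewrite EFinM.
  rewrite ge0_integralZl_EFin//.
  - by rewrite -[leRHS]mule1 lee_wpmul2l.
  - by move=> u _; rewrite lee_fin.
  - exact/measurable_EFinP.
rewrite -EFinM lee_fin.
have A0 : 0 <= `|eta| + d by rewrite addr_ge0.
rewrite -(mulr_powRB1 A0); last by lra.
rewrite mulrC ler_wpM2l// /c.
have en := normr_ge0 eta.
by apply: ge0_ler_powR; rewrite ?nnegrE//; lra.
Qed.

End WindowMoment.

Section Shifts.
Variable R : realType.
Implicit Types x y : R.

Lemma ler_dist2 x y : `|y - x| <= 1 -> `|x| + 2 <= `|y| + 3.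
Proof.
move=> yx; have : `|x| <= `|y| + `|y - x|.
  by have := ler_normB y (y - x); rewrite opprB addrC subrK.
by move: (`|x|) (`|y|) (`|y - x|) yx => u v t; lra.
Qed.

Lemma ler_sqr_shift x y : `|y - x| <= 1 -> 1 + y ^+ 2 <= (`|x| + 2) ^+ 2.
Proof.
rewrite distrC => /ler_dist2; rewrite -(real_normK (num_real y)).
have := normr_ge0 y; have := normr_ge0 x.
by move: (`|x|) (`|y|) => u v; nra.
Qed.

(** The term subtracted in the tangent inequality is absorbed in the left-hand
    side, with constant exactly 1. *)
Lemma young_absorb (r X w s : R) :
  r * X * w <= s + (r - 1) * X * w -> X * w <= s.
Proof. by rewrite mulrBl mul1r mulrBl addrA lerBrDr [s + _]addrC lerD2l. Qed.

End Shifts.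

Section NullFourier.
Variable R : realType.
Notation mu := (@lebesgue_measure R).

(** Recovers pointwise vanishing from a zero L^2 norm: a function equal to 0
    almost everywhere has zero transform, and by inversion a function of the
    space is itself a transform. *)
Lemma fourier_null (F : R -> R[i]) y : cintegrable F ->
  (\int[mu]_x (modulus (F x) ^+ 2)%:E = 0)%E -> fourier F y = 0.
Proof.
move=> Fi F2; have mF : complex_measurable F by case: Fi.
have mF2 : measurable_fun setT (fun x => (modulus (F x) ^+ 2)%:E).
  by apply/measurable_EFinP; exact: measurable_sqr_modulus.
have mF1 : measurable_fun setT (fun x => (modulus (F x))%:E).
  by apply/measurable_EFinP; exact: measurable_modulus.
have ae2 : ae_eq mu setT (fun x => (modulus (F x) ^+ 2)%:E) (cst 0%E).
  apply/(ae_eq_integral_abs mu measurableT mF2).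
  by rewrite -[RHS]F2; apply: eq_integral => x _; rewrite gee0_abs// lee_fin sqr_ge0.
have F1 : (\int[mu]_x (modulus (F x))%:E = 0)%E.
  transitivity (\int[mu]_x (cst 0 x : \bar R))%E; last exact: integral0.
  apply: ae_eq_integral => //.
  apply: filterS ae2 => x /= H _.
  by have [/eqP] := H I; rewrite sqrf_eq0 => /eqP ->.
apply: modulus_eq0; apply/eqP; rewrite eq_le modulus_ge0 andbT.
apply: (le_trans (modulus_fourier y Fi)).
by rewrite /Rintegral F1.
Qed.

End NullFourier.

(** * The localized energy inequality *)

Section Core.
Variable R : realType.
Notation mu := (@lebesgue_measure R).
Variables (f : R -> R[i]) (g : R -> R) (K M r d : R) (lam nu : int -> R).
Hypotheses (mf : complex_measurable f).
Hypothesis (cr : continuous (fun x => complex.Re (f x))).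
Hypothesis (ci : continuous (fun x => complex.Im (f x))).
Hypotheses (fE : (weighted_energy f < +oo)%E).
Hypothesis (hatfE : (weighted_energy (fourier f) < +oo)%E).
Hypothesis (cg : continuous g).
Hypothesis (g0 : forall x, 1 < `|x| -> g x = 0).
Hypothesis (gK : forall x, `|g x| <= K).
Hypothesis (g1 : (\int[mu]_x (g x ^+ 2)%:E = 1)%E).
Hypothesis (gM : (\int[mu]_z (`|z| `^ (2 * r) *
  modulus (fourier (fun x => (g x)%:C%C) z) ^+ 2)%:E <= M%:E)%E).
Hypotheses (r1 : 1 <= r) (d1 : 1 <= d) (Md : M <= d).
Hypotheses (lamS : int_strictly_increasing lam) (lamoo : int_diverges lam).
Hypotheses (nuS : int_strictly_increasing nu) (nuoo : int_diverges nu).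
Hypothesis (lamgap : gap_condition r^-1 3 lam).
Hypothesis (nugap : gap_condition r d nu).
Hypothesis (flam : forall j, f (lam j) = 0).
Hypothesis (hatfnu : forall j, fourier f (nu j) = 0).

Let r0 : 0 < r. Proof. exact: lt_le_trans r1. Qed.

Let mg : measurable_fun setT g.
Proof. by apply: continuous_measurable_fun. Qed.

Let fi : cintegrable f. Proof. exact: cintegrable_energy. Qed.

Let mhatf : complex_measurable (fourier f).
Proof. exact: complex_measurable_fourier. Qed.

Let hatfi : cintegrable (fourier f). Proof. exact: cintegrable_energy. Qed.

Let F x := conjc (fourier f x).

Let Fi : cintegrable F. Proof. exact: cintegrableJ. Qed.

Let fF y : f y = conjc (fourier F y).
Proof.
have H : fourier F y = conjc (f y) by apply: fourier_inversion; [| |exact: cr|exact: ci].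
by rewrite H conjcK.
Qed.

Let gi : cintegrable (fun x => (g x)%:C%C).
Proof.
apply: cintegrable_energy; first exact: complex_measurable_real.
rewrite weighted_energyE; last exact: complex_measurable_real.
have sq x : modulus (g x)%:C%C ^+ 2 = g x ^+ 2.
  by rewrite modulus_real real_normK ?num_real.
under eq_integral do rewrite sq; rewrite g1.
apply: lte_add_pinfty; first exact: ltey.
rewrite (@le_lt_trans _ _ (\int[mu]_x (g x ^+ 2)%:E)%E) ?g1 ?ltey//.
have mg2 : measurable_fun setT (fun x : R => g x ^+ 2) by exact: measurable_funX.
rewrite -g1; apply: ge0_le_integral => //.
- by move=> x _; rewrite lee_fin mulr_ge0 ?sqr_ge0.
- by apply/measurable_EFinP; apply: measurable_energy_density; exact: complex_measurable_real.
- exact/measurable_EFinP.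
- move=> x _; rewrite lee_fin sq.
  have [x1|x1] := leP `|x| 1; last by rewrite g0// expr0n/= mulr0.
  rewrite ler_piMl ?sqr_ge0// -(real_normK (num_real x)).
  by rewrite exprn_ile1.
Qed.

Let V := stft f g.

Let W x := (\int[mu]_y (modulus (windowed f g x y) ^+ 2)%:E)%E.

Let mwin x : complex_measurable (windowed f g x).
Proof. exact: measurable_windowed. Qed.

Let mwin2 x : measurable_fun setT (fun y => modulus (windowed f g x y) ^+ 2).
Proof. exact: measurable_sqr_modulus. Qed.

Let W0 x : (0 <= W x)%E.
Proof. by apply: integral_ge0 => y _; rewrite lee_fin sqr_ge0. Qed.

Let K0 : 0 <= K. Proof. exact: le_trans (gK 0). Qed.

Let Wfin x : W x \is a fin_num.
Proof.
rewrite ge0_fin_numE//.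
have mf2 : measurable_fun setT (fun y => modulus (f y) ^+ 2) by exact: measurable_sqr_modulus.
have fin : (\int[mu]_y (modulus (f y) ^+ 2)%:E < +oo)%E.
  apply: le_lt_trans fE; rewrite weighted_energyE// leeDl//.
  by apply: integral_ge0 => y _; rewrite lee_fin; apply: mulr_ge0; exact: sqr_ge0.
apply: (@le_lt_trans _ _ (\int[mu]_y ((K ^+ 2)%:E * (modulus (f y) ^+ 2)%:E))%E).
  apply: ge0_le_integral => //.
  - by move=> y _; rewrite lee_fin sqr_ge0.
  - by apply/measurable_EFinP; exact: mwin2.
  - under eq_fun do rewrite -EFinM; apply/measurable_EFinP.
    by apply: measurable_funM => //; exact: measurable_cst.
  - move=> y _; rewrite -EFinM lee_fin modulusM exprMn mulrC ler_wpM2r ?sqr_ge0//.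
    by rewrite modulus_real ler_sqr ?nnegrE.
rewrite ge0_integralZl_EFin ?sqr_ge0//; last 2 first.
- by move=> y _; rewrite lee_fin sqr_ge0.
- exact/measurable_EFinP.
by apply: lte_mul_pinfty => //; rewrite lee_fin sqr_ge0.
Qed.

Let mV : complex_measurable (fun p : R * R => V p.1 p.2).
Proof. exact: measurable_stft. Qed.

Let mVx x : complex_measurable (V x).
Proof. by apply: complex_measurable_fourier. Qed.

(* The weight of the sequence lam at position x; its r-th power is the weight
   of the energy of f. *)
Let P (x : R) := ((`|x| + 2) `^ r^-1) ^+ 2.

Let PE (x : R) : P x `^ r = (`|x| + 2) ^+ 2.
Proof.
have x0 : 0 <= `|x| + 2 by rewrite addr_ge0.
rewrite /P -powR_mulrn ?powR_ge0// -!powRrM -[RHS]powR_mulrn//.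
by congr (_ `^ _); field; rewrite gt_eqF.
Qed.

(** The windowed function is the transform of conj (V x), it vanishes on lam, and
    on its support |y| + 3 >= |x| + 2, so the weight may be taken constant. *)
Let windowed_wirtinger (x : R) : ((P x)%:E * W x <=
  \int[mu]_xi (xi ^+ 2 * modulus (V x xi) ^+ 2)%:E)%E.
Proof.
have [->|Soo] := eqVneq (\int[mu]_xi (xi ^+ 2 * modulus (V x xi) ^+ 2)%:E)%E +oo%E.
  exact: leey.
have Vi : cintegrable (V x).
  apply: cintegrable_energy; first exact: mVx.
  rewrite weighted_energyE; last exact: mVx.
  apply: lte_add_pinfty; last by rewrite ltey.
  have B : (\int[mu]_xi (modulus (V x xi) ^+ 2)%:E <= W x)%E.
    exact: (bessel_stft fi mg gK x).
  apply: (le_lt_trans B); rewrite -ge0_fin_numE; [exact: (Wfin x)|exact: W0].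
pose G xi := conjc (V x xi).
have Gi : cintegrable G by exact: cintegrableJ.
have cgx : continuous (fun y => g (y - x)).
  move=> y; apply: (@continuous_comp _ _ _ (fun y => y - x) g).
    by apply: cvgB; [exact: cvg_id|exact: cvg_cst].
  exact: cg.
have hatG y : fourier G y = conjc (windowed f g x y).
  apply: fourier_inversion => //.
  - exact: cintegrable_windowed.
  - rewrite (_ : (fun y => _) = (fun y => complex.Re (f y) * g (y - x))).
      by apply: cvgM; [exact: cr|exact: cgx].
    by apply/funext => z; rewrite /windowed complex_ReM /= mulr0 subr0.
  - rewrite (_ : (fun y => _) = (fun y => complex.Im (f y) * g (y - x))).
      by apply: cvgM; [exact: ci|exact: cgx].
    by apply/funext => z; rewrite /windowed complex_ImM /= mulr0 add0r.
pose w (y : R) := (`|y| + 3) `^ r^-1.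
have mw : measurable_fun setT w.
  apply: (measurableT_comp (measurable_powR r^-1)).
  by apply: measurable_funD => //; exact: normr_measurable.
have H := @wirtinger_fourier R G lam w Gi lamS lamoo mw (fun y => powR_ge0 _ _) lamgap.
have {}H := H _.
have Gz j : fourier G (lam j) = 0 by rewrite hatG /windowed flam mul0r conjc0.
have {}H := H Gz; move: H.
under eq_integral do rewrite hatG modulusJ.
under [X in (_ <= X)%E -> _]eq_integral do rewrite modulusJ.
apply: le_trans.
rewrite /W -ge0_integralZl_EFin ?sqr_ge0//; last 2 first.
- by move=> y _; rewrite lee_fin sqr_ge0.
- by apply/measurable_EFinP; exact: mwin2.
apply: ge0_le_integral => //.
- by move=> y _; rewrite -EFinM lee_fin; apply: mulr_ge0; exact: sqr_ge0.
- under eq_fun do rewrite -EFinM; apply/measurable_EFinP.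
  by apply: measurable_funM; [exact: measurable_cst|exact: mwin2].
- by apply/measurable_EFinP; apply: measurable_funM; [exact: measurable_funX|exact: mwin2].
move=> y _; rewrite -EFinM lee_fin.
have [yx|yx] := leP `|y - x| 1; last first.
  by rewrite /windowed g0// mulr0 modulus0 expr0n/= !mulr0.
rewrite ler_wpM2r ?sqr_ge0// /P /w ler_sqr ?nnegrE ?powR_ge0//.
apply: ge0_ler_powR; rewrite ?nnegrE; last exact: ler_dist2.
- by rewrite invr_ge0 ltW.
- exact: addr_ge0.
- exact: addr_ge0.
Qed.

(** Integrate the tangent inequality at P x against |V x|^2.  Since the L^2 norm
    of V x is at most that of the windowed function, the subtracted term cancels
    against [windowed_wirtinger] without loss. *)
Let windowed_young (x : R) : (((`|x| + 2) ^+ 2)%:E * W x <=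
  \int[mu]_xi ((xi ^+ 2) `^ r * modulus (V x xi) ^+ 2)%:E)%E.
Proof.
set S := (\int[mu]_xi ((xi ^+ 2) `^ r * modulus (V x xi) ^+ 2)%:E)%E.
have [->|Soo] := eqVneq S +oo%E; first exact: leey.
have mV2 : measurable_fun setT (fun xi => modulus (V x xi) ^+ 2).
  exact: measurable_sqr_modulus.
have mpw : measurable_fun setT (fun xi : R => (xi ^+ 2) `^ r).
  by apply: (measurableT_comp (measurable_powR r)); exact: measurable_funX.
have S0 : (0 <= S)%E.
  by apply: integral_ge0 => xi _; rewrite lee_fin mulr_ge0 ?sqr_ge0 ?powR_ge0.
have Sfin : S \is a fin_num by rewrite (ge0_fin_numE S0) ltey; exact: Soo.
have P0 : 0 <= P x by exact: sqr_ge0.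
pose c := r * P x `^ (r - 1).
have c0 : 0 <= c by rewrite mulr_ge0 ?powR_ge0// ltW.
pose e := (r - 1) * P x `^ r.
have e0 : 0 <= e by rewrite mulr_ge0 ?powR_ge0 ?subr_ge0.
have H1 : (c%:E * ((P x)%:E * W x) <=
    \int[mu]_xi (c * (xi ^+ 2 * modulus (V x xi) ^+ 2))%:E)%E.
  under eq_integral do rewrite EFinM.
  rewrite ge0_integralZl_EFin//; last 2 first.
  - by move=> xi _; rewrite lee_fin; apply: mulr_ge0; exact: sqr_ge0.
  - by apply/measurable_EFinP; exact: measurable_energy_density.
  by apply: lee_wpmul2l; [rewrite lee_fin|exact: windowed_wirtinger].
have H2 : (\int[mu]_xi (c * (xi ^+ 2 * modulus (V x xi) ^+ 2))%:E <=
    S + e%:E * \int[mu]_xi (modulus (V x xi) ^+ 2)%:E)%E.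
  rewrite -ge0_integralZl_EFin//; last 2 first.
  - by move=> xi _; rewrite lee_fin sqr_ge0.
  - exact/measurable_EFinP.
  rewrite /S -ge0_integralD//; last 4 first.
  - by move=> xi _; rewrite lee_fin mulr_ge0 ?sqr_ge0 ?powR_ge0.
  - by apply/measurable_EFinP; exact: measurable_funM.
  - by move=> xi _; rewrite -EFinM lee_fin mulr_ge0 ?sqr_ge0.
  - under eq_fun do rewrite -EFinM; apply/measurable_EFinP.
    by apply: measurable_funM => //; exact: measurable_cst.
  apply: ge0_le_integral => //.
  - move=> xi _; rewrite lee_fin mulr_ge0//; apply: mulr_ge0; exact: sqr_ge0.
  - apply/measurable_EFinP; apply: measurable_funM; first exact: measurable_cst.
    exact: measurable_energy_density.
  - under eq_fun do rewrite -EFinM -EFinD; apply/measurable_EFinP.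
    apply: measurable_funD; first exact: measurable_funM.
    by apply: measurable_funM; [exact: measurable_cst|].
  - move=> xi _; rewrite -EFinM -EFinD lee_fin mulrA -mulrDl ler_wpM2r ?sqr_ge0//.
    exact: powR_tangent r1 P0 (sqr_ge0 xi).
have H3 : (e%:E * \int[mu]_xi (modulus (V x xi) ^+ 2)%:E <= e%:E * W x)%E.
  by apply: lee_wpmul2l; [rewrite lee_fin|exact: (bessel_stft fi mg gK x)].
have := le_trans H1 (le_trans H2 (leeD2l S H3)).
rewrite -(fineK (Wfin x)) -(fineK Sfin) -!EFinM -EFinD !lee_fin /c /e.
have -> : r * P x `^ (r - 1) * (P x * fine (W x)) = r * (P x * P x `^ (r - 1)) * fine (W x).
  by ring.
by rewrite (mulr_powRB1 P0 r0) PE => /young_absorb.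
Qed.

Let ghat := fourier (fun x => (g x)%:C%C).

Let mghat2 : measurable_fun setT (fun z => modulus (ghat z) ^+ 2).
Proof.
by apply: measurable_sqr_modulus; apply: complex_measurable_fourier; case: gi.
Qed.

Let bessel_ghat : (\int[mu]_z (modulus (ghat z) ^+ 2)%:E <= 1)%E.
Proof.
rewrite -g1; apply: (le_trans (bessel gi)).
by under eq_integral do rewrite modulus_real real_normK ?num_real//.
Qed.

Let mF : complex_measurable F. Proof. by case: Fi. Qed.

(** Exchange the integrals, apply [bessel_stft_freq] for each xi, exchange again
    and apply [shifted_moment] to |ghat|^2 for each eta. *)
Let stft_energy_freq :
  (\int[mu]_x \int[mu]_xi ((xi ^+ 2) `^ r * modulus (V x xi) ^+ 2)%:E <=
   \int[mu]_eta (((`|eta| + d) `^ r) ^+ 2 * modulus (fourier f eta) ^+ 2)%:E)%E.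
Proof.
pose k (p : R * R) := ((p.2 ^+ 2) `^ r * modulus (V p.1 p.2) ^+ 2)%:E.
have msq : measurable_fun setT (fun xi : R => (xi ^+ 2) `^ r).
  by apply: (measurableT_comp (measurable_powR r)); exact: measurable_funX.
have mk : measurable_fun setT k.
  apply/measurable_EFinP; apply: measurable_funM.
    by apply: (measurableT_comp msq); exact: measurable_snd.
  exact: measurable_sqr_modulus mV.
have k0 p : (0 <= k p)%E by rewrite lee_fin mulr_ge0 ?sqr_ge0 ?powR_ge0.
rewrite [leLHS](@fubini_tonelli _ _ _ _ R mu mu k mk k0).
pose l (p : R * R) := ((p.1 ^+ 2) `^ r * (modulus (F p.2) ^+ 2 * modulus (ghat (p.2 - p.1)) ^+ 2))%:E.
have mF2 : measurable_fun setT (fun x => modulus (F x) ^+ 2) by exact: measurable_sqr_modulus.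
have ml : measurable_fun setT l.
  apply/measurable_EFinP; apply: measurable_funM.
    by apply: (measurableT_comp msq); exact: measurable_fst.
  apply: measurable_funM; first by apply: (measurableT_comp mF2); exact: measurable_snd.
  by apply: (measurableT_comp mghat2); exact: measurable_funB.
have l0 p : (0 <= l p)%E.
  by rewrite lee_fin mulr_ge0 ?powR_ge0//; apply: mulr_ge0; exact: sqr_ge0.
apply: (@le_trans _ _ (\int[mu]_xi \int[mu]_eta l (xi, eta))%E).
  apply: ge0_le_integral => //.
  - by move=> xi _; apply: integral_ge0 => x _; exact: k0.
  - exact: (@measurable_fun_fubini_tonelli_G _ _ _ _ R mu k mk k0).
  - exact: (@measurable_fun_fubini_tonelli_F _ _ _ _ R mu l ml l0).
  move=> xi _.
  have kE x : k (x, xi) = (((xi ^+ 2) `^ r)%:E * (modulus (V x xi) ^+ 2)%:E)%E by [].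
  have lE eta : l (xi, eta) = (((xi ^+ 2) `^ r)%:E *
    (modulus (F eta) ^+ 2 * modulus (ghat (eta - xi)) ^+ 2)%:E)%E by [].
  under eq_integral do rewrite kE.
  under [in leRHS]eq_integral do rewrite lE.
  have mVxi : measurable_fun setT (fun x => modulus (V x xi) ^+ 2).
    have mV2 := measurable_sqr_modulus mV.
    exact: (measurableT_comp mV2 (pair2_measurable xi)).
  rewrite ge0_integralZl_EFin ?powR_ge0//; last 2 first.
  - by move=> x _; rewrite lee_fin sqr_ge0.
  - exact/measurable_EFinP.
  rewrite ge0_integralZl_EFin ?powR_ge0//; last 2 first.
  - by move=> x _; rewrite lee_fin; apply: mulr_ge0; exact: sqr_ge0.
  - apply/measurable_EFinP; apply: measurable_funM => //.
    by apply: (measurableT_comp mghat2); apply: measurable_funB.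
  apply: lee_wpmul2l; first by rewrite lee_fin powR_ge0.
  exact: (bessel_stft_freq fi mg gK gi Fi fF xi).
rewrite [leLHS](@fubini_tonelli _ _ _ _ R mu mu l ml l0).
apply: ge0_le_integral => //.
- by move=> eta _; apply: integral_ge0 => x _; exact: l0.
- exact: (@measurable_fun_fubini_tonelli_G _ _ _ _ R mu l ml l0).
- apply/measurable_EFinP; apply: measurable_funM.
    apply: measurable_funX; apply: (measurableT_comp (measurable_powR r)).
    by apply: measurable_funD => //; exact: normr_measurable.
  exact: measurable_sqr_modulus.
move=> eta _.
have lE xi : l (xi, eta) = ((modulus (F eta) ^+ 2)%:E *
    ((xi ^+ 2) `^ r * modulus (ghat (eta - xi)) ^+ 2)%:E)%E.
  by rewrite -EFinM mulrCA.
under eq_integral do rewrite lE.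
rewrite ge0_integralZl_EFin ?sqr_ge0//; last 2 first.
- by move=> xi _; rewrite lee_fin mulr_ge0 ?powR_ge0 ?sqr_ge0.
- apply/measurable_EFinP; apply: measurable_funM => //.
  by apply: (measurableT_comp mghat2); apply: measurable_funB.
have -> : (((`|eta| + d) `^ r) ^+ 2 * modulus (fourier f eta) ^+ 2)%:E =
    ((modulus (F eta) ^+ 2)%:E * (((`|eta| + d) `^ r) ^+ 2)%:E)%E.
  by rewrite -EFinM mulrC /F modulusJ.
apply: lee_wpmul2l; first by rewrite lee_fin sqr_ge0.
have -> : ((`|eta| + d) `^ r) ^+ 2 = (`|eta| + d) `^ (2 * r).
  by rewrite mulrC powRrM powR_mulrn// powR_ge0.
apply: (shifted_moment (M := M) (h := fun z => modulus (ghat z) ^+ 2)) => //.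
by move=> z; exact: sqr_ge0.
Qed.

(** For fixed y the translates g (y - x) are supported where |x - y| <= 1 and
    have norm 1, so averaging over x recovers |f y|^2 with a weight of at least
    1 + y^2. *)
Let stft_energy_time : (weighted_energy f <=
  \int[mu]_x (((`|x| + 2) ^+ 2)%:E * W x))%E.
Proof.
pose k (p : R * R) := ((`|p.1| + 2) ^+ 2 * modulus (windowed f g p.1 p.2) ^+ 2)%:E.
have mf2 : measurable_fun setT (fun x => modulus (f x) ^+ 2) by exact: measurable_sqr_modulus.
have mg2 : measurable_fun setT (fun x : R => g x ^+ 2) by exact: measurable_funX.
have kE p : k p = ((`|p.1| + 2) ^+ 2 * (modulus (f p.2) ^+ 2 * g (p.2 - p.1) ^+ 2))%:E.
  by rewrite /k /windowed modulusM modulus_real exprMn real_normK ?num_real.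
have mX : measurable_fun setT (fun x : R => (`|x| + 2) ^+ 2).
  by apply: measurable_funX; apply: measurable_funD => //; exact: normr_measurable.
have mk : measurable_fun setT k.
  rewrite (funext kE); apply/measurable_EFinP; apply: measurable_funM.
    by apply: (measurableT_comp mX); exact: measurable_fst.
  apply: measurable_funM; first by apply: (measurableT_comp mf2); exact: measurable_snd.
  by apply: (measurableT_comp mg2); exact: measurable_funB.
have k0 p : (0 <= k p)%E by rewrite lee_fin; apply: mulr_ge0; exact: sqr_ge0.
have -> : (\int[mu]_x (((`|x| + 2) ^+ 2)%:E * W x) = \int[mu]_x \int[mu]_y k (x, y))%E.
  apply: eq_integral => x _; rewrite /W -ge0_integralZl_EFin ?sqr_ge0//.
  - by move=> y _; rewrite lee_fin sqr_ge0.
  - by apply/measurable_EFinP; exact: mwin2.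
rewrite [leRHS](@fubini_tonelli _ _ _ _ R mu mu k mk k0).
apply: ge0_le_integral => //.
- by move=> y _; rewrite lee_fin mulr_ge0 ?sqr_ge0// addr_ge0 ?sqr_ge0.
- apply/measurable_EFinP; apply: measurable_funM => //.
  by apply: measurable_funD => //; exact: measurable_funX.
- exact: (@measurable_fun_fubini_tonelli_G _ _ _ _ R mu k mk k0).
move=> y _; set c := (1 + y ^+ 2) * modulus (f y) ^+ 2.
have c0 : 0 <= c by rewrite mulr_ge0 ?sqr_ge0// addr_ge0 ?sqr_ge0.
have mgy : measurable_fun setT (fun x : R => g (y - x) ^+ 2).
  by apply: (measurableT_comp mg2); apply: measurable_funB.
have gy1 : (\int[mu]_x (g (y - x) ^+ 2)%:E = 1)%E.
  rewrite -g1 -(@ge0_integral_shift _ (fun x => (g x ^+ 2)%:E) y); last 2 first.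
  - exact/measurable_EFinP.
  - by move=> x; rewrite lee_fin sqr_ge0.
  rewrite -(@ge0_integral_reflect _ (fun x => (g (x + y) ^+ 2)%:E)); last 2 first.
  - apply/measurable_EFinP; apply: (measurableT_comp mg2).
    by apply: measurable_funD.
  - by move=> x; rewrite lee_fin sqr_ge0.
  by apply: eq_integral => x _; rewrite addrC.
apply: (@le_trans _ _ (\int[mu]_x (c%:E * (g (y - x) ^+ 2)%:E))%E).
  rewrite ge0_integralZl_EFin//; last 2 first.
  - by move=> x _; rewrite lee_fin sqr_ge0.
  - exact/measurable_EFinP.
  by rewrite gy1 mule1.
apply: ge0_le_integral => //.
- by move=> x _; rewrite -EFinM lee_fin mulr_ge0 ?sqr_ge0.
- under eq_fun do rewrite -EFinM; apply/measurable_EFinP.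
  by apply: measurable_funM => //; exact: measurable_cst.
- exact: (measurableT_comp mk (pair2_measurable y)).
move=> x _; rewrite kE -EFinM lee_fin /=.
have [yx|yx] := leP `|y - x| 1; last by rewrite g0// expr0n/= !mulr0.
rewrite /c -mulrA ler_wpM2r//; first by apply: mulr_ge0; exact: sqr_ge0.
exact: ler_sqr_shift.
Qed.

(** The chain of inequalities closes up as N + E <= E with E finite. *)
Lemma uniqueness_core x : f x = 0.
Proof.
pose E := (\int[mu]_y (y ^+ 2 * modulus (f y) ^+ 2)%:E)%E.
pose N := (\int[mu]_y (modulus (f y) ^+ 2)%:E)%E.
have mf2 : measurable_fun setT (fun x => modulus (f x) ^+ 2) by exact: measurable_sqr_modulus.
have fEN : weighted_energy f = (N + E)%E by exact: weighted_energyE.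
have N0 : (0 <= N)%E by apply: integral_ge0 => y _; rewrite lee_fin sqr_ge0.
have E0 : (0 <= E)%E.
  by apply: integral_ge0 => y _; rewrite lee_fin; apply: mulr_ge0; exact: sqr_ge0.
have mX : measurable_fun setT (fun x : R => (`|x| + 2) ^+ 2).
  by apply: measurable_funX; apply: measurable_funD => //; exact: normr_measurable.
have mWx : measurable_fun setT W.
  pose k (p : R * R) := (modulus (windowed f g p.1 p.2) ^+ 2)%:E.
  have mk : measurable_fun setT k.
    apply/measurable_EFinP; apply: measurable_sqr_modulus.
    apply: complex_measurableM; first exact: (complex_measurable_comp mf measurable_snd).
    apply: complex_measurable_real; apply: (measurableT_comp mg).
    exact: measurable_funB.
  apply: (@measurable_fun_fubini_tonelli_F _ _ _ _ R mu k mk) => p.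
  by rewrite lee_fin sqr_ge0.
have mS : measurable_fun setT
    (fun x => \int[mu]_xi ((xi ^+ 2) `^ r * modulus (V x xi) ^+ 2)%:E)%E.
  pose k (p : R * R) := ((p.2 ^+ 2) `^ r * modulus (V p.1 p.2) ^+ 2)%:E.
  have msq : measurable_fun setT (fun xi : R => (xi ^+ 2) `^ r).
    by apply: (measurableT_comp (measurable_powR r)); exact: measurable_funX.
  have mk : measurable_fun setT k.
    apply/measurable_EFinP; apply: measurable_funM.
      by apply: (measurableT_comp msq); exact: measurable_snd.
    exact: measurable_sqr_modulus mV.
  apply: (@measurable_fun_fubini_tonelli_F _ _ _ _ R mu k mk) => p.
  by rewrite lee_fin mulr_ge0 ?powR_ge0 ?sqr_ge0.
have II : (\int[mu]_eta (((`|eta| + d) `^ r) ^+ 2 * modulus (fourier f eta) ^+ 2)%:E <= E)%E.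
  apply: (wirtinger_fourier (w := fun eta => (`|eta| + d) `^ r) fi nuS nuoo).
  - apply: (measurableT_comp (measurable_powR r)).
    by apply: measurable_funD => //; exact: normr_measurable.
  - by move=> y; exact: powR_ge0.
  - exact: nugap.
  - exact: hatfnu.
have TS : (\int[mu]_x (((`|x| + 2) ^+ 2)%:E * W x) <=
    \int[mu]_x \int[mu]_xi ((xi ^+ 2) `^ r * modulus (V x xi) ^+ 2)%:E)%E.
  apply: ge0_le_integral.
  - exact: measurableT.
  - by move=> y _; apply: mule_ge0; [rewrite lee_fin sqr_ge0|exact: W0].
  - by apply: emeasurable_funM; [exact/measurable_EFinP|exact: mWx].
  - exact: mS.
  - by move=> y _; exact: windowed_young.
have NE : (N + E <= E)%E.
  rewrite -fEN; apply: (le_trans stft_energy_time); apply: (le_trans TS).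
  exact: le_trans stft_energy_freq II.
have Efin : E \is a fin_num.
  rewrite (ge0_fin_numE E0); apply: le_lt_trans fE; rewrite fEN leeDr//.
have NZ : N = 0%E.
  apply/eqP; rewrite eq_le N0 andbT.
  by move: NE; rewrite -[leRHS]add0e leeD2rE.
have FZ : (\int[mu]_x (modulus (F x) ^+ 2)%:E = 0)%E.
  apply/eqP; rewrite eq_le; apply/andP; split.
    rewrite -[leRHS]NZ; under eq_integral do rewrite /F modulusJ.
    exact: bessel.
  by apply: integral_ge0 => y _; rewrite lee_fin sqr_ge0.
by rewrite fF (fourier_null x Fi FZ) conjc0.
Qed.

End Core.

(** * Uniqueness pairs *)

Section Components.
Variable R : realType.

Let continuous_component (f : R -> R[i]) (c : R[i] -> R) :
  (forall z w, c z - c w = c (z - w)) -> (forall z, `|c z| <= modulus z) ->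
  continuous (f : R -> R[i]^o) -> continuous (fun x => c (f x)).
Proof.
move=> cB cle cf x; apply/cvgrPdist_lt => e e0.
have e0' : 0 < (e%:C%C : R[i]) by rewrite ltcR.
have /cvgrPdist_lt/(_ _ e0') := cf x.
apply: filterS => y; rewrite normc_def -/(modulus _) ltcR => H.
rewrite cB (le_lt_trans (cle _))//.
by case: (f x - f y) H.
Qed.

Lemma continuous_Re (f : R -> R[i]) :
  continuous (f : R -> R[i]^o) -> continuous (fun x => complex.Re (f x)).
Proof.
apply: continuous_component; last exact: ler_Re.
by case=> a b [a' b'].
Qed.

Lemma continuous_Im (f : R -> R[i]) :
  continuous (f : R -> R[i]^o) -> continuous (fun x => complex.Im (f x)).
Proof.
apply: continuous_component; last exact: ler_Im.
by case=> a b [a' b'].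
Qed.

End Components.

Section UniquenessPairs.
Variable R : realType.

(** The choice of d, made before f and the sequences are given: it depends on r
    through the window only. *)
Lemma uniqueness_threshold (r : R) : 1 <= r ->
  exists2 d : R, 0 <= d & forall (f : R -> R[i]) (lam nu : int -> R),
    complex_measurable f ->
    continuous (fun x => complex.Re (f x)) ->
    continuous (fun x => complex.Im (f x)) ->
    (weighted_energy f < +oo)%E -> (weighted_energy (fourier f) < +oo)%E ->
    int_strictly_increasing lam -> int_diverges lam ->
    int_strictly_increasing nu -> int_diverges nu ->
    gap_condition r^-1 3 lam -> gap_condition r d nu ->
    (forall j, f (lam j) = 0) -> (forall j, fourier f (nu j) = 0) ->
    forall x, f x = 0.
Proof.
move=> r1; have s0 : 0 <= 2 * r by rewrite mulr_ge0// (le_trans ler01).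
have [g [M [cg g0 [K gK] g1 gM]]] := exists_window s0.
have d1 : 1 <= Num.max 1 M by rewrite le_max lexx.
have dM : M <= Num.max 1 M by rewrite le_max lexx orbT.
exists (Num.max 1 M); first exact: le_trans d1.
move=> f lam nu mf cr ci e1 e2 lamS lamoo nuS nuoo lamgap nugap flam hatfnu.
exact: (uniqueness_core mf cr ci e1 e2 cg g0 gK g1 gM r1 d1 dM lamS lamoo nuS nuoo
  lamgap nugap flam hatfnu).
Qed.

(** Exchanges the roles of the two sequences: the conjugate of [fourier f]
    satisfies the same hypotheses as f, and its own transform is the conjugate
    of f. *)
Lemma conj_fourier_swap (f : R -> R[i]) : complex_measurable f ->
  continuous (fun x => complex.Re (f x)) ->
  continuous (fun x => complex.Im (f x)) ->
  (weighted_energy f < +oo)%E -> (weighted_energy (fourier f) < +oo)%E ->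
  let F x := conjc (fourier f x) in
  [/\ cintegrable F, continuous (fun x => complex.Re (F x)),
      continuous (fun x => complex.Im (F x)), (weighted_energy F < +oo)%E &
      forall y, fourier F y = conjc (f y)].
Proof.
move=> mf cr ci e1 e2 F.
have fi : cintegrable f by exact: cintegrable_energy.
have hfi : cintegrable (fourier f).
  by apply: cintegrable_energy e2; exact: complex_measurable_fourier.
split.
- exact: cintegrableJ.
- rewrite (_ : (fun x => _) = (fun x => complex.Re (fourier f x))).
    exact: continuous_Re_fourier.
  by apply/funext => x; rewrite complex_ReJ.
- rewrite (_ : (fun x => _) = (fun x => - complex.Im (fourier f x))).
    by move=> x; apply: cvgN; exact: continuous_Im_fourier.
  by apply/funext => x; rewrite complex_ImJ.
- rewrite (_ : weighted_energy F = weighted_energy (fourier f))//.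
  by apply: eq_integral => x _; rewrite modulusJ.
- by move=> y; apply: fourier_inversion; [| |exact: cr|exact: ci].
Qed.

End UniquenessPairs.

Theorem corollary1 (R : realType) (p q : R) (hp : 1 < p) (hq : 1 < q)
    (hpq : p^-1 + q^-1 = 1) :
  exists d_p d_q : R,
    forall lam mu : int -> R,
      int_strictly_increasing lam -> int_strictly_increasing mu ->
      int_diverges lam -> int_diverges mu ->
      (gap_sup p d_p lam <= (2^-1)%:E)%E ->
      (gap_sup q d_q mu <= (2^-1)%:E)%E ->
      fourier_uniqueness_pair (range lam) (range mu).
Proof.
have p0 : 0 < p - 1 by rewrite subr_gt0.
have q0 : 0 < q - 1 by rewrite subr_gt0.
have pq : (p - 1) * (q - 1) = 1.
  have pn : p != 0 by rewrite gt_eqF// (lt_trans ltr01).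
  have qn : q != 0 by rewrite gt_eqF// (lt_trans ltr01).
  have : (p^-1 + q^-1) * (p * q) = p * q by rewrite hpq mul1r.
  rewrite mulrDl mulrA mulVf// mul1r [p * q]mulrC mulrA mulVf// mul1r => H.
  by rewrite mulrBl mulrBr !mulr1 mul1r; move: H; lra.
have inH (f : R -> R[i]) : in_H f -> [/\ complex_measurable f, (weighted_energy f < +oo)%E &
    (weighted_energy (fourier f) < +oo)%E].
  move=> [[mf _] fE].
  have e0 h : (0 <= weighted_energy h)%E.
    by apply: integral_ge0 => x _; rewrite lee_fin mulr_ge0 ?sqr_ge0// addr_ge0 ?sqr_ge0.
  split; [exact: mf|apply: le_lt_trans fE; rewrite leeDl//; exact: e0|].
  by apply: le_lt_trans fE; rewrite leeDr//; exact: e0.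
have [q2|q2] := leP 1 (q - 1).
  have [d d0 H] := uniqueness_threshold q2.
  (* the extra unit is the one that gap_condition_of_sup spends *)
  exists (3 + 1), (d + 1) => lam nu lamS nuS lamoo nuoo lamg nug f fH cf flam hatfnu.
  have [mf e1 e2] := inH f fH.
  have rE : (q - 1)^-1 = p - 1 by apply: (mulIf (lt0r_neq0 q0)); rewrite mulVf ?lt0r_neq0// pq.
  apply: (H f lam nu mf (continuous_Re cf) (continuous_Im cf) e1 e2 lamS lamoo nuS nuoo).
  - by rewrite rE; exact: gap_condition_of_sup lamg.
  - exact: gap_condition_of_sup nug.
  - by move=> j; apply: flam; exists j.
  - by move=> j; apply: hatfnu; exists j.
have p2 : 1 <= p - 1 by move: (p - 1) (q - 1) pq p0 q0 q2 => a b; nra.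
have [d d0 H] := uniqueness_threshold p2.
exists (d + 1), (3 + 1) => lam nu lamS nuS lamoo nuoo lamg nug f fH cf flam hatfnu.
have [mf e1 e2] := inH f fH.
have rE : (p - 1)^-1 = q - 1 by apply: (mulfI (lt0r_neq0 p0)); rewrite mulfV ?lt0r_neq0// pq.
have cr := continuous_Re cf; have ci := continuous_Im cf.
(* here q - 1 < 1 < p - 1: exchange the two sequences *)
have [Fi cFr cFi FE hatF] := conj_fourier_swap mf cr ci e1 e2.
set F := (fun x => conjc (fourier f x)) in Fi cFr cFi FE hatF.
have hatFE : (weighted_energy (fourier F) < +oo)%E.
  rewrite (_ : weighted_energy (fourier F) = weighted_energy f)//.
  by apply: eq_integral => x _; rewrite hatF modulusJ.
have FZ : forall x, F x = 0.
  apply: (H F nu lam (proj1 Fi) cFr cFi FE hatFE nuS nuoo lamS lamoo).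
  - by rewrite rE; exact: gap_condition_of_sup nug.
  - exact: gap_condition_of_sup lamg.
  - by move=> j; rewrite /F hatfnu ?conjc0//; exists j.
  - by move=> j; rewrite hatF flam ?conjc0//; exists j.
move=> x; rewrite -(conjcK (f x)) -hatF (fourier_null x Fi) ?conjc0//.
by apply: integral0_eq => y _; rewrite FZ modulus0 expr0n.
Qed.
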